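(* Consider \[ \frac{d}{dt}\left[x(t)-\int_0^{\tau_1}\mathbf g(x(t-s))\,ds\right]=-a\,x(t)-\alpha\,\mathbf f\!\left(\int_0^{\tau_2}x(t-s)\,ds\right)-\mathbf h(x(t)),\qquad x(t)\in\mathbb R^n . \] Denote by $\alpha_0$ the smallest $\alpha>0$ such that, for some $j$ and some $\beta>0$, \[ \alpha=-\beta\,\frac{\gamma(\cos(\beta\tau_1)-1)+a_j}{b\sin(\beta\tau_2)},\qquad \beta=\gamma\sin(\beta\tau_1)+\frac{(\gamma(\cos(\beta\tau_1)-1)+a_j)(\cos(\beta\tau_2)-1)}{\sin(\beta\tau_2)} . \] If $0<\gamma\tau_1\le1$, $b>0$, and $a_j>0$ for all $j$, then $x\equiv0$ is a locally asymptotically stable consensus equilibrium for all $\alpha\in(0,\alpha_0)$.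
   Context: Here $a>0$, $\tau_1,\tau_2>0$ are constants, $\alpha$ is a real parameter, $\mathbf f(x)=(f(x_1),\dots,f(x_n))^T$ and $\mathbf g(x)=(g(x_1),\dots,g(x_n))^T$ with $f,g:\mathbb R\to\mathbb R$, and $\mathbf h:\mathbb R^n\to\mathbb R^n$. $\Gamma_0\le S_n$ is a finite group acting on $V=\mathbb R^n$ by permuting components, $\Gamma=\Gamma_0\times\mathbb Z_2$ with $\mathbb Z_2$ acting antipodally. Standing assumptions: (1) $\mathbf f,\mathbf g,\mathbf h$ are $\Gamma$-equivariant (hence odd); (2) $\mathbf f,\mathbf g,\mathbf h$ are continuous and differentiable at $0$; with $b:=f'(0)$, $\gamma:=g'(0)$, $C:=D\mathbf h(0)$ one has $b\ne0$, $0<\gamma<1$, and $C$ is a $\Gamma$-equivariant symmetric matrix; (3) there is $\kappa\in[0,1)$ such that $\mathbf g$ is Lipschitz with constant $\kappa$. The eigenvalues of $C$ are $\mu_0,\dots,\mu_r$, with eigenspaces $E(\mu_j)$ equal to the $\Gamma$-isotypic components $V_j$ of $V=V_0\oplus\dots\oplus V_r$; $a_j:=a+\mu_j$. A consensus state is one with $x_1=\dots=x_n$.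
   Formalization: In defining α₀, the 0/0 case sin(βτ₂)=0=γ(cos(βτ₁)−1)+a_j is also counted, with α fixed by β−γ sin(βτ₁)=(αb/β)(1−cos(βτ₂)); without these imaginary roots the claim fails (e.g. τ₁=τ₂=1, γ=1/2, b=1, a_j=1,2, α=π²/2). *)

(* Defs.v *)
(* MathComp / MathComp-Analysis world. *)
From HB Require Import structures.
From mathcomp Require Import all_boot all_order all_algebra all_fingroup.
From mathcomp Require Import mxrepresentation.
From mathcomp Require Import all_classical all_reals all_analysis.
Set Implicit Arguments.
Unset Strict Implicit.
Unset Printing Implicit Defensive.
Import Order.TTheory GRing.Theory Num.Theory.
Import numFieldNormedType.Exports.
Local Open Scope classical_set_scope.
Local Open Scope ring_scope.

(* States are row vectors, on which matrices act from the right; the i-th entry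
   of [v *m perm_mx s] is the entry of [v] at [s^-1 i].  The nontrivial element
   of ['Z_2] acts as -1. *)
Definition Gam (n : nat) (Gamma0 : {group 'S_n}) : {group 'S_n * 'Z_2} :=
  setX_group Gamma0 [group of [set: 'Z_2]].

Definition Gam_mx (R : realType) (n : nat) (p : 'S_n * 'Z_2) : 'M[R]_n :=
  (-1) ^+ (p.2 : nat) *: perm_mx p.1.

Fact Gam_mx_repr (R : realType) (n : nat) (Gamma0 : {group 'S_n}) :
  mx_repr (Gam Gamma0) (@Gam_mx R n).
Proof.
split=> [|[s z] [s' z'] _ _]; rewrite /Gam_mx /=.
  by rewrite expr0 scale1r perm_mx1.
rewrite perm_mxM -scalemxAl -scalemxAr scalerA -exprD; congr (_ *: _).
by case: z z' => [[|[|//]] ?] [[|[|//]] ?]; rewrite /= ?expr0 ?expr1 // expr2 mulrNN mulr1.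
Qed.

Definition Gam_repr (R : realType) (n : nat) (Gamma0 : {group 'S_n}) :
    mx_representation R (Gam Gamma0) n :=
  MxRepresentation (Gam_mx_repr R Gamma0).

Definition equivariant (R : realType) (n : nat) (Gamma0 : {group 'S_n})
    (F : 'rV[R]_n -> 'rV[R]_n) : Prop :=
  forall p, p \in Gam Gamma0 ->
    forall v, F (v *m Gam_repr R Gamma0 p) = F v *m Gam_repr R Gamma0 p.

Definition equivariant_mx (R : realType) (n : nat) (Gamma0 : {group 'S_n})
    (C : 'M[R]_n) : Prop :=
  forall p, p \in Gam Gamma0 ->
    Gam_repr R Gamma0 p *m C = C *m Gam_repr R Gamma0 p.

(* [component_mx rG M] is the sum of all subrepresentations isomorphic to the
   irreducible subrepresentation [M]. *)
Definition isotypic_component (R : realType) (n : nat) (Gamma0 : {group 'S_n})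
    (W : 'M[R]_n) : Prop :=
  exists2 M : 'M[R]_n, mxsimple (Gam_repr R Gamma0) M &
    (W :=: component_mx (Gam_repr R Gamma0) M)%MS.

(* Subspaces are row spaces of matrices. *)
Definition isotypic_decomposition (R : realType) (n r : nat)
    (Gamma0 : {group 'S_n}) (V_ : 'I_r.+1 -> 'M[R]_n) : Prop :=
  [/\ forall j, isotypic_component Gamma0 (V_ j),
      forall W, isotypic_component Gamma0 W -> exists j, (W :=: V_ j)%MS,
      (\sum_j V_ j :=: 1%:M)%MS
    & mxdirect (\sum_j V_ j)%MS].

Record nfde (R : realType) (n : nat) := Nfde {
  nf_a : R;
  nf_tau1 : R;
  nf_tau2 : R;
  nf_alpha : R;
  nf_f : R -> R;
  nf_g : R -> R;
  nf_h : 'rV[R]_n -> 'rV[R]_n }.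

Definition delay (R : realType) (n : nat) (S : nfde R n) : R :=
  Num.max (nf_tau1 S) (nf_tau2 S).

Definition vint (R : realType) (n : nat) (tau : R) (F : R -> 'rV[R]_n) :
    'rV[R]_n :=
  \row_i (\int[@lebesgue_measure R]_(s in `[0, tau]) F s 0 i)%R.

Definition nf_lhs (R : realType) (n : nat) (S : nfde R n) (x : R -> 'rV[R]_n)
    (t : R) : 'rV[R]_n :=
  x t - vint (nf_tau1 S) (fun s => map_mx (nf_g S) (x (t - s))).

Definition nf_rhs (R : realType) (n : nat) (S : nfde R n) (x : R -> 'rV[R]_n)
    (t : R) : 'rV[R]_n :=
  - (nf_a S *: x t)
  - nf_alpha S *: map_mx (nf_f S) (vint (nf_tau2 S) (fun s => x (t - s)))
  - nf_h S (x t).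

(* Solutions on [-delay, T[ with T possibly infinite; the values of [x] outside
   this interval are irrelevant.  Since [x] is continuous on it, the equation
   on ]0, T[ forces the equation for the right derivative at 0. *)
Definition is_solution (R : realType) (n : nat) (S : nfde R n) (T : \bar R)
    (x : R -> 'rV[R]_n) : Prop :=
  {within [set t : R | - delay S <= t /\ (t%:E < T)%E], continuous x} /\
  forall t : R, 0 < t -> (t%:E < T)%E ->
    is_derive t 1 (nf_lhs S x) (nf_rhs S x t).

Definition solution_from (R : realType) (n : nat) (S : nfde R n) (T : \bar R)
    (phi x : R -> 'rV[R]_n) : Prop :=
  is_solution S T x /\ forall s : R, - delay S <= s <= 0 -> x s = phi s.

(* By compactness the pointwise bound says that the sup norm of
   [phi - xs] over [-delay, 0] is less than delta. *)
Definition near_history (R : realType) (n : nat) (S : nfde R n)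
    (xs : 'rV[R]_n) (delta : R) (phi : R -> 'rV[R]_n) : Prop :=
  {within `[- delay S, 0], continuous phi} /\
  forall s : R, - delay S <= s <= 0 -> `|phi s - xs| < delta.

(* The nonlinearities are only continuous, so solutions need not be determined
   by their histories: a global solution has to exist, and every solution, also
   one that is given on a bounded time interval only, has to stay close. *)
Definition stable (R : realType) (n : nat) (S : nfde R n) (xs : 'rV[R]_n) :
    Prop :=
  forall eps : R, 0 < eps -> exists2 delta : R, 0 < delta &
    forall phi, near_history S xs delta phi ->
      (exists x, solution_from S +oo%E phi x) /\
      (forall (T : \bar R) x, solution_from S T phi x ->
         forall t : R, 0 <= t -> (t%:E < T)%E -> `|x t - xs| < eps).

Definition locally_attractive (R : realType) (n : nat) (S : nfde R n)
    (xs : 'rV[R]_n) : Prop :=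
  exists2 delta : R, 0 < delta &
    forall phi, near_history S xs delta phi ->
      forall x, solution_from S +oo%E phi x -> x t @[t --> +oo] --> xs.

Definition locally_asymptotically_stable (R : realType) (n : nat)
    (S : nfde R n) (xs : 'rV[R]_n) : Prop :=
  stable S xs /\ locally_attractive S xs.

Definition equilibrium (R : realType) (n : nat) (S : nfde R n)
    (xs : 'rV[R]_n) : Prop :=
  is_solution S +oo%E (fun _ => xs).

Definition consensus (R : realType) (n : nat) (xs : 'rV[R]_n) : Prop :=
  forall i k, xs 0 i = xs 0 k.

Definition critical_gain (R : realType) (gamma tau1 aj beta : R) : R :=
  gamma * (cos (beta * tau1) - 1) + aj.

(* The formulas are the solution, for sin (beta tau2) <> 0, of the real and
   imaginary parts of the characteristic equation at i beta,
     (alpha b / beta) sin (beta tau2) = - critical_gain,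
     beta - gamma sin (beta tau1) = (alpha b / beta) (1 - cos (beta tau2)).
   Where sin (beta tau2) = 0, the pair forces critical_gain = 0, so that the
   formulas become 0 / 0; alpha is then determined by the second equation. *)
Definition critical_eqs (R : realType) (b gamma tau1 tau2 aj alpha beta : R) :
    Prop :=
  [/\ sin (beta * tau2) != 0,
      alpha = - beta * (critical_gain gamma tau1 aj beta
                        / (b * sin (beta * tau2)))
    & beta = gamma * sin (beta * tau1)
             + critical_gain gamma tau1 aj beta * (cos (beta * tau2) - 1)
               / sin (beta * tau2)]
  \/
  [/\ sin (beta * tau2) = 0,
      critical_gain gamma tau1 aj beta = 0
    & beta - gamma * sin (beta * tau1)
      = alpha * b / beta * (1 - cos (beta * tau2))].

Definition critical (R : realType) (r : nat) (b gamma tau1 tau2 a : R)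
    (mu : 'I_r.+1 -> R) (alpha : R) : Prop :=
  exists (j : 'I_r.+1) (beta : R),
    0 < beta /\ critical_eqs b gamma tau1 tau2 (a + mu j) alpha beta.

Definition smallest_critical (R : realType) (r : nat)
    (b gamma tau1 tau2 a : R) (mu : 'I_r.+1 -> R) (alpha0 : R) : Prop :=
  [/\ 0 < alpha0, critical b gamma tau1 tau2 a mu alpha0
    & forall alpha, 0 < alpha -> critical b gamma tau1 tau2 a mu alpha ->
        alpha0 <= alpha].

(* Main.v *)
Require Import Defs.
From HB Require Import structures.
From mathcomp Require Import all_boot all_order all_algebra all_fingroup.
From mathcomp Require Import mxrepresentation.
From mathcomp Require Import all_classical all_reals all_analysis.
From mathcomp Require Import complex zify ring lra.
Set Implicit Arguments.
Unset Strict Implicit.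
Unset Printing Implicit Defensive.
Import Order.TTheory GRing.Theory Num.Theory.
Import numFieldNormedType.Exports.
Local Open Scope classical_set_scope.
Local Open Scope ring_scope.

(* With X an antiderivative of x the equation reads
     x' = g(x(t)) - g(x(t - tau1)) - a x - alpha f(X(t) - X(t - tau2)) - h(x),
   a retarded equation whose linearization at 0 splits along the eigenspaces of C into
   scalar delay equations, whose imaginary characteristic roots are described by the
   critical equations.

   Exponential stability of the linear part is obtained without complex analysis or a
   spectral theory of delay equations.  The Euler scheme of step 1/M is convolution with a
   polynomial p_M in the one-step delay.  A lower bound c <= |p_M|^2 on the unit circle
   turns, by Parseval, into an l2 estimate of finitely supported sequences; that it also
   controls initial segments, i.e. that p_M has no zeros in the disk, follows by continuation
   from the undelayed equation: first gamma is switched on, where gamma tau1 <= 1 excludes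
   imaginary roots, then alpha, where alpha < alpha0 does.  Uniformity of c in M and in the
   homotopy parameter follows by compactness, a vanishing symbol leading to an imaginary
   root in the limit.  A small gain argument with an exponential weight transfers the
   estimate to the nonlinear equation.  Global solutions are ultralimits of Euler polygons
   of an equation with clipped unknowns. *)

(** A bound on the circle alone cannot tell a stable recursion from an unstable one: Parseval needs
    finite support, while the response to a finitely supported input may grow. Causality enters only
    through [gain], whose quality is irrelevant: any gain, however poor and even depending on [M],
    is sharpened to the constant read off from the circle. Hence the admissible step of the
    continuation never shrinks. Uniformity in [M] is what survives in continuous time: on a fixed
    interval [[0, T]] a sampled solution satisfies the recursion up to an error that vanishes as the
    grid is refined, whereas the constant depends neither on the grid nor on [T]. Energy estimates
    do not see initial data, so a history has to be turned into a forcing of bounded duration.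
    Pointwise bounds return from the energies of the solution and of its difference quotients.
    Differentiability is assumed at 0 only. The remainders are therefore merely small relative to
    the present and delayed values, which is exactly the kind of residual that all the linear
    estimates tolerate. *)

Section Parseval.
Variable R : realType.
Implicit Types (z w : R[i]) (p q y : {poly R}).

Definition nsq z : R := complex.Re z ^+ 2 + complex.Im z ^+ 2.

Definition cis (phi : R) : R[i] := (cos phi +i* sin phi)%C.

Definition ceval p z : R[i] := (map_poly (real_complex R) p).[z].

Definition energy (n : nat) (y : nat -> R) : R := \sum_(i < n) y i ^+ 2.

Lemma nsqM z w : nsq (z * w) = nsq z * nsq w.
Proof. case: z w => [a b] [c d]; rewrite /nsq /=; ring. Qed.

Lemma nsq_ge0 z : 0 <= nsq z.
Proof. by rewrite /nsq addr_ge0 // sqr_ge0. Qed.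

Lemma nsq_cis phi : nsq (cis phi) = 1.
Proof. by rewrite /nsq /= cos2Dsin2. Qed.

Lemma nsqE z : (nsq z)%:C%C = z * z^*%C.
Proof. case: z => [a b]; rewrite /nsq /=; simpc; congr (_ +i* _)%C; ring. Qed.

Lemma cisD (phi psi : R) : cis (phi + psi) = cis phi * cis psi.
Proof.
rewrite /cis; simpc; rewrite cosD sinD; congr (_ +i* _)%C; ring.
Qed.

Lemma cis0 : cis 0 = 1.
Proof. by rewrite /cis cos0 sin0. Qed.

Lemma cisX phi n : cis phi ^+ n = cis (phi *+ n).
Proof.
by elim: n => [|n IH]; rewrite ?expr0 ?mulr0n ?cis0 // exprS IH mulrS cisD.
Qed.

(** Half of the argument lies strictly between 0 and [pi], where the sine is positive, and
    [cos (2 x) = 1 - 2 sin^2 x]. *)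
Lemma cisM_neq1 N k : (0 < k < N)%N -> cis (2 * pi / N%:R) ^+ k != 1.
Proof.
move=> /andP[k0 kN]; rewrite cisX; apply/eqP => -[] + _.
set x : R := pi / N%:R *+ k.
have N0 : 0 < N%:R :> R by rewrite ltr0n (ltn_trans k0 kN).
have x0 : 0 < sin x.
  apply: sin_gt0_pi; rewrite /x -mulr_natr mulrAC divr_gt0 ?mulr_gt0 ?pi_gt0 ?ltr0n ?(ltn_trans k0 kN) //=.
  by rewrite ltr_pdivrMr // ltr_pM2l ?pi_gt0 // ltr_nat.
have -> : 2 * pi / N%:R *+ k = x + x.
  by rewrite /x -mulrnDl; congr (_ *+ _); ring.
rewrite cosD -!expr2 => h; have := cos2Dsin2 x => h2.
have : sin x ^+ 2 = 0 by lra.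
by move/eqP; rewrite sqrf_eq0 gt_eqF.
Qed.

Lemma ceval_sum p N z : (size p <= N)%N ->
  ceval p z = \sum_(i < N) (p`_i)%:C%C * z ^+ i.
Proof.
move=> sp; rewrite /ceval (@horner_coef_wide _ N) ?size_map_poly //.
by apply: eq_bigr => i _; rewrite coef_map.
Qed.

Lemma cevalM p q z : ceval (p * q) z = ceval p z * ceval q z.
Proof. by rewrite /ceval rmorphM hornerM. Qed.

(** Orthogonality of characters: for [i != j] the number [zt^i] times the conjugate of [zt^j] is an
    [N]-th root of unity other than 1, so the geometric sum of its powers vanishes. *)
Lemma parseval y N : (size y <= N)%N ->
  \sum_(k < N) nsq (ceval y (cis (2 * pi / N%:R) ^+ k)) =
  N%:R * energy N (fun i => y`_i).
Proof.
move=> sy; case: N sy => [|N'] sy; first by rewrite big_ord0 mul0r.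
set N := N'.+1 in sy *; set zt := cis _.
have N0 : N%:R != 0 :> R by rewrite pnatr_eq0.
have ztN : zt ^+ N = 1.
  rewrite cisX; have -> : 2 * pi / N%:R *+ N = pi + pi :> R.
    by rewrite -mulr_natr divfK //; ring.
  rewrite /cis cosD sinD cospi sinpi; apply/eqP; rewrite eq_complex /=; apply/andP; split; apply/eqP; ring.
have ztc : zt * zt^*%C = 1 by rewrite -nsqE nsq_cis.
have geo i j : (i < N)%N -> (j < N)%N ->
    \sum_(k < N) (zt ^+ i * zt^*%C ^+ j) ^+ k = (if i == j then N%:R else 0) :> R[i].
  move=> iN jN; case: eqP => [<-|/eqP ij].
    rewrite (eq_bigr (fun=> 1)); first by rewrite sumr_const card_ord.
    by move=> k _; rewrite -exprMn ztc !expr1n.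
  set w := _ * _.
  have wN : w ^+ N = 1.
    by rewrite /w exprMn !(exprAC _ _ N) -rmorphXn ztN rmorph1 !expr1n mulr1.
  have w1 : w != 1.
    have [lij|lji|/eqP] := ltngtP i j; last by rewrite (negbTE ij).
      have -> : w = zt^*%C ^+ (j - i).
        by rewrite /w -{1}(subnK (ltnW lij)) exprD mulrCA -exprMn ztc expr1n mulr1.
      rewrite -rmorphXn -[1](rmorph1 conjc) (inj_eq (inv_inj (@conjcK _))).
      by apply: cisM_neq1; rewrite subn_gt0 lij (leq_ltn_trans _ jN) // leq_subr.
    have -> : w = zt ^+ (i - j).
      by rewrite /w -{1}(subnK (ltnW lji)) exprD -mulrA -exprMn ztc expr1n mulr1.
    by apply: cisM_neq1; rewrite subn_gt0 lji (leq_ltn_trans _ iN) // leq_subr.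
  have := subrX1 w N; rewrite wN subrr => /esym/eqP.
  by rewrite mulf_eq0 subr_eq0 (negbTE w1) => /eqP.
apply: (@complexI R); rewrite rmorph_sum /=.
transitivity (\sum_(k < N) \sum_(i < N) \sum_(j < N)
    ((y`_i)%:C%C * (y`_j)%:C%C) * (zt ^+ i * zt^*%C ^+ j) ^+ k : R[i]).
  apply: eq_bigr => k _; rewrite nsqE (ceval_sum _ sy) rmorph_sum mulr_suml.
  apply: eq_bigr => i _; rewrite mulr_sumr; apply: eq_bigr => j _.
  rewrite rmorphM !rmorphXn /= oppr0 exprMn -!exprM (mulnC i) (mulnC j).
  by rewrite mulrACA.
rewrite exchange_big /= rmorphM rmorph_sum /= mulr_sumr; apply: eq_bigr => i _.
rewrite exchange_big /=.
under eq_bigr => j _ do rewrite -mulr_sumr geo //.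
rewrite (bigD1 i) //= eqxx big1 ?addr0; last first.
  by move=> j ji; rewrite eq_sym val_eqE (negbTE ji) mulr0.
by rewrite rmorphXn rmorph_nat /= expr2 mulrC.
Qed.

(* The N-th roots of unity resolve both sequences, so that Parseval holds for them
   without aliasing. *)
Lemma symbol_bound p y c N :
  (forall phi, - pi <= phi <= pi -> c <= nsq (ceval p (cis phi))) ->
  (size (p * y)%R <= N)%N -> (size y <= N)%N ->
  c * energy N (fun i => y`_i) <= energy N (fun i => (p * y)`_i).
Proof.
move=> hc sp sy; case: N sp sy => [|N'] sp sy.
  by rewrite /energy !big_ord0 mulr0.
set N := N'.+1 in sp sy *.
have N0 : 0 < N%:R :> R by rewrite ltr0n.
rewrite -(ler_pM2l N0) mulrCA -!parseval // mulr_sumr.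
apply: ler_sum => k _; rewrite cevalM nsqM ler_wpM2r ?nsq_ge0 //.
rewrite cisX; set x := _ *+ k.
have x0 : 0 <= x by rewrite mulrn_wge0 // divr_ge0 ?mulr_ge0 ?pi_ge0 ?ltW.
have x2 : x < pi + pi.
  rewrite /x -[_ *+ k]mulr_natr mulrAC ltr_pdivrMr // -mulr2n -[pi *+ 2]mulr_natl.
  by rewrite ltr_pM2l ?mulr_gt0 ?pi_gt0 // ltr_nat.
have [xp|xp] := leP x pi; first by apply: hc; have := pi_ge0 R; lra.
(* The roots of unity have arguments in [[0, 2 pi[], while the hypothesis is stated on
   [[- pi, pi]]. *)
have -> : cis x = cis (x - pi - pi).
  have := cosDpi (x - pi - pi); have := sinDpi (x - pi - pi).
  have := cosDpi (x - pi); have := sinDpi (x - pi); rewrite !subrK /cis.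
  by move=> -> -> -> ->; rewrite !opprK.
by apply: hc; have := pi_gt0 R; lra.
Qed.

End Parseval.

(** * Causal energy gains of convolutions and their continuation *)

Section Gain.
Variable R : realType.
Implicit Types (p q y w : {poly R}) (f u : nat -> R).

(** Cauchy-Schwarz against the constant vector, from [x y <= (x^2 + y^2) / 2]. *)
Lemma sqr_sum_le (n : nat) (x : 'I_n -> R) :
  (\sum_i x i) ^+ 2 <= n%:R * \sum_i x i ^+ 2.
Proof.
rewrite expr2 mulr_suml.
apply: (@le_trans _ _ (\sum_i \sum_j (x i ^+ 2 + x j ^+ 2) / 2)).
  apply: ler_sum => i _; rewrite mulr_sumr; apply: ler_sum => j _.
  by have := sqr_ge0 (x i - x j); rewrite sqrrB; lra.
under eq_bigr => i _ do rewrite -mulr_suml big_split /= sumr_const card_ord.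
rewrite -mulr_suml big_split /= sumr_const card_ord sumrMnl.
by rewrite -mulr_natl; set S := \sum_i _; lra.
Qed.

Lemma sum_widen (m n : nat) f : (m <= n)%N -> (forall i, 0 <= f i) ->
  \sum_(i < m) f i <= \sum_(i < n) f i.
Proof.
move=> mn f0; rewrite -(subnKC mn) big_split_ord /= lerDl.
by apply: sumr_ge0 => i _.
Qed.

Lemma sum_shift (i n : nat) f :
  \sum_(k < n) (if (i <= k)%N then f (k - i)%N else 0) = \sum_(k < n - i) f k.
Proof.
elim: n => [|n IH]; first by rewrite sub0n !big_ord0.
rewrite big_ord_recr /= IH; case: leqP => h; first by rewrite subSn // big_ord_recr /=.
have /eqP -> : (n.+1 - i == 0)%N by rewrite subn_eq0.
have /eqP -> : (n - i == 0)%N by rewrite subn_eq0 ltnW.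
by rewrite addr0 !big_ord0.
Qed.

Lemma sum_shift_le (i n : nat) f : (forall i, 0 <= f i) ->
  \sum_(k < n) (if (i <= k)%N then f (k - i)%N else 0) <= \sum_(k < n) f k.
Proof. by move=> f0; rewrite sum_shift sum_widen // leq_subr. Qed.

Lemma energy_ge0 n f : 0 <= energy n f.
Proof. by apply: sumr_ge0 => i _; apply: sqr_ge0. Qed.

Lemma energy_widen m n f : (m <= n)%N -> energy m f <= energy n f.
Proof. by move=> mn; apply: (@sum_widen _ _ (fun i => f i ^+ 2)) => // i; apply: sqr_ge0. Qed.

Lemma eq_energy n f u : (forall i, (i < n)%N -> f i = u i) -> energy n f = energy n u.
Proof. by move=> fu; apply: eq_bigr => i _; rewrite fu. Qed.

Lemma energy_split m n f : energy (m + n) f = energy m f + energy n (fun i => f (m + i)%N).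
Proof. by rewrite /energy big_split_ord. Qed.

Lemma energy0 n : energy n (fun=> 0 : R) = 0.
Proof. by apply: big1 => i _; rewrite expr0n. Qed.

(** The range of summation no longer depends on [k], so this sum can be exchanged with one over
    [k]. *)
Lemma coefM_wide p y s k : (size p <= s)%N ->
  (p * y)`_k = \sum_(i < s) p`_i * (if (i <= k)%N then y`_(k - i) else 0).
Proof.
move=> sp; rewrite coefM.
have F i : (s <= i)%N -> p`_i = 0 by move=> si; rewrite nth_default // (leq_trans sp).
have [ks|sk] := leqP k.+1 s.
  rewrite -[in RHS](subnKC ks) big_split_ord /= [X in _ + X]big1 ?addr0.
    by apply: eq_bigr => i _; rewrite -ltnS ltn_ord.
  by move=> i _; rewrite leqNgt leq_addr mulr0.
rewrite -[in LHS](subnKC (ltnW sk)) big_split_ord /= [X in _ + X]big1 ?addr0.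
  by apply: eq_bigr => i _; rewrite ifT //; have := ltn_ord i; lia.
by move=> i _; rewrite F ?mul0r // leq_addr.
Qed.

(** A crude bound for the squared operator norm of convolution with [q]. What matters is only that
    it does not depend on the length of the segment. *)
Definition conv_norm q : R := (size q)%:R * \sum_(i < size q) q`_i ^+ 2.

Lemma conv_norm_ge0 q : 0 <= conv_norm q.
Proof. by rewrite mulr_ge0 // sumr_ge0 // => i _; rewrite sqr_ge0. Qed.

Lemma energy_conv q y n :
  energy n (fun i => (q * y)`_i) <= conv_norm q * energy n (fun i => y`_i).
Proof.
apply: (@le_trans _ _ (\sum_(k < n) (size q)%:R *
    \sum_(i < size q) q`_i ^+ 2 * (if (i <= k)%N then y`_(k - i) ^+ 2 else 0))).
  apply: ler_sum => k _; rewrite (coefM_wide _ _ (leqnn _)).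
  apply: (le_trans (sqr_sum_le _)); rewrite ler_wpM2l //.
  apply: ler_sum => i _; rewrite exprMn ler_wpM2l ?sqr_ge0 //.
  by case: ifP => //; rewrite expr0n.
rewrite -mulr_sumr /conv_norm -mulrA ler_wpM2l // exchange_big /= mulr_suml.
apply: ler_sum => i _; rewrite -mulr_sumr ler_wpM2l ?sqr_ge0 //.
by apply: (@sum_shift_le _ _ (fun i => y`_i ^+ 2)) => j; apply: sqr_ge0.
Qed.

(* Causal l2-stability of the recursion with symbol [p]. *)
Definition gain p (K : R) : Prop := forall y n,
  energy n (fun i => y`_i) <= K * energy n (fun i => (p * y)`_i).

(** Division by [p] as a power series: a multiple of ['X^L] corrects the coefficient [L] without
    touching the lower ones. *)
Lemma conv_solve p u L : p`_0 != 0 ->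
  exists w, forall i, (i < L)%N -> (p * w)`_i = u i.
Proof.
move=> p0; elim: L => [|L [w hw]]; first by exists 0.
exists (w + ((u L - (p * w)`_L) / p`_0)%:P * 'X^L) => i iL.
rewrite mulrDr mulrCA coefD coefCM coefMXn.
have [iL'|iL'] := ltnP i L; first by rewrite mulr0 addr0 hw.
have -> : i = L by lia.
by rewrite subnn divfK // addrC subrK.
Qed.

(** A gain applied to [w - y] bounds its energy by zero. *)
Lemma gain_eq p K y w n : gain p K ->
  (forall i, (i < n)%N -> (p * w)`_i = (p * y)`_i) ->
  forall i, (i < n)%N -> w`_i = y`_i.
Proof.
move=> g h i iN; have := g (w - y) n; rewrite [X in K * X](_ : _ = 0); last first.
  by rewrite -[RHS](energy0 n); apply: eq_energy => j jn; rewrite mulrBr coefB h // subrr.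
rewrite mulr0 => e0.
have : energy n (fun i => (w - y)`_i) = 0.
  by apply/eqP; rewrite eq_le e0 energy_ge0.
move/eqP; rewrite /energy psumr_eq0; last by move=> j _; apply: sqr_ge0.
move/allP => /(_ (Ordinal iN) (mem_index_enum _)) /=.
by rewrite sqrf_eq0 coefB subr_eq0 => /eqP.
Qed.

(** Before [n + d] the products with [v] and with [w] agree. From there on, [p] being of length [d],
    only the coefficients of [w] between [n] and [n + d] are seen, and their energy is the
    difference on the right. *)
Lemma energy_cut p w n (d := size p) :
  let v := take_poly (n + d) w in
  energy (n + d + d) (fun i => (p * v)`_i) <=
  energy (n + d) (fun i => (p * w)`_i)
  + conv_norm p * (energy (n + d) (fun i => w`_i) - energy n (fun i => w`_i)).
Proof.
rewrite /=; set v := take_poly _ _; rewrite energy_split; apply: lerD.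
  rewrite le_eqVlt; apply/orP; left; apply/eqP; apply: eq_energy => i id.
  rewrite !coefM; apply: eq_bigr => j _; rewrite coef_take_poly.
  by case: ltnP => // h; exfalso; have := ltn_ord j; lia.
set v' := v - take_poly n v.
have aux (d' s n' i : nat) : (s <= n')%N -> ((d' + s).-1 <= n' + d' + i)%N by lia.
have tail i : (p * v)`_(n + d + i) = (p * v')`_(n + d + i).
  rewrite /v' mulrBr coefB [X in _ - X]nth_default ?subr0 //.
  apply: (leq_trans (size_polyMleq _ _)).
  by apply: aux; exact: size_take_poly.
rewrite (eq_energy (u := fun i => (p * v')`_(n + d + i))); last by move=> i _; exact: tail.
apply: (@le_trans _ _ (energy (n + d + d) (fun i => (p * v')`_i))).
  by rewrite [leRHS]energy_split lerDr energy_ge0.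
apply: (le_trans (energy_conv _ _ _)); rewrite ler_wpM2l ?conv_norm_ge0 //.
rewrite !energy_split (eq_energy (u := fun=> 0)); last first.
  by move=> i iN; rewrite coefB !coef_take_poly iN ltn_addr // subrr.
rewrite [X in _ + _ + X](eq_energy (u := fun=> 0)); last first.
  move=> i iN; rewrite coefB !coef_take_poly.
  rewrite ifF ?sub0r; last by apply/negbTE; lia.
  by rewrite if_same oppr0.
rewrite !energy0 add0r addr0 addrAC subrr add0r.
rewrite (eq_energy (u := fun i => w`_(n + i))) // => i iN.
rewrite coefB !coef_take_poly ltn_add2l iN ifF ?subr0 //.
by apply/negbTE; lia.
Qed.

Lemma le_archi (x z A : R) :
  (forall m : nat, (0 < m)%N -> x <= z + A / m%:R) -> x <= z.
Proof.
move=> h; rewrite leNgt; apply/negP => zx.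
have d0 : 0 < x - z by rewrite subr_gt0.
have A0 : 0 < A by have := h 1%N isT; rewrite divr1; lra.
pose m := Num.bound (A / (x - z)).
have hm : A / (x - z) < m%:R.
  by apply: le_lt_trans (archi_boundP _); rewrite ?ler_norm // divr_ge0 // ltW.
have m0 : 0 < m%:R :> R by apply: le_lt_trans hm; rewrite divr_ge0 // ltW.
have := h m; rewrite -(ltr0n R) => /(_ m0).
move: hm; rewrite ltr_pdivrMr // => hm.
have : A / m%:R < x - z by rewrite ltr_pdivrMr // mulrC.
lra.
Qed.

(* Once some gain is known, the response to a finitely supported input is
   square summable, so that it can be cut off where its energy is small and
   the bound on the circle applies. *)
Lemma gain_improve p K c : p`_0 != 0 -> 0 < c -> gain p K ->
  (forall phi, - pi <= phi <= pi -> c <= nsq (ceval p (cis phi))) ->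
  gain p c^-1.
Proof.
move=> p0 c0 gK hc y N; rewrite mulrC ler_pdivlMr // mulrC.
set U := energy N (fun i => (p * y)`_i).
pose A := conv_norm p * (K * U).
apply: (@le_archi _ _ A) => m m0.
set d := size p.
(* The input is stopped at [N]; its response [w] continues [y] beyond [N], and has total energy at
   most [K * U] by the known gain. *)
pose u i : R := if (i < N)%N then (p * y)`_i else 0.
have [w hw] := @conv_solve p u (N + m * d) p0.
have enu n : (N <= n)%N -> energy n u = U.
  move=> Nn; rewrite -(subnKC Nn) energy_split [X in _ + X](eq_energy (u := fun=> 0)).
    by rewrite energy0 addr0; apply: eq_energy => i iN; rewrite /u iN.
  by move=> i _; rewrite /u ltnNge leq_addr.
pose e j := energy (N + j * d) (fun i => w`_i).
have KU : e m <= K * U.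
  rewrite -(enu (N + m * d)%N) ?leq_addr //; apply: (le_trans (gK _ _)).
  by rewrite le_eqVlt; apply/orP; left; apply/eqP; congr (_ * _); apply: eq_energy.
(* Pigeonhole: the [m] consecutive windows of length [d] share the energy [K * U], so one of them
   carries at most the [m]-th part. The cut is made there, and its cost disappears as [m] grows. *)
have [j [jm hj]] : exists j, (j < m)%N /\ e j.+1 - e j <= K * U / m%:R.
  apply: contrapT => hn.
  have : \sum_(j < m) (K * U / m%:R) < \sum_(j < m) (e j.+1 - e j).
    apply: ltr_sum; first by apply/hasP; exists (Ordinal m0); rewrite ?mem_index_enum.
    move=> j _; rewrite ltNge; apply/negP => hj.
    by apply: hn; exists j; split.
  rewrite sumr_const card_ord -[_ *+ m]mulr_natr divfK ?pnatr_eq0 -?lt0n //.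
  rewrite -(big_mkord xpredT (fun j => e j.+1 - e j)) telescope_sumr //.
  have e00 : 0 <= e 0%N by apply: energy_ge0.
  lra.
have wy : forall i, (i < N)%N -> w`_i = y`_i.
  by apply: (gain_eq gK) => i iN; rewrite hw ?ltn_addr // /u iN.
have dE : (N + j * d + d = N + j.+1 * d)%N by rewrite mulSn; lia.
set L := (N + j * d)%N in dE.
have LN : (L + d <= N + m * d)%N.
  by rewrite dE leq_add2l leq_mul2r jm orbT.
have := @energy_cut p w L; rewrite -/d /=; set v := take_poly _ _ => cut.
have sv : (size v <= L + d)%N by apply: size_take_poly.
have sb : c * energy (L + d + d) (fun i => v`_i) <= energy (L + d + d) (fun i => (p * v)`_i).
  apply: symbol_bound => //; last by rewrite (leq_trans sv) // leq_addr.
  by apply: (leq_trans (size_polyMleq _ _)); rewrite -/d; lia.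
have yv : energy N (fun i => y`_i) <= energy (L + d + d) (fun i => v`_i).
  rewrite (eq_energy (u := fun i => v`_i)); first by apply: energy_widen; rewrite /L; lia.
  move=> i iN; rewrite coef_take_poly wy //.
  by have -> : (i < L + d)%N by rewrite /L; lia.
have Pw : energy (L + d) (fun i => (p * w)`_i) = U.
  rewrite -(enu (L + d)%N); last by rewrite /L; lia.
  by apply: eq_energy => i iL; rewrite hw // (leq_trans iL).
have le1 : c * energy N (fun i => y`_i) <= c * energy (L + d + d) (fun i => v`_i).
  by rewrite ler_pM2l.
apply: (le_trans le1); apply: (le_trans sb); apply: (le_trans cut).
rewrite Pw lerD2l dE; have -> : A / m%:R = conv_norm p * (K * U / m%:R).
  by rewrite /A -[LHS]mulrA.
by rewrite ler_wpM2l ?conv_norm_ge0 //; exact: hj.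
Qed.

(** Half of [c] absorbs the perturbation; the other half, together with the factor 2 from splitting
    the square, gives [4 / c]. *)
Lemma gain_perturb p q c (t : R) : 0 < c -> gain p c^-1 ->
  4 * t ^+ 2 * conv_norm q <= c -> gain (p + t *: q) (4 / c).
Proof.
move=> c0 g ht y N.
have := g y N; rewrite mulrC ler_pdivlMr // => h1.
rewrite mulrAC ler_pdivlMr //.
set E := energy N (fun i => y`_i) in h1 *.
have E0 : 0 <= E by apply: energy_ge0.
set F := energy N (fun i => ((p + t *: q) * y)`_i).
have h2 : energy N (fun i => (p * y)`_i) <=
    2 * F + 2 * t ^+ 2 * energy N (fun i => (q * y)`_i).
  rewrite /F /energy !mulr_sumr -big_split /=; apply: ler_sum => i _.
  rewrite [(p + _) * y]mulrDl -scalerAl coefD coefZ.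
  (* [2 (X + t Y)^2 + 2 t^2 Y^2 - X^2 = (X + 2 t Y)^2]. *)
  set X := _`_i; set Y := _`_i; have := sqr_ge0 (X + 2 * t * Y).
  by rewrite sqrrD; nra.
have h3 := energy_conv q y N; rewrite -/E in h3.
have h4 : 2 * t ^+ 2 * energy N (fun i => (q * y)`_i) <= c / 2 * E.
  apply: (@le_trans _ _ (2 * t ^+ 2 * (conv_norm q * E))).
    by rewrite ler_wpM2l // mulr_ge0 // sqr_ge0.
  by rewrite mulrA ler_wpM2r //; lra.
lra.
Qed.

(* Continuation in [t]: the gain [c^-1] does not deteriorate along the segment,
   because at each step it is recovered from [gain_improve]. *)
Lemma gain_homotopy p q K c : p`_0 != 0 -> q`_0 = 0 -> 0 < c -> gain p K ->
  (forall t phi, 0 <= t <= 1 -> - pi <= phi <= pi ->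
     c <= nsq (ceval (p + t *: q) (cis phi))) ->
  gain (p + q) c^-1.
Proof.
move=> p0 q0 c0 gK hc.
have nz t : (p + t *: q)`_0 != 0 by rewrite coefD coefZ q0 mulr0 addr0.
pose B := 4 * conv_norm q / c.
(* The same step [1 / n] serves along the whole segment, because [gain_improve] restores the gain
   [c^-1] after every step; [B <= n <= n^2] gives the smallness required by [gain_perturb]. *)
pose n := (Num.bound B).+1.
have B0 : 0 <= B by apply: divr_ge0 (ltW c0); apply: mulr_ge0 (conv_norm_ge0 q).
have n0 : 0 < n%:R :> R by rewrite ltr0n.
have n1 : 1 <= n%:R :> R by rewrite ler1n.
have hn : 4 * (n%:R^-1) ^+ 2 * conv_norm q <= c.
  have : B <= n%:R.
    by apply: le_trans (ltW (archi_boundP B0)) _; rewrite ler_nat /n.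
  rewrite /B ler_pdivrMr // => h.
  rewrite mulrAC exprVn ler_pdivrMr ?exprn_gt0 //; apply: (le_trans h).
  by rewrite mulrC ler_pM2l // expr2 ler_peMr // ltW.
have step i : (i <= n)%N -> gain (p + (i%:R / n%:R) *: q) c^-1.
  elim: i => [|i IH] iN.
    have -> : (p + (0%:R / n%:R) *: q) = p by rewrite mul0r scale0r addr0.
    apply: (gain_improve p0 c0 gK) => phi hphi.
    by have := hc 0 phi; rewrite scale0r addr0; apply => //; rewrite lexx ler01.
  have g1 := gain_perturb c0 (IH (ltnW iN)) hn.
  have -> : p + (i.+1%:R / n%:R) *: q = p + (i%:R / n%:R) *: q + n%:R^-1 *: q.
    by rewrite -addrA -scalerDl -natr1 mulrDl mul1r.
  apply: (gain_improve _ c0 g1).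
    by rewrite -addrA -scalerDl nz.
  move=> phi hphi; rewrite -addrA -scalerDl.
  have -> : i%:R / n%:R + n%:R^-1 = i.+1%:R / n%:R :> R by rewrite -natr1 mulrDl mul1r.
  apply: hc => //; rewrite divr_ge0 //= ler_pdivrMr // mul1r ler_nat //.
have := step n (leqnn n).
by rewrite divff ?gt_eqF // scale1r.
Qed.

(** With [X = rho Y + D], convexity of the square gives [X^2 <= rho Y^2 + D^2 / (1 - rho)].
    Summation over a segment absorbs the first term. *)
Lemma gain_first_order (s rho : R) : 0 < s -> 0 <= rho < 1 ->
  gain (s *: (1 - rho *: 'X)) ((s * (1 - rho)) ^- 2).
Proof.
move=> s0 /andP[r0 r1] y N.
set E := energy N (fun i => y`_i).
have d0 : 0 < 1 - rho by lra.
have co i : ((1 - rho *: 'X) * y)`_i =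
    y`_i - rho * (if (1 <= i)%N then y`_(i - 1) else 0).
  rewrite mulrBl mul1r coefB -scalerAl coefZ coefXM.
  by case: i => [|i]; rewrite ?subn1.
have h : E <= rho * E + (1 - rho)^-1 * energy N (fun i => ((1 - rho *: 'X) * y)`_i).
  apply: (@le_trans _ _ (\sum_(i < N) (rho * (if (1 <= i)%N then y`_(i - 1) ^+ 2 else 0)
     + (1 - rho)^-1 * ((1 - rho *: 'X) * y)`_i ^+ 2))).
    apply: ler_sum => i _; rewrite co; set X := y`_i.
    rewrite (_ : (if _ then y`_(i - 1) ^+ 2 else 0) = (if (1 <= i)%N then y`_(i - 1) else 0) ^+ 2); last first.
      by case: ifP => //; rewrite expr0n.
    set Y := (if _ then _ else _).
    rewrite -(ler_pM2l d0) mulrDr mulVKf ?gt_eqF //.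
    by have := sqr_ge0 (X - Y); nra.
  rewrite big_split /= -!mulr_sumr lerD2r ler_wpM2l //.
  by apply: (@sum_shift_le 1 N (fun i => y`_i ^+ 2)) => j; apply: sqr_ge0.
set F := energy N _ in h.
have -> : energy N (fun i => (s *: (1 - rho *: 'X) * y)`_i) = s ^+ 2 * F.
  by rewrite /F /energy mulr_sumr; apply: eq_bigr => i _; rewrite -scalerAl coefZ exprMn.
rewrite exprMn invfM mulrAC mulrA mulVf ?expf_neq0 ?gt_eqF // mul1r.
have : (1 - rho) * E <= (1 - rho)^-1 * F by lra.
rewrite -ler_pdivlMl // mulrA -expr2 exprVn => hh.
by rewrite mulrC.
Qed.

End Gain.

(** * Limits along an ultrafilter *)

Section Ultralimits.

Lemma ultra_fmap (T V : Type) (x : T -> V) (U : set_system T) :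
  UltraFilter U -> UltraFilter (x @ U).
Proof.
move=> uU; split; first exact: fmap_proper_filter.
move=> G pG sub; apply/seteqP; split=> [A GA|]; last exact: sub.
have [|UC] := in_ultra_setVsetC (x @^-1` A) uU; first by [].
have GC : G (~` A) by apply: sub.
by have /filter_ex [? []] : G (A `&` ~` A) by exact: filterI.
Qed.

(** Stands in for the extraction of subsequences: along one fixed ultrafilter, any family of bounded
    sequences, even an uncountable one, converges simultaneously. *)
Lemma ultra_cvg (V : topologicalType) (K : set V) (x : nat -> V) (U : set_system nat) :
  UltraFilter U -> compact K -> (\forall n \near U, K (x n)) -> exists l : V, x @ U --> l.
Proof.
move=> uU; rewrite compact_ultra => cK hx.
by have [l [_ hl]] := cK (x @ U) (ultra_fmap x uU) hx; exists l.
Qed.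

Lemma exists_ultra : exists U : set_system nat, UltraFilter U /\ \oo `<=` U.
Proof. exact: ultraFilterLemma. Qed.

End Ultralimits.

(** * Elementary bounds for sine and cosine *)

Section Trigonometry.
Variable R : realType.
Implicit Types x : R.

Lemma ge0_of_derivative (f df : R -> R) x : 0 <= x ->
  (forall y : R, is_derive y 1 f (df y)) -> (forall y, 0 <= y -> 0 <= df y) ->
  f 0 = 0 -> 0 <= f x.
Proof.
rewrite le_eqVlt => /orP[/eqP<- _ _ ->//|x0 hd hp f0].
have cf : {within `[0, x], continuous f}.
  apply: continuous_subspaceT => y; apply: differentiable_continuous.
  by apply/derivable1_diffP; case: (hd y).
have [c] := MVT x0 (fun y _ => hd y) cf.
rewrite in_itv/= f0 !subr0 => /andP[c0 _] ->.
by rewrite mulr_ge0 ?hp ?ltW.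
Qed.

Lemma sin_le x : 0 <= x -> sin x <= x.
Proof.
move=> x0; rewrite -subr_ge0.
apply: (@ge0_of_derivative (fun y => y - sin y) (fun y => 1 - cos y)) => //.
by rewrite sin0 subrr.
Qed.

Lemma cos_ge x : 1 - x ^+ 2 / 2 <= cos x.
Proof.
wlog x0 : x / 0 <= x.
  move=> h; have [/h//|/ltW x0] := leP 0 x.
  by have := h (- x); rewrite oppr_ge0 sqrrN cosN; apply.
rewrite -subr_ge0 (_ : _ - _ = cos x + x ^+ 2 / 2 - 1); last by ring.
apply: (@ge0_of_derivative (fun y => cos y + y ^+ 2 / 2 - 1) (fun y => y - sin y)) => //.
- by move=> y; apply: is_derive_eq; rewrite /GRing.scale /=; field.
- by move=> y y0; rewrite subr_ge0 sin_le.
- by rewrite cos0 expr0n /= mul0r addr0 subrr.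
Qed.

Lemma sin_ge x : 0 <= x -> x - x ^+ 3 / 6 <= sin x.
Proof.
move=> x0; rewrite -subr_ge0 (_ : _ - _ = sin x - x + x ^+ 3 / 6); last by ring.
apply: (@ge0_of_derivative (fun y => sin y - y + y ^+ 3 / 6)
   (fun y => cos y - (1 - y ^+ 2 / 2))) => //.
- by move=> y; apply: is_derive_eq; rewrite /GRing.scale /=; field.
- by move=> y y0; rewrite subr_ge0 cos_ge.
- by rewrite sin0 expr0n /= mul0r addr0 subrr.
Qed.

(** For [x < 2] the double angle formula gives strictness, as [sin (x / 2) <= x / 2] and
    [cos (x / 2) < 1]. Strictness is what admits the borderline case [gamma * tau1 = 1]. *)
Lemma sin_lt x : 0 < x -> sin x < x.
Proof.
move=> x0; have [x2|x2] := ltP x 2; last by apply: le_lt_trans (sin_le1 x) _; lra.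
have h : sin x = 2 * (sin (x / 2) * cos (x / 2)).
  have {1}-> : x = x / 2 + x / 2 by lra.
  rewrite sinD; ring.
have p0 := pihalf_lt2 R; have := pi_ge2 R => p2.
have s0 : 0 < sin (x / 2) by apply: sin_gt0_pi; rewrite divr_gt0 //=; lra.
have s1 : sin (x / 2) <= x / 2 by apply: sin_le; lra.
have c1 : cos (x / 2) < 1.
  rewrite lt_neqAle cos_le1 andbT; apply/eqP => c1.
  by have := cos2Dsin2 (x / 2); rewrite c1; nra.
by rewrite h; nra.
Qed.

(** On [[0, 2]] the cubic Taylor bound gives [sin x >= x / 3], and
    [1 - cos phi = 2 sin^2 (phi / 2)], which is at least [2 (phi / 6)^2]. *)
Lemma sqr_le_cos (phi : R) : - pi <= phi <= pi -> phi ^+ 2 <= 18 * (1 - cos phi).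
Proof.
wlog x0 : phi / 0 <= phi.
  move=> h; have [/h//|/ltW x0] := leP 0 phi => h1.
  by have := h (- phi); rewrite oppr_ge0 sqrrN cosN; apply => //; lra.
move=> h1; set x := phi / 2.
have c : cos phi = 1 - 2 * sin x ^+ 2.
  have -> : phi = x + x by rewrite /x; lra.
  rewrite cosD -!expr2; have := cos2Dsin2 x; lra.
have xx : phi = 2 * x by rewrite /x; lra.
have xp : 0 <= x by rewrite /x; lra.
have p0 := pihalf_lt2 R.
have x2 : x <= 2 by rewrite /x; lra.
have s : x / 3 <= sin x.
  apply: le_trans (sin_ge xp); rewrite -subr_ge0.
  have -> : x - x ^+ 3 / 6 - x / 3 = x * (2 - x) * (2 + x) / 6 by field.
  by rewrite divr_ge0 ?mulr_ge0 //; lra.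
rewrite c xx.
have : (x / 3) ^+ 2 <= sin x ^+ 2.
  by rewrite ler_sqr ?nnegrE; lra.
have -> : (x / 3) ^+ 2 = x ^+ 2 / 9 by field.
move=> hs; have -> : (2 * x) ^+ 2 = 4 * x ^+ 2 by ring.
lra.
Qed.

End Trigonometry.

(** * The symbol of the Euler scheme on the unit circle *)

Section Symbol.
Variable R : realType.

(* The Euler scheme of step [1 / M] for
   [y' = gamma (y(t) - y(t - m1/M)) - a y - k * int_0^(m2/M) y(t - s) ds],
   written as a polynomial in the one-step delay. *)
Definition dpoly (M m1 m2 : nat) (a gamma k : R) : {poly R} :=
  M%:R *: (1 - 'X) +
  'X * ((a - gamma)%:P + gamma *: 'X^m1 + (k / M%:R) *: \sum_(i < m2) 'X^i).

Definition csum (m : nat) (phi : R) : R := \sum_(i < m) cos (phi *+ i).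
Definition ssum (m : nat) (phi : R) : R := \sum_(i < m) sin (phi *+ i).

Lemma sum_cisX m phi : \sum_(i < m) cis phi ^+ i = (csum m phi +i* ssum m phi)%C.
Proof.
elim: m => [|m IH]; rewrite /csum /ssum ?big_ord0 // !big_ord_recr /= IH cisX.
by simpc.
Qed.

(** Real and imaginary parts of the geometric sum formula. In the limit of fine grids they become
    [omega S = 1 - cos (omega tau2)] and [omega C = sin (omega tau2)]. *)
Lemma csum_ssum m phi :
  (1 - cos phi) * csum m phi + sin phi * ssum m phi = 1 - cos (phi *+ m) /\
  (1 - cos phi) * ssum m phi - sin phi * csum m phi = - sin (phi *+ m).
Proof.
have := subrX1 (cis phi) m; rewrite sum_cisX cisX => /eqP.
rewrite /cis; simpc => /eqP [] h1 h2; split; lra.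
Qed.

Lemma cevalD (p q : {poly R}) z : ceval (p + q) z = ceval p z + ceval q z.
Proof. by rewrite /ceval rmorphD hornerD. Qed.

Lemma cevalN (p : {poly R}) z : ceval (- p) z = - ceval p z.
Proof. by rewrite /ceval rmorphN hornerN. Qed.

Lemma ceval1 z : ceval (1 : {poly R}) z = 1.
Proof. by rewrite /ceval rmorph1 hornerC. Qed.

Lemma cevalC (c : R) z : ceval c%:P z = c%:C%C.
Proof. by rewrite /ceval map_polyC hornerC. Qed.

Lemma cevalZ (c : R) p z : ceval (c *: p) z = c%:C%C * ceval p z.
Proof. by rewrite -mul_polyC cevalM cevalC. Qed.

Lemma cevalX z : ceval ('X : {poly R}) z = z.
Proof. by rewrite /ceval map_polyX hornerX. Qed.

Lemma cevalXn n z : ceval ('X^n : {poly R}) z = z ^+ n.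
Proof. by rewrite /ceval map_polyXn hornerXn. Qed.

Lemma ceval_bigsum n (F : 'I_n -> {poly R}) z :
  ceval (\sum_i F i) z = \sum_i ceval (F i) z.
Proof. by rewrite /ceval rmorph_sum horner_sum. Qed.

Lemma nsq_dpoly M m1 m2 a gamma k phi :
  nsq (ceval (dpoly M m1 m2 a gamma k) (cis phi)) =
  (M%:R * (cos phi - 1) + (a - gamma) + gamma * cos (phi *+ m1)
     + k / M%:R * csum m2 phi) ^+ 2
  + (- (M%:R * sin phi) + gamma * sin (phi *+ m1) + k / M%:R * ssum m2 phi) ^+ 2.
Proof.
have -> : ceval (dpoly M m1 m2 a gamma k) (cis phi) =
    M%:R%:C%C * (1 - cis phi) + cis phi * ((a - gamma)%:C%C
      + gamma%:C%C * cis phi ^+ m1 + (k / M%:R)%:C%C * \sum_(i < m2) cis phi ^+ i).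
  rewrite /dpoly !(cevalD, cevalN, ceval1, cevalM, cevalZ, cevalX, cevalC, cevalXn, ceval_bigsum).
  by congr (_ + _ * (_ + _ * _)); apply: eq_bigr => i _; rewrite cevalXn.
have e : cis (- phi) * cis phi = 1 by rewrite -cisD addNr cis0.
(* Multiplication by a number of modulus one removes the factor ['X] that the explicit scheme puts
   in front of the right-hand side. *)
rewrite -[LHS]mul1r -[X in X * nsq _ = _](nsq_cis (- phi)) -nsqM.
have -> (A W : R[i]) : cis (- phi) * (A * (1 - cis phi) + cis phi * W) =
    A * (cis (- phi) - 1) + W.
  transitivity (A * (cis (- phi) - cis (- phi) * cis phi) + cis (- phi) * cis phi * W).
    by ring.
  by rewrite e mul1r.
rewrite sum_cisX cisX /cis cosN sinN; simpc; rewrite /nsq /=; ring.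
Qed.

(* In the limit of fine grids a vanishing symbol produces an imaginary
   characteristic root; [C] and [S] stand for [sin (omega tau2) / omega] and
   [(1 - cos (omega tau2)) / omega]. *)
Lemma symbol_lower_bound (a tau1 tau2 g0 g1 k0 k1 : R) :
  0 < a -> 0 < tau1 -> 0 < tau2 -> 0 <= k0 -> 0 <= k1 ->
  (forall t omega C S : R, 0 <= t <= 1 -> omega != 0 ->
     let g := g0 + t * (g1 - g0) in let k := k0 + t * (k1 - k0) in
     omega * C = sin (omega * tau2) -> omega * S = 1 - cos (omega * tau2) ->
     a - g + g * cos (omega * tau1) + k * C = 0 ->
     omega = g * sin (omega * tau1) + k * S -> False) ->
  exists c : R, 0 < c /\ exists M0 : nat, forall M : nat, (M0 <= M)%N ->
    forall t phi : R, 0 <= t <= 1 -> - pi <= phi <= pi ->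
      c <= nsq (ceval (dpoly M (Num.truncn (tau1 * M%:R)) (Num.truncn (tau2 * M%:R)) a
                 (g0 + t * (g1 - g0)) (k0 + t * (k1 - k0))) (cis phi)).
Proof.
move=> a0 t10 t20 k00 k10 noroot; apply: contrapT => hn.
(* Failure of the claim yields ever finer grids with parameters at which the symbol is below
   [1 / (n + 1)]. *)
have bad n : exists v : nat * R * R, let: (M, t, phi) := v in
    [/\ (n < M)%N, 0 <= t <= 1, - pi <= phi <= pi &
      nsq (ceval (dpoly M (Num.truncn (tau1 * M%:R)) (Num.truncn (tau2 * M%:R)) a
         (g0 + t * (g1 - g0)) (k0 + t * (k1 - k0))) (cis phi)) < n.+1%:R^-1].
  apply: contrapT => hn'; apply: hn; exists n.+1%:R^-1; split; first by rewrite invr_gt0.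
  exists n.+1 => M nM t phi ht hphi; rewrite leNgt; apply/negP => hlt.
  by apply: hn'; exists (M, t, phi).
have [v hv] := choice bad.
pose M n := (v n).1.1; pose t n := (v n).1.2; pose phi n := (v n).2.
have {}hv n : [/\ (n < M n)%N, 0 <= t n <= 1, - pi <= phi n <= pi &
    nsq (ceval (dpoly (M n) (Num.truncn (tau1 * (M n)%:R)) (Num.truncn (tau2 * (M n)%:R)) a
         (g0 + t n * (g1 - g0)) (k0 + t n * (k1 - k0))) (cis (phi n))) < n.+1%:R^-1].
  by rewrite /M /t /phi; have := hv n; case: (v n) => [[]].
have [U [uU oU]] := exists_ultra.
(* [om] is the angle per unit of time, the only scaling of [phi] with a meaningful limit. *)
pose m n := (M n)%:R : R; pose om n := m n * phi n.
pose m1 n := Num.truncn (tau1 * m n); pose m2 n := Num.truncn (tau2 * m n).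
pose C n := csum (m2 n) (phi n) / m n; pose S n := ssum (m2 n) (phi n) / m n.
pose g n := g0 + t n * (g1 - g0); pose k n := k0 + t n * (k1 - k0).
pose RE n := m n * (cos (phi n) - 1) + (a - g n) + g n * cos (phi n *+ m1 n) + k n * C n.
pose IM n := - (m n * sin (phi n)) + g n * sin (phi n *+ m1 n) + k n * S n.
have m_gt0 n : 0 < m n by rewrite ltr0n (leq_ltn_trans _ (let: And4 h _ _ _ := hv n in h)).
have t01 n : 0 <= t n <= 1 by case: (hv n).
have phi_pi n : - pi <= phi n <= pi by case: (hv n).
have small n : RE n ^+ 2 + IM n ^+ 2 < n.+1%:R^-1.
  have [_ _ _] := hv n; rewrite nsq_dpoly -/(m n) -/(m1 n) -/(m2 n) -/(g n) -/(k n).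
  by rewrite /RE /IM /C /S !mulrA -!(mulrAC _ (m n)^-1).
have inv1 n : n.+1%:R^-1 <= 1 :> R by rewrite invf_le1 ?ler1n.
have RE1 n : `|RE n| <= 1.
  rewrite -(@ler_pXn2r _ 2) ?nnegrE // expr1n real_normK ?num_real //.
  apply: le_trans (inv1 n); apply: le_trans (ltW (small n)).
  by rewrite lerDl sqr_ge0.
have IM1 n : `|IM n| <= 1.
  rewrite -(@ler_pXn2r _ 2) ?nnegrE // expr1n real_normK ?num_real //.
  apply: le_trans (inv1 n); apply: le_trans (ltW (small n)).
  by rewrite lerDr sqr_ge0.
have trunc_bound (tau : R) n : 0 < tau ->
    (Num.truncn (tau * m n))%:R <= tau * m n < (Num.truncn (tau * m n))%:R + 1.
  by move=> tau0; rewrite natr1 truncn_itv // mulr_ge0 // ltW.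
have sum_bound (F : nat -> R) n : (forall i, `|F i| <= 1) ->
    `|(\sum_(i < m2 n) F i) / m n| <= tau2.
  move=> F1; rewrite normrM normfV (gtr0_norm (m_gt0 n)) ler_pdivrMr //.
  apply: le_trans (ler_norm_sum _ _ _) _.
  apply: (@le_trans _ _ (\sum_(i < m2 n) 1)); first by apply: ler_sum => i _.
  by rewrite sumr_const card_ord; have /andP[] := trunc_bound _ n t20.
have C_bound n : `|C n| <= tau2 by apply: (sum_bound (fun i => cos (phi n *+ i))) => i; apply: cos_max.
have S_bound n : `|S n| <= tau2 by apply: (sum_bound (fun i => sin (phi n *+ i))) => i; apply: sin_max.
pose G : R := `|g0| + `|g1|; pose kk := k0 + k1.
have g_bound n : `|g n| <= G.
  have -> : g n = (1 - t n) * g0 + t n * g1 by rewrite /g; ring.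
  have /andP[t0 t1] := t01 n; apply: le_trans (ler_normD _ _) _.
  rewrite !normrM (ger0_norm t0) ger0_norm ?subr_ge0 // /G.
  by have := normr_ge0 g0; have := normr_ge0 g1; nra.
have k_bound n : 0 <= k n <= kk.
  have -> : k n = (1 - t n) * k0 + t n * k1 by rewrite /k; ring.
  by have /andP[t0 t1] := t01 n; rewrite /kk; apply/andP; split; nra.
(* The final 1 bounds [RE] and [IM]; the other terms bound everything in them except the difference
   quotient, which is thereby bounded too. *)
pose B := a + G + G + kk * tau2 + 1.
have kC_bound n (X : R) : `|X| <= tau2 -> `|k n * X| <= kk * tau2.
  move=> hX; have /andP[h0 h1] := k_bound n.
  by rewrite normrM (ger0_norm h0) ler_pM.
have gX_bound n (X : R) : `|X| <= 1 -> `|g n * X| <= G.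
  by move=> hX; rewrite normrM -[G]mulr1 ler_pM.
have B1 n : `|m n * (1 - cos (phi n))| <= B.
  have := kC_bound n _ (C_bound n); have := gX_bound n _ (cos_max (phi n *+ m1 n)).
  have := g_bound n; have := RE1 n; rewrite /B /RE !ler_norml.
  by move=> *; apply/andP; split; lra.
have B2 n : `|m n * sin (phi n)| <= B.
  have := kC_bound n _ (S_bound n); have := gX_bound n _ (sin_max (phi n *+ m1 n)).
  have := g_bound n; have := IM1 n; rewrite /B /IM !ler_norml.
  by move=> *; apply/andP; split; lra.
have B0 : 0 <= B := le_trans (normr_ge0 _) (B1 0%N).
(* By [sqr_le_cos], [om^2] is at most 9 times the sum of the squares of the two quantities bounded
   by [B], hence at most [18 B^2]. *)
pose W := 5 * B.
have om_bound n : `|om n| <= W.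
  rewrite -(@ler_pXn2r _ 2) ?nnegrE ?mulr_ge0 // real_normK ?num_real //.
  have h := sqr_le_cos (phi_pi n).
  have h1 : (m n * (1 - cos (phi n))) ^+ 2 <= B ^+ 2.
    by rewrite -real_normK ?num_real // ler_pXn2r ?nnegrE.
  have h2 : (m n * sin (phi n)) ^+ 2 <= B ^+ 2.
    by rewrite -[leLHS]real_normK ?num_real // ler_pXn2r ?nnegrE.
  have h3 : (1 - cos (phi n)) ^+ 2 + sin (phi n) ^+ 2 = 2 * (1 - cos (phi n)).
    by have := cos2Dsin2 (phi n); rewrite sqrrB; lra.
  rewrite /om /W exprMn.
  have h4 : m n ^+ 2 * phi n ^+ 2 <= m n ^+ 2 * (18 * (1 - cos (phi n))).
    by rewrite ler_wpM2l ?sqr_ge0.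
  apply: (le_trans h4).
  have -> : m n ^+ 2 * (18 * (1 - cos (phi n))) =
    9 * ((m n * (1 - cos (phi n))) ^+ 2 + (m n * sin (phi n)) ^+ 2).
    by rewrite !exprMn -mulrDr h3; ring.
  by have := sqr_ge0 B; rewrite [(5 * B) ^+ 2]exprMn; lra.
have cU (x : nat -> R) (l : R) : x @ \oo --> l -> x @ U --> l.
  by move=> h A nA; exact: oU (h A nA).
have bcv (x : nat -> R) (b : R) : (forall n, `|x n| <= b) -> exists l : R, x @ U --> l.
  move=> xb; apply: (ultra_cvg (K := `[- b, b]%classic) uU (@segment_compact _ _ _)).
  by apply: nearW => n; rewrite /= in_itv /= -ler_norml.
have cdist (x y z : nat -> R) (l : R) : (forall n, `|x n - y n| <= z n) ->
    z @ U --> 0 -> y @ U --> l -> x @ U --> l.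
  move=> h z0 yl; have d0 : (fun n => x n - y n) @ U --> 0.
    apply: (@squeeze_cvgr _ _ _ _ (fun n => - z n) z) => //.
      by apply: nearW => n; rewrite -ler_norml.
    by rewrite -oppr0; apply: cvgN.
  have -> : x = (fun n => (x n - y n) + y n) by apply/funext => n; rewrite subrK.
  by rewrite -[l]add0r; apply: cvgD.
have c_inv : (fun n => (m n)^-1) @ U --> 0.
  apply: (@cdist _ (fun=> 0) (fun n => n.+1%:R^-1)); last exact: cvg_cst.
    move=> n; rewrite subr0 ger0_norm ?invr_ge0 ?(ltW (m_gt0 n)) //.
    rewrite lef_pV2 ?posrE // ler_nat; by case: (hv n).
  by apply: cU; exact: cvg_harmonic.
have cmul0 (x z : nat -> R) (b : R) : (forall n, `|x n| <= b * z n) ->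
    z @ U --> 0 -> x @ U --> 0.
  move=> h z0; apply: (@cdist _ (fun=> 0) (fun n => b * z n)); last exact: cvg_cst.
    by move=> n; rewrite subr0.
  by rewrite -(mulr0 b); apply: cvgM => //; exact: cvg_cst.
have phiE n : phi n = om n * (m n)^-1 by rewrite /om mulrAC divff ?mul1r // gt_eqF.
have c_phi : (fun n => `|phi n|) @ U --> 0.
  apply: (@cmul0 _ _ W) c_inv => n.
  by rewrite normr_id phiE normrM normfV (gtr0_norm (m_gt0 n)) ler_wpM2r ?invr_ge0 ?(ltW (m_gt0 n)) ?om_bound.
have [om' c_om] := bcv _ _ om_bound.
have [C' c_C] := bcv _ _ C_bound.
have [S' c_S] := bcv _ _ S_bound.
have [t' c_t] : exists l : R, t @ U --> l.
  by apply: (@bcv _ 1) => n; have /andP[? ?] := t01 n; rewrite ger0_norm.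
have c_cos1 : (fun n => m n * (1 - cos (phi n))) @ U --> 0.
  apply: (@cmul0 _ _ W) c_phi => n.
  rewrite ger0_norm; last by rewrite mulr_ge0 ?(ltW (m_gt0 n)) // subr_ge0 cos_le1.
  apply: (@le_trans _ _ (m n * phi n ^+ 2)).
    by rewrite ler_pM2l //; have := cos_ge (phi n); have := sqr_ge0 (phi n); lra.
  rewrite -real_normK ?num_real // expr2 mulrA ler_wpM2r //.
  by rewrite -{1}(gtr0_norm (m_gt0 n)) -normrM; exact: om_bound.
have sin_near x : `|sin x - x| <= `|x| ^+ 3.
  wlog x0 : x / 0 <= x.
    move=> h; have [/h//|/ltW x0] := leP 0 x.
    by have := h (- x); rewrite oppr_ge0 sinN -opprD !normrN; apply.
  rewrite (ger0_norm x0) ler_norml; have := sin_le x0; have := sin_ge x0.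
  by have := exprn_ge0 3 x0 => *; apply/andP; split; lra.
have c_sin1 : (fun n => m n * sin (phi n)) @ U --> om'.
  apply: (@cdist _ _ (fun n => W * (`|phi n| * `|phi n|))) c_om => [n|].
    rewrite /om -mulrBr normrM; apply: (@le_trans _ _ (`|m n| * `|phi n| ^+ 3)).
      by rewrite ler_wpM2l // sin_near.
    by rewrite exprS expr2 mulrA -normrM ler_wpM2r ?mulr_ge0 //; exact: om_bound.
  by rewrite -(mulr0 W) -[X in _ * X](mulr0 0); apply: cvgM; [exact: cvg_cst|apply: cvgM].
have c_delay (tau : R) : 0 < tau ->
    (fun n => phi n *+ Num.truncn (tau * m n)) @ U --> om' * tau.
  move=> tau0; apply: (@cdist _ (fun n => om n * tau) (fun n => W * (m n)^-1)) => [n||].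
  - have := trunc_bound tau n tau0; set d := Num.truncn _ => /andP[h1 h2].
    have -> : phi n *+ d - om n * tau = om n * (m n)^-1 * (d%:R - tau * m n).
      by rewrite -phiE /om -mulr_natr; ring.
    rewrite normrM normrM normfV (gtr0_norm (m_gt0 n)) -[leRHS]mulr1.
    apply: ler_pM => //; rewrite ?mulr_ge0 ?invr_ge0 ?(ltW (m_gt0 n)) //.
      by rewrite ler_wpM2r ?invr_ge0 ?(ltW (m_gt0 n)).
    by rewrite ler_norml; apply/andP; split; lra.
  - by rewrite -(mulr0 W); apply: cvgM => //; exact: cvg_cst.
  - by apply: cvgM => //; exact: cvg_cst.
have c_cos (x : nat -> R) (l : R) : x @ U --> l -> (fun n => cos (x n)) @ U --> cos l.
  by move=> xl; apply: (cvg_comp _ _ xl); exact: continuous_cos.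
have c_sin (x : nat -> R) (l : R) : x @ U --> l -> (fun n => sin (x n)) @ U --> sin l.
  by move=> xl; apply: (cvg_comp _ _ xl); exact: continuous_sin.
have c_g : g @ U --> g0 + t' * (g1 - g0).
  by apply: cvgD; [exact: cvg_cst|apply: cvgM => //; exact: cvg_cst].
have c_k : k @ U --> k0 + t' * (k1 - k0).
  by apply: cvgD; [exact: cvg_cst|apply: cvgM => //; exact: cvg_cst].
have c_inv1 : (fun n => n.+1%:R^-1) @ U --> (0 : R) by apply: cU; exact: cvg_harmonic.
have sqr0 (x y : nat -> R) (l : R) : x @ U --> l ->
    (forall n, x n ^+ 2 + y n ^+ 2 < n.+1%:R^-1) -> l = 0.
  move=> xl h; apply/eqP; rewrite -sqrf_eq0; apply/eqP.
  have xx : (fun n => x n ^+ 2) @ U --> l ^+ 2.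
    by rewrite expr2; apply: cvg_trans (cvgM xl xl); apply: near_eq_cvg; apply: nearW => n; rewrite expr2.
  apply: (cvg_unique _ xx) => //; apply: (@cdist _ (fun=> 0) _ _ _ c_inv1); last exact: cvg_cst.
  move=> n; rewrite subr0 ger0_norm ?sqr_ge0 // (le_trans _ (ltW (h n))) //.
  by rewrite lerDl sqr_ge0.
have re0 : a - (g0 + t' * (g1 - g0)) + (g0 + t' * (g1 - g0)) * cos (om' * tau1)
    + (k0 + t' * (k1 - k0)) * C' = 0.
  apply: (sqr0 _ _ _ _ small); apply: cvgD; last exact: cvgM.
  apply: cvgD; last by apply: cvgM => //; apply: c_cos; exact: c_delay.
  rewrite -[X in _ --> X]add0r; apply: cvgD; last by apply: cvgB => //; exact: cvg_cst.
  rewrite -oppr0; apply: cvg_trans (cvgN c_cos1); apply: near_eq_cvg; apply: nearW => n.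
  by rewrite /= -mulrN opprB.
have im0 : - om' + (g0 + t' * (g1 - g0)) * sin (om' * tau1)
    + (k0 + t' * (k1 - k0)) * S' = 0.
  apply: (sqr0 IM RE); last by move=> n; rewrite addrC.
  apply: cvgD; last exact: cvgM.
  apply: cvgD; last by apply: cvgM => //; apply: c_sin; exact: c_delay.
  exact: cvgN.
have omC : om' * C' = sin (om' * tau2).
  have c1 : (fun n => m n * sin (phi n) * C n - m n * (1 - cos (phi n)) * S n) @ U
      --> om' * C' - 0 * S' by apply: cvgB; apply: cvgM.
  rewrite mul0r subr0 in c1; apply: (cvg_unique _ c1) => //.
  apply: cvg_trans (c_sin _ _ (c_delay _ t20)); apply: near_eq_cvg; apply: nearW => n.
  have [_ h] := csum_ssum (m2 n) (phi n).
  rewrite -/(m2 n) -[LHS]opprK -h /C /S; field; exact: (lt0r_neq0 (m_gt0 n)).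
have omS : om' * S' = 1 - cos (om' * tau2).
  have c1 : (fun n => m n * (1 - cos (phi n)) * C n + m n * sin (phi n) * S n) @ U
      --> 0 * C' + om' * S' by apply: cvgD; apply: cvgM.
  rewrite mul0r add0r in c1; apply: (cvg_unique _ c1) => //.
  have c2 : (fun n => 1 - cos (phi n *+ m2 n)) @ U --> 1 - cos (om' * tau2).
    by apply: cvgB; [exact: cvg_cst|apply: c_cos; exact: c_delay].
  apply: cvg_trans c2; apply: near_eq_cvg; apply: nearW => n.
  have [h _] := csum_ssum (m2 n) (phi n).
  rewrite /= -/(m2 n) -h /C /S; field; exact: (lt0r_neq0 (m_gt0 n)).
have t'01 : 0 <= t' <= 1.
  apply/andP; split.
    by apply: (cvgr_to_ge c_t); apply: nearW => n; have /andP[] := t01 n.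
  by apply: (cvgr_to_le c_t); apply: nearW => n; have /andP[] := t01 n.
(* A nonzero limit frequency is excluded by hypothesis. At frequency zero the real part reads
   [a + k C' = 0], which contradicts [a > 0] once [C' >= 0]. *)
have [om0|om0] := eqVneq om' 0; last first.
  apply: (noroot t' om' C' S') => //; lra.
(* When [phi * m2] is at most 1 in absolute value, so are all the arguments in [csum], and every
   cosine is at least one half. *)
have C0 : 0 <= C'.
  apply: (cvgr_to_ge c_C).
  have c0 : (fun n => phi n *+ m2 n) @ U --> 0.
    by rewrite -(mul0r tau2) -om0; exact: c_delay.
  have /cvgrPdist_le /(_ _ ltr01) := c0; apply: filterS => n.
  rewrite sub0r normrN => hn1.
  rewrite divr_ge0 ?(ltW (m_gt0 n)) //; apply: sumr_ge0 => i _.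
  have hi : `|phi n *+ i| <= 1.
    apply: le_trans hn1; rewrite !normrMn -[leLHS]mulr_natr -[leRHS]mulr_natr.
    by rewrite ler_wpM2l // ler_nat ltnW.
  have hq : (phi n *+ i) ^+ 2 <= 1.
    by rewrite -real_normK ?num_real // exprn_ile1.
  by have := cos_ge (phi n *+ i); lra.
move: re0; rewrite om0 mul0r cos0 mulr1 => re0.
have /andP[t0 t1] := t'01.
have : 0 <= (k0 + t' * (k1 - k0)) * C'.
  apply: mulr_ge0 => //; have -> : k0 + t' * (k1 - k0) = (1 - t') * k0 + t' * k1 by ring.
  by rewrite addr_ge0 ?mulr_ge0 // subr_ge0.
by lra.
Qed.

End Symbol.

(** * Gain of the Euler scheme below the critical parameter *)

Section DiscreteGain.
Variable R : realType.

(** The direction of the segment carries a factor ['X], so the constant coefficient stays equal to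
    [M]. *)
Lemma dpoly_affine M m1 m2 (a g0 g1 k0 k1 t : R) :
  dpoly M m1 m2 a (g0 + t * (g1 - g0)) (k0 + t * (k1 - k0)) =
  dpoly M m1 m2 a g0 k0 + t *: ('X * ((g0 - g1)%:P + (g1 - g0) *: 'X^m1
     + ((k1 - k0) / M%:R) *: \sum_(i < m2) 'X^i)).
Proof.
rewrite /dpoly -!mul_polyC; set S := \sum_(i < _) _.
by rewrite !(polyCD, polyCB, polyCM, polyCN); ring.
Qed.

Lemma dpoly0 M m1 m2 (a g k : R) : (dpoly M m1 m2 a g k)`_0 = M%:R.
Proof. by rewrite /dpoly coefD coefZ coefB coef1 coefX coefXM /= subr0 mulr1 addr0. Qed.

(** At the start of the segment the gain may depend on [M]. At its end it is uniform, since it comes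
    from the lower bound on the circle. *)
Lemma dpoly_homotopy (a tau1 tau2 g0 g1 k0 k1 : R) (M0 : nat) :
  0 < a -> 0 < tau1 -> 0 < tau2 -> 0 <= k0 -> 0 <= k1 ->
  (forall t omega C S : R, 0 <= t <= 1 -> omega != 0 ->
     let g := g0 + t * (g1 - g0) in let k := k0 + t * (k1 - k0) in
     omega * C = sin (omega * tau2) -> omega * S = 1 - cos (omega * tau2) ->
     a - g + g * cos (omega * tau1) + k * C = 0 ->
     omega = g * sin (omega * tau1) + k * S -> False) ->
  let dp g k M := dpoly M (Num.truncn (tau1 * M%:R)) (Num.truncn (tau2 * M%:R)) a g k in
  (forall M, (M0 <= M)%N -> exists K, gain (dp g0 k0 M) K) ->
  exists c : R, 0 < c /\ exists M1 : nat, forall M, (M1 <= M)%N -> gain (dp g1 k1 M) c^-1.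
Proof.
move=> a0 t1 t2 k00 k10 noroot dp g00.
have [c [c0 [M1 hc]]] := symbol_lower_bound a0 t1 t2 k00 k10 noroot.
exists c; split => //; exists (maxn 1 (maxn M0 M1)) => M.
rewrite !geq_max => /and3P[M1' M0' MM].
have [K gK] := g00 M M0'.
have e := dpoly_affine M (Num.truncn (tau1 * M%:R)) (Num.truncn (tau2 * M%:R)) a g0 g1 k0 k1.
have e1 : dp g1 k1 M = dp g0 k0 M + ('X * ((g0 - g1)%:P + (g1 - g0) *: 'X^(Num.truncn (tau1 * M%:R))
     + ((k1 - k0) / M%:R) *: \sum_(i < (Num.truncn (tau2 * M%:R))) 'X^i)).
  by have := e 1; rewrite !mul1r scale1r !(addrC g0) !(addrC k0) !subrK.
rewrite e1; apply: (gain_homotopy _ _ c0 gK).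
- by rewrite dpoly0 pnatr_eq0 -lt0n.
- by rewrite coefXM.
- by move=> t phi ht hphi; rewrite -e; apply: hc.
Qed.

(** For positive [omega], [g sin (omega tau1) < g omega tau1 <= omega]; the equation is odd in
    [omega]. *)
Lemma no_root_free (g tau1 omega : R) : 0 < tau1 -> 0 <= g -> g * tau1 <= 1 ->
  omega != 0 -> omega = g * sin (omega * tau1) -> False.
Proof.
move=> t1 g0 gt o0 e.
wlog op : omega o0 e / 0 < omega.
  move=> h; have [/(h _ o0 e)//|] := ltP 0 omega; rewrite le_eqVlt (negbTE o0) /= => oN.
  apply: (h (- omega)); rewrite ?oppr_eq0 ?oppr_gt0 //.
  by rewrite mulNr sinN mulrN -e.
have := sin_lt (mulr_gt0 op t1); set s := sin _ in e *.
have gp : 0 < g by rewrite lt_neqAle g0 andbT; apply/eqP => g00; move: e; rewrite -g00 mul0r; lra.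
rewrite -(ltr_pM2l gp) -e mulrCA => h.
have : omega * (g * tau1) <= omega by rewrite ler_piMr // ltW.
lra.
Qed.

Lemma discrete_gain (a gamma tau1 tau2 k : R) :
  0 < a -> 0 <= gamma -> gamma * tau1 <= 1 -> 0 < tau1 -> 0 < tau2 -> 0 <= k ->
  (forall k' omega C S : R, 0 < k' <= k -> 0 < omega ->
     omega * C = sin (omega * tau2) -> omega * S = 1 - cos (omega * tau2) ->
     a - gamma + gamma * cos (omega * tau1) + k' * C = 0 ->
     omega = gamma * sin (omega * tau1) + k' * S -> False) ->
  exists c : R, 0 < c /\ exists M0 : nat, forall M, (M0 <= M)%N ->
    gain (dpoly M (Num.truncn (tau1 * M%:R)) (Num.truncn (tau2 * M%:R)) a gamma k) c^-1.
Proof.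
move=> a0 g0 gt t1 t2 k0 noroot.
(* Without delays the scheme is [M (1 - (1 - a / M) 'X)]; the bound on [M] keeps the factor
   [1 - a / M] in [[0, 1[]. *)
have base M : ((Num.bound a).+1 <= M)%N ->
    exists K, gain (dpoly M (Num.truncn (tau1 * M%:R)) (Num.truncn (tau2 * M%:R)) a 0 0) K.
  move=> hM; have M0 : 0 < M%:R :> R by rewrite ltr0n; case: (M) hM.
  have aM : a <= M%:R.
    by apply: (le_trans (ltW (archi_boundP (ltW a0)))); rewrite ler_nat ltnW.
  exists ((M%:R * (1 - (1 - a / M%:R))) ^- 2).
  have -> : dpoly M (Num.truncn (tau1 * M%:R)) (Num.truncn (tau2 * M%:R)) a 0 0 =
      M%:R *: (1 - (1 - a / M%:R) *: 'X).
    have e : M%:R%:P * (a / M%:R)%:P = a%:P :> {poly R}.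
      by rewrite -polyCM mulrCA divff ?gt_eqF // mulr1.
    rewrite /dpoly mul0r !scale0r !addr0 subr0 -!mul_polyC polyCB -e; ring.
  apply: gain_first_order => //; rewrite subr_ge0 ler_pdivrMr // mul1r aM /=.
  by rewrite gtrBl divr_gt0.
have [c1 [c10 [M1 h1]]] : exists c : R, 0 < c /\ exists M1 : nat, forall M, (M1 <= M)%N ->
    gain (dpoly M (Num.truncn (tau1 * M%:R)) (Num.truncn (tau2 * M%:R)) a gamma 0) c^-1.
  apply: (@dpoly_homotopy a tau1 tau2 0 gamma 0 0 _ a0 t1 t2) base => //.
  move=> t omega C S /andP[ht0 ht1] o0 /=.
  rewrite !(add0r, subr0, oppr0, mulr0, mul0r, addr0) => _ _ _.
  apply: (@no_root_free (t * gamma) tau1 omega) => //; first exact: mulr_ge0.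
  by rewrite -mulrA; apply: mulr_ile1 => //; rewrite mulr_ge0 // ltW.
apply: (@dpoly_homotopy a tau1 tau2 gamma gamma 0 k M1) => //; last first.
  by move=> M /h1 h; exists c1^-1.
move=> t omega C S /andP[ht0 ht1] o0 /=; rewrite !(subrr, add0r, subr0, oppr0, mulr0, addr0).
(* Where [k] is not yet switched on, the imaginary part alone excludes a root, as on the first
   segment. *)
have [tk0|tk0] := eqVneq (t * k) 0.
  rewrite tk0 !mul0r !addr0 => _ _ _ e; exact: (no_root_free t1 g0 gt o0 e).
have tkp : 0 < t * k by rewrite lt_neqAle eq_sym tk0 mulr_ge0.
have tkk : t * k <= k by rewrite ler_piMl.
have [op|] := ltP 0 omega; first by apply: (noroot (t * k)); rewrite ?tkp.
(* Complex conjugation: [C] is even and [S] is odd in [omega]. *)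
rewrite le_eqVlt (negbTE o0) /= => oN e1 e2 e3 e4.
apply: (noroot (t * k) (- omega) C (- S)); rewrite ?tkp ?oppr_gt0 //.
- by rewrite !mulNr sinN e1.
- by rewrite mulrNN mulNr cosN.
- by rewrite mulNr cosN.
- by rewrite mulNr sinN !mulrN -opprD -e4.
Qed.

(** The real part says that the critical gain equals [- k C]. If [C] is nonzero, dividing by it
    gives the closed formulas; if [C] vanishes, so do the sine and the critical gain, which is the
    degenerate case. *)
Lemma critical_eqs_of_root (b gamma tau1 tau2 aj k omega C S : R) :
  0 < b -> 0 < k -> 0 < omega ->
  omega * C = sin (omega * tau2) -> omega * S = 1 - cos (omega * tau2) ->
  aj - gamma + gamma * cos (omega * tau1) + k * C = 0 ->
  omega = gamma * sin (omega * tau1) + k * S ->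
  critical_eqs b gamma tau1 tau2 aj (k / b) omega.
Proof.
move=> b0 k0 o0 eC eS re im.
have bn : b != 0 by rewrite gt_eqF.
have on : omega != 0 by rewrite gt_eqF.
have gE : critical_gain gamma tau1 aj omega = - (k * C) by rewrite /critical_gain; lra.
rewrite /critical_eqs gE; have [s0|s0] := eqVneq (sin (omega * tau2)) 0; [right|left].
  have C0 : C = 0 by apply/eqP; move/eqP: eC; rewrite s0 mulf_eq0 (negbTE on).
  split => //; first by rewrite C0 mulr0 oppr0.
  by rewrite -eS divfK // mulrA divfK //; lra.
have Cn : C != 0 by apply: contraNneq s0 => C0; rewrite -eC C0 mulr0.
split => //.
  by rewrite -eC; field; rewrite on bn Cn.
have -> : cos (omega * tau2) - 1 = - (omega * S) by lra.
rewrite -eC {1}im; congr (_ + _); field; by rewrite on Cn.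
Qed.

End DiscreteGain.

(** * Small gain estimate for the discrete system *)

Section DiscreteStability.
Variable R : realType.

Definition lag (s : nat) (f : nat -> R) (k : nat) : R :=
  if (s <= k)%N then f (k - s)%N else 0.

Lemma sqr_lag s (f : nat -> R) k : lag s f k ^+ 2 = lag s (fun i => f i ^+ 2) k.
Proof. by rewrite /lag; case: ifP => //; rewrite expr0n. Qed.

Lemma energy_lag s (f : nat -> R) n : energy n (lag s f) <= energy n f.
Proof.
rewrite /energy; under eq_bigr => i _ do rewrite sqr_lag.
by apply: (@sum_shift_le _ s n (fun i => f i ^+ 2)) => i; apply: sqr_ge0.
Qed.

(** The Riemann sum of the distributed delay without its factor [1 / M]. It starts at lag 1 because
    the scheme is explicit. *)
Definition memory (m : nat) (f : nat -> R) (k : nat) : R :=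
  \sum_(i < m) lag i.+1 f k.

Lemma energy_memory m (f : nat -> R) n :
  energy n (memory m f) <= m%:R ^+ 2 * energy n f.
Proof.
apply: (@le_trans _ _ (m%:R * \sum_(k < n) \sum_(i < m) lag i.+1 f k ^+ 2)).
  by rewrite mulr_sumr; apply: ler_sum => k _; apply: sqr_sum_le.
rewrite expr2 -mulrA ler_wpM2l // exchange_big /=.
apply: (@le_trans _ _ (\sum_(i < m) energy n f)).
  by apply: ler_sum => i _; apply: energy_lag.
by rewrite sumr_const card_ord mulr_natl.
Qed.

Lemma coef_dpoly M m1 m2 (a g k : R) (y : {poly R}) i :
  let w := fun i => y`_i in
  (dpoly M m1 m2 a g k * y)`_i =
  M%:R * (w i - lag 1 w i) + (a - g) * lag 1 w i
  + g * lag m1.+1 w i + k / M%:R * memory m2 w i.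
Proof.
move=> w; have co s : ('X^s * y)`_i = lag s w i.
  by rewrite coefXnM /lag ltnNge; case: leqP.
have -> : dpoly M m1 m2 a g k * y = M%:R *: (y - 'X^1 * y) + (a - g) *: ('X^1 * y)
    + g *: ('X^(m1.+1) * y) + (k / M%:R) *: \sum_(i < m2) ('X^(i.+1) * y).
  rewrite /dpoly -!mul_polyC -mulr_suml.
  under [\sum_(i < m2) 'X^(i.+1)]eq_bigr => j _ do rewrite exprS.
  by rewrite -mulr_sumr (exprS _ m1) expr1; ring.
rewrite !(coefD, coefZ, coefB, coefN, co) coef_sum.
by congr (_ + _ * _); apply: eq_bigr => j _; rewrite co.
Qed.

Lemma sqrD3 (x y z : R) : (x + y + z) ^+ 2 <= 3 * (x ^+ 2 + y ^+ 2 + z ^+ 2).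
Proof.
have := sqr_ge0 (x - y); have := sqr_ge0 (x - z); have := sqr_ge0 (y - z).
by rewrite !sqrrB; nra.
Qed.

Lemma energyD3 n (x y z : nat -> R) :
  energy n (fun i => x i + y i + z i) <= 3 * (energy n x + energy n y + energy n z).
Proof.
by rewrite /energy -!big_split mulr_sumr; apply: ler_sum => i _; apply: sqrD3.
Qed.

Lemma energyZ n (c : R) (x : nat -> R) : energy n (fun i => c * x i) = c ^+ 2 * energy n x.
Proof. by rewrite /energy mulr_sumr; apply: eq_bigr => i _; rewrite exprMn. Qed.

Lemma ler_energy n (x y : nat -> R) : (forall i, (i < n)%N -> `|x i| <= y i) ->
  energy n x <= energy n y.
Proof.
move=> xy; apply: ler_sum => i _; rewrite -real_normK ?num_real //.
by rewrite ler_sqr ?nnegrE // ?xy // (le_trans _ (xy i _)).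
Qed.

(** A discrete Sobolev inequality: [w N ^+ 2] telescopes into terms [(x - y) (x + y)], and [M] times
    such a product is controlled by [(M (x - y))^2] and [(x + y)^2]. *)
Lemma sqr_last_energy (M N : nat) (w : nat -> R) : (0 < M)%N ->
  w N ^+ 2 <= (energy N.+1 (fun i => M%:R * (w i - lag 1 w i))
               + 4 * energy N.+1 w) / M%:R.
Proof.
move=> M0; have m0 : 0 < M%:R :> R by rewrite ltr0n.
rewrite ler_pdivlMr //.
have -> : w N ^+ 2 = \sum_(i < N.+1) (w i ^+ 2 - lag 1 w i ^+ 2).
  elim: N => [|N IH]; first by rewrite big_ord1 /lag /= expr0n subr0.
  by rewrite big_ord_recr /= -IH /lag /= subn1 /= addrC subrK.
have es := energy_lag 1 w N.+1.
apply: (@le_trans _ _ (energy N.+1 (fun i => M%:R * (w i - lag 1 w i))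
   + 2 * (energy N.+1 w + energy N.+1 (lag 1 w)))); last by rewrite lerD2l; lra.
rewrite /energy -big_split mulr_sumr -big_split mulr_suml /=; apply: ler_sum => i _.
set x := w i; set y := lag 1 w i.
by have := sqr_ge0 (M%:R * (x - y) - (x + y)); have := sqr_ge0 (x - y);
   have := sqr_ge0 (M%:R * (x - y)); have := sqr_ge0 (x + y); nra.
Qed.

Variables (n : nat) (lam : 'I_n -> R) (gamma tau1 tau2 k : R).
Hypotheses (tau1_gt0 : 0 < tau1) (tau2_gt0 : 0 < tau2).
Let m1 (M : nat) := Num.truncn (tau1 * M%:R).
Let m2 (M : nat) := Num.truncn (tau2 * M%:R).

Lemma uniform_gain :
  (forall j, exists c : R, 0 < c /\ exists M0 : nat, forall M, (M0 <= M)%N ->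
     gain (dpoly M (m1 M) (m2 M) (lam j) gamma k) c^-1) ->
  exists c : R, 0 < c /\ exists M0 : nat, forall M, (M0 <= M)%N -> forall j,
     gain (dpoly M (m1 M) (m2 M) (lam j) gamma k) c^-1.
Proof.
move=> h; have [c hc] := choice h.
have [M0 hM] := choice (fun j => (hc j).2).
pose C := 1 + \sum_j (c j)^-1.
have Cc j : (c j)^-1 <= C.
  rewrite /C (bigD1 j) //= addrCA lerDl addr_ge0 // sumr_ge0 // => i _.
  by rewrite invr_ge0 ltW //; case: (hc i).
have C0 : 0 < C.
  by rewrite ltr_pwDl // sumr_ge0 // => i _; rewrite invr_ge0 ltW //; case: (hc i).
exists C^-1; split; first by rewrite invr_gt0.
exists (\max_j M0 j) => M hMM j y N; rewrite invrK.
have hj : (M0 j <= M)%N by apply: leq_trans hMM; apply: leq_bigmax.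
by apply: (le_trans (hM j M hj y N)); rewrite ler_wpM2r ?energy_ge0.
Qed.

Definition abs_sum (w : 'I_n -> nat -> R) (i : nat) : R := \sum_j `|w j i|.

Lemma energy_abs_sum w N : energy N (abs_sum w) <= n%:R * \sum_j energy N (w j).
Proof.
rewrite /energy exchange_big mulr_sumr /=; apply: ler_sum => i _.
apply: (le_trans (sqr_sum_le _)); rewrite ler_wpM2l //; apply: ler_sum => j _.
by rewrite real_normK ?num_real.
Qed.

(* Small gain in energy: a residual that is small relative to the solution and
   its memory is absorbed by the uniform gain. *)
Lemma discrete_small_gain :
  (forall j, exists c : R, 0 < c /\ exists M0 : nat, forall M, (M0 <= M)%N ->
     gain (dpoly M (m1 M) (m2 M) (lam j) gamma k) c^-1) ->
  exists eps K : R, [/\ 0 < eps, 0 <= K & exists M0 : nat,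
    forall M, (M0 <= M)%N -> (0 < M)%N -> forall (N : nat) (w : 'I_n -> nat -> R) (r : nat -> R),
    (forall j i, (i <= N)%N ->
      `|M%:R * (w j i - lag 1 (w j) i) + (lam j - gamma) * lag 1 (w j) i
        + gamma * lag (m1 M).+1 (w j) i + k / M%:R * memory (m2 M) (w j) i| <=
      eps * (lag 1 (abs_sum w) i + lag (m1 M).+1 (abs_sum w) i
             + M%:R^-1 * memory (m2 M) (abs_sum w) i) + r i) ->
    forall j, w j N ^+ 2 <= K * (energy N.+1 r / M%:R)].
Proof.
move=> /uniform_gain [c [c0 [M0 hc]]].
(* Accounts for the energies of the two lags and of the scaled memory, each relative to that of
   [abs_sum w]. *)
pose q := 1 + 2 + tau2 ^+ 2.
have q0 : 0 < q by rewrite /q; have := sqr_ge0 tau2; lra.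
pose n1 := (n.+1)%:R : R.
have n10 : 0 < n1 by rewrite ltr0n.
(* The minimum with 1 gives [eps^2 <= eps], so that no square root has to be taken; [n1] is [n + 1]
   to be positive in all cases. *)
pose eps := Num.min 1 (c / (24 * n1 ^+ 2 * q)).
have eps0 : 0 < eps by rewrite lt_min ltr01 divr_gt0 // !mulr_gt0 // exprn_gt0.
have epsE : 12 * eps ^+ 2 * q * n1 ^+ 2 <= c / 2.
  have e1 : eps ^+ 2 <= eps by rewrite expr2 ler_piMl ?(ltW eps0) // /eps ge_min lexx.
  have e2 : eps * (24 * n1 ^+ 2 * q) <= c.
    rewrite -ler_pdivlMr; first by rewrite /eps ge_min lexx orbT.
    by rewrite !mulr_gt0 // exprn_gt0.
  have : eps ^+ 2 * (n1 ^+ 2 * q) <= eps * (n1 ^+ 2 * q).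
    by rewrite ler_wpM2r // mulr_ge0 ?sqr_ge0 // ltW.
  by move: e2; lra.
pose L := \sum_j (lam j - gamma) ^+ 2 + gamma ^+ 2 + k ^+ 2 * tau2 ^+ 2.
have L0 : 0 <= L.
  rewrite /L -exprMn !addr_ge0 ?sqr_ge0 //.
  by apply: sumr_ge0 => j _; apply: sqr_ge0.
(* The difference quotient is the residual minus lag terms with squared coefficients bounded by [L]:
   its energy is at most [6 n1 Rr + 6 L E], and [sqr_last_energy] adds [4 E], where
   [E <= 4 n1 Rr / c]. *)
pose K := 6 * n1 + (6 * L + 4) * (4 * n1 / c).
have K0 : 0 <= K.
  apply: addr_ge0; first by rewrite mulr_ge0 // ltW.
  apply: mulr_ge0; first by rewrite addr_ge0 // mulr_ge0.
  by rewrite divr_ge0 ?(ltW c0) // mulr_ge0 // ltW.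
exists eps, K; split => //; exists M0 => M MM Mp N w r hw j0.
have m0 : 0 < M%:R :> R by rewrite ltr0n.
have m2b : (M%:R^-1) ^+ 2 * (m2 M)%:R ^+ 2 <= tau2 ^+ 2.
  rewrite -exprMn ler_sqr ?nnegrE ?mulr_ge0 ?invr_ge0 ?(ltW m0) ?(ltW tau2_gt0) //.
  rewrite mulrC ler_pdivrMr // /m2.
  by have /andP[] := truncn_itv (mulr_ge0 (ltW tau2_gt0) (ltW m0)).
set Rr := energy N.+1 r; have Rr0 : 0 <= Rr by apply: energy_ge0.
pose E := \sum_j energy N.+1 (w j).
have E0 : 0 <= E by apply: sumr_ge0 => j _; apply: energy_ge0.
have Ej j : energy N.+1 (w j) <= E.
  by rewrite /E (bigD1 j) //= lerDl sumr_ge0 // => i _; apply: energy_ge0.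
set Q := energy N.+1 (abs_sum w).
have QE : Q <= n1 * E.
  by apply: (le_trans (energy_abs_sum _ _)); rewrite ler_wpM2r // ler_nat.
have Q0 : 0 <= Q by apply: energy_ge0.
pose u j i := M%:R * (w j i - lag 1 (w j) i) + (lam j - gamma) * lag 1 (w j) i
        + gamma * lag (m1 M).+1 (w j) i + k / M%:R * memory (m2 M) (w j) i.
have mem_b (f : nat -> R) : energy N.+1 (fun i => M%:R^-1 * memory (m2 M) f i)
    <= tau2 ^+ 2 * energy N.+1 f.
  rewrite energyZ; apply: (@le_trans _ _ (M%:R^-1 ^+ 2 * ((m2 M)%:R ^+ 2 * energy N.+1 f))).
    by rewrite ler_wpM2l ?sqr_ge0 // energy_memory.
  by rewrite mulrA ler_wpM2r // energy_ge0.
have sqrD2 (x y : R) : (x + y) ^+ 2 <= 2 * (x ^+ 2 + y ^+ 2).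
  by have := sqr_ge0 (x - y); rewrite sqrrB sqrrD; lra.
have Uj j : energy N.+1 (u j) <= 6 * eps ^+ 2 * q * n1 * E + 2 * Rr.
  apply: (@le_trans _ _ (energy N.+1 (fun i => eps * (lag 1 (abs_sum w) i
     + lag (m1 M).+1 (abs_sum w) i + M%:R^-1 * memory (m2 M) (abs_sum w) i) + r i))).
    by apply: ler_energy => i iN; apply: hw.
  apply: (@le_trans _ _ (2 * (energy N.+1 (fun i => eps * (lag 1 (abs_sum w) i
     + lag (m1 M).+1 (abs_sum w) i + M%:R^-1 * memory (m2 M) (abs_sum w) i)) + Rr))).
    by rewrite /Rr /energy -big_split mulr_sumr; apply: ler_sum => i _; apply: sqrD2.
  rewrite energyZ.
  have h1 := energyD3 N.+1 (lag 1 (abs_sum w)) (lag (m1 M).+1 (abs_sum w))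
     (fun i => M%:R^-1 * memory (m2 M) (abs_sum w) i).
  have h2 := mem_b (abs_sum w); have h3 := energy_lag 1 (abs_sum w) N.+1.
  have h4 := energy_lag (m1 M).+1 (abs_sum w) N.+1; rewrite -/Q in h2 h3 h4.
  set X := energy _ _ in h1 *.
  have h5 : X <= 3 * q * Q by rewrite /q; lra.
  have h6 : eps ^+ 2 * X <= eps ^+ 2 * (3 * q * (n1 * E)).
    rewrite ler_wpM2l ?sqr_ge0 // (le_trans h5) // ler_wpM2l //.
    by rewrite mulr_ge0 // ltW.
  lra.
have gj j : c * energy N.+1 (w j) <= energy N.+1 (u j).
  (* Cutting [w] after [N] is harmless: by causality the coefficients up to [N] of the product do
     not change. *)
  pose y : {poly R} := \poly_(i < N.+1) w j i.
  have yE i : (i <= N)%N -> y`_i = w j i by move=> iN; rewrite coef_poly ltnS iN.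
  have shE s i : (i <= N)%N -> lag s (fun i => y`_i) i = lag s (w j) i.
    move=> iN; rewrite /lag; case: ifP => // _; rewrite yE //.
    by rewrite (leq_trans (leq_subr _ _)).
  have := hc M MM j y N.+1.
  rewrite mulrC ler_pdivlMr // mulrC (eq_energy (u := w j)); last first.
    by move=> i iN; apply: yE.
  move=> h; apply: (le_trans h); rewrite le_eqVlt; apply/orP; left; apply/eqP.
  apply: eq_energy => i iN; rewrite coef_dpoly /u yE // !shE //.
  by congr (_ + _ * _); apply: eq_bigr => s _; rewrite shE.
have n11 : 1 <= n1 by rewrite /n1 -natr1 lerDr.
have epsE' : 6 * eps ^+ 2 * q * n1 * E <= c / 4 * E.
  rewrite ler_wpM2r //; apply: (@le_trans _ _ (6 * eps ^+ 2 * q * n1 ^+ 2)); last lra.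
  apply: ler_wpM2l; last by rewrite expr2 ler_peMl // ltW.
  by apply: mulr_ge0 (ltW q0); apply: mulr_ge0 (sqr_ge0 _).
have cE : c * E <= n1 * (6 * eps ^+ 2 * q * n1 * E + 2 * Rr).
  rewrite /E mulr_sumr; apply: (@le_trans _ _ (\sum_(j < n) (6 * eps ^+ 2 * q * n1 * E + 2 * Rr))).
    by apply: ler_sum => j _; apply: (le_trans (gj j)).
  rewrite sumr_const card_ord -[leLHS]mulr_natl ler_wpM2r ?ler_nat //.
  exact: le_trans (energy_ge0 _ _) (Uj j0).
have cE2 : c * E <= 4 * n1 * Rr.
  have : n1 * (6 * eps ^+ 2 * q * n1 * E) <= c / 2 * E.
    rewrite (_ : n1 * _ = 6 * eps ^+ 2 * q * n1 ^+ 2 * E); last by ring.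
    by rewrite ler_wpM2r //; have := mulr_ge0 (ler0n R 12) (sqr_ge0 eps); lra.
  by move: cE; rewrite mulrDr; lra.
have E1 : E <= 4 * n1 / c * Rr by rewrite mulrAC ler_pdivlMr // mulrC.
have Uj2 j : energy N.+1 (u j) <= 3 * n1 * Rr.
  apply: (le_trans (Uj j)).
  have : n1 * Rr >= Rr by rewrite ler_peMl.
  lra.
apply: (le_trans (sqr_last_energy N (w j0) Mp)).
rewrite mulrA ler_wpM2r ?invr_ge0 ?(ltW m0) //.
have d_b : energy N.+1 (fun i => M%:R * (w j0 i - lag 1 (w j0) i)) <=
    2 * (energy N.+1 (u j0) + 3 * (L * E)).
  pose x1 i := (gamma - lam j0) * lag 1 (w j0) i.
  pose x2 i := - gamma * lag (m1 M).+1 (w j0) i.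
  pose x3 i := - k * (M%:R^-1 * memory (m2 M) (w j0) i).
  apply: (@le_trans _ _ (2 * (energy N.+1 (u j0) + energy N.+1 (fun i => x1 i + x2 i + x3 i)))).
    rewrite /energy -big_split mulr_sumr; apply: ler_sum => i _ /=.
    rewrite (_ : M%:R * _ = u j0 i + (x1 i + x2 i + x3 i)) ?sqrD2 //.
    by rewrite /u /x1 /x2 /x3; ring.
  rewrite ler_pM2l // lerD2l; apply: (le_trans (energyD3 _ _ _ _)).
  rewrite ler_pM2l // !energyZ.
  have h1 := energy_lag 1 (w j0) N.+1; have h2 := energy_lag (m1 M).+1 (w j0) N.+1.
  have h3 := mem_b (w j0); rewrite energyZ in h3; have hE := Ej j0; set e := energy N.+1 (w j0) in h1 h2 h3 hE *.
  have lamL : (gamma - lam j0) ^+ 2 <= \sum_j (lam j - gamma) ^+ 2.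
    rewrite -sqrrN opprB (bigD1 j0) //= lerDl sumr_ge0 // => i _; exact: sqr_ge0.
  rewrite /L !mulrDl; apply: lerD; first apply: lerD.
  - by apply: ler_pM => //; [exact: sqr_ge0|exact: energy_ge0|exact: le_trans h1 hE].
  - rewrite sqrrN ler_wpM2l ?sqr_ge0 //; exact: le_trans h2 hE.
  - rewrite sqrrN -mulrA ler_wpM2l ?sqr_ge0 // (le_trans h3) // ler_wpM2l ?sqr_ge0 //.
have h1 := Uj2 j0; have h2 := Ej j0.
have h3 : (6 * L + 4) * E <= (6 * L + 4) * (4 * n1 / c * Rr).
  by rewrite ler_wpM2l // addr_ge0 // mulr_ge0.
have -> : K * Rr = 6 * n1 * Rr + (6 * L + 4) * (4 * n1 / c * Rr) by rewrite /K; ring.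
lra.
Qed.

End DiscreteStability.

(** * Uniform continuity, mean values and Riemann sums *)

Section RealAnalysis.
Variable R : realType.
Implicit Types (f F df : R -> R).

(** Otherwise two sequences of points at vanishing distance have a common limit along an
    ultrafilter, while their values stay [eta] apart. *)
Lemma unif_cont_itv f (p q eta : R) : continuous f -> 0 < eta ->
  exists delta : R, 0 < delta /\ forall s t, p <= s <= q -> p <= t <= q ->
    `|s - t| <= delta -> `|f s - f t| <= eta.
Proof.
move=> cf eta0; apply: contrapT => hn.
have bad m : exists v : R * R, [/\ p <= v.1 <= q, p <= v.2 <= q, `|v.1 - v.2| <= m.+1%:R^-1 &
    eta < `|f v.1 - f v.2| ].
  apply: contrapT => hb; apply: hn; exists m.+1%:R^-1; split; first by rewrite invr_gt0.
  move=> s t hs ht st; rewrite leNgt; apply/negP => hlt.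
  by apply: hb; exists (s, t).
have [v hv] := choice bad.
have [U [uU oU]] := exists_ultra.
have cpt : compact (`[p, q]%classic : set R) by exact: segment_compact.
have [s hs] : exists s : R, (fun m => (v m).1) @ U --> s.
  by apply: (ultra_cvg uU cpt); apply: nearW => m; rewrite /= in_itv /=; case: (hv m).
have d0 : (fun m => (v m).2 - (v m).1) @ U --> (0 : R).
  have c_inv : (fun m => m.+1%:R^-1) @ U --> (0 : R).
    by move=> A nA; apply: oU; exact: (@cvg_harmonic R A nA).
  apply: (@squeeze_cvgr _ _ _ _ (fun m => - m.+1%:R^-1) (fun m => m.+1%:R^-1)) => //.
    by apply: nearW => m; rewrite -ler_norml distrC; case: (hv m).
  by rewrite -oppr0; apply: cvgN.
have ht : (fun m => (v m).2) @ U --> s.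
  have -> : (fun m => (v m).2) = (fun m => ((v m).2 - (v m).1) + (v m).1).
    by apply/funext => m; rewrite subrK.
  by rewrite -[s]add0r; apply: cvgD.
have c1 : (fun m => f (v m).1) @ U --> f s by apply: (cvg_comp _ _ hs); exact: cf.
have c2 : (fun m => f (v m).2) @ U --> f s by apply: (cvg_comp _ _ ht); exact: cf.
have c3 : (fun m => `|f (v m).1 - f (v m).2|) @ U --> (0 : R).
  by rewrite -(normr0 R) -(subrr (f s)); apply: cvg_norm; apply: cvgB.
have : eta <= 0.
  by apply: (cvgr_to_ge c3); apply: nearW => m; apply: ltW; case: (hv m).
by rewrite leNgt eta0.
Qed.

Lemma bounded_itv f (p q : R) : continuous f ->
  exists b : R, 0 <= b /\ forall t, p <= t <= q -> `|f t| <= b.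
Proof.
move=> cf; have [pq|pq] := leP p q; last first.
  by exists 0; split => // t /andP[h1 h2]; have := le_trans h1 h2; rewrite leNgt pq.
have cn : {within `[p, q], continuous (fun t => `|f t|)}.
  apply: continuous_subspaceT => t.
  exact: (continuous_comp (cf t) (@norm_continuous _ _ (f t))).
have [c _ hc] := EVT_max pq cn.
by exists `|f c|; split => // t ht; apply: hc; rewrite in_itv.
Qed.

Lemma is_derive_continuous f df : (forall t : R, is_derive t 1 f (df t)) -> continuous f.
Proof.
move=> h t; apply: differentiable_continuous.
by apply/derivable1_diffP; case: (h t).
Qed.

Lemma mean_value f df (p q : R) : p < q -> continuous f ->
  (forall x, p < x < q -> is_derive x 1 f (df x)) ->
  exists2 x, p < x < q & f q - f p = df x * (q - p).
Proof.
move=> pq cf hd.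
have hd' x : x \in `]p, q[ -> is_derive x 1 f (df x) by rewrite in_itv; exact: hd.
have [x + e] := MVT pq hd' (continuous_subspaceT cf).
by rewrite in_itv => xpq; exists x.
Qed.

Lemma le_increment f F df dF (p q : R) : p <= q -> continuous f -> continuous F ->
  (forall x, p < x < q -> is_derive x 1 f (df x)) ->
  (forall x, p < x < q -> is_derive x 1 F (dF x)) ->
  (forall x, p < x < q -> df x <= dF x) -> f q - f p <= F q - F p.
Proof.
rewrite le_eqVlt => /orP[/eqP<- *|pq cf cF hf hF h]; first by rewrite !subrr.
have cg : continuous (fun x => F x - f x) by move=> x; apply: cvgB; [exact: cF|exact: cf].
have [x hx e] := @mean_value (fun x => F x - f x) (fun x => dF x - df x) _ _ pq cg
  (fun x hx => is_deriveB (hF x hx) (hf x hx)).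
rewrite -subr_ge0; have -> : F q - F p - (f q - f p) = F q - f q - (F p - f p) by ring.
by rewrite e mulr_ge0 ?subr_ge0 ?h // ltW.
Qed.

(** On each cell the increment of [F] is [h] times a value of [f] at a mean value point, which is
    within [2 h] of the node since [xi] is within [h] of [t]. The remaining piece of the window is
    no longer than [h] and costs [b * h]. *)
Lemma riemann_sum f F (p q h xi t tau b eta : R) (m : nat) :
  (forall t : R, is_derive t 1 F (f t)) -> 0 < h -> 0 <= eta ->
  (forall s t, p <= s <= q -> p <= t <= q -> `|s - t| <= 2 * h -> `|f s - f t| <= eta) ->
  (forall t, p <= t <= q -> `|f t| <= b) ->
  `|xi - t| <= h -> m%:R * h <= tau <= (m%:R + 1) * h ->
  p <= xi - tau -> xi <= q -> p <= t - tau -> t <= q ->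
  `|F xi - F (xi - tau) - h * \sum_(i < m) f (t - i%:R * h)| <= tau * eta + b * h.
Proof.
move=> hF h0 eta0 uc hb xit /andP[mt tm] pxi xiq pt tq.
have cF := is_derive_continuous hF.
have tail : `|F (xi - m%:R * h) - F (xi - tau)| <= b * h.
  have : xi - tau <= xi - m%:R * h by rewrite lerD2l lerN2.
  rewrite le_eqVlt => /orP[/eqP ->|lt1].
    rewrite subrr normr0 mulr_ge0 ?(ltW h0) // (le_trans _ (hb xi _)) //.
    by have := mulr_ge0 (ler0n R m) (ltW h0) => ?; apply/andP; split; lra.
  have [x /andP[x1 x2] ->] := mean_value lt1 cF (fun x _ => hF x).
  have mh := mulr_ge0 (ler0n R m) (ltW h0).
  rewrite normrM; apply: ler_pM => //; first by apply: hb; apply/andP; split; lra.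
  by rewrite ger0_norm; lra.
have step (i : 'I_m) : exists x, F (xi - i%:R * h) - F (xi - i.+1%:R * h) = f x * h /\
    `|f x - f (t - i%:R * h)| <= eta.
  have lt1 : xi - i.+1%:R * h < xi - i%:R * h.
    by rewrite ltrD2l ltrN2 ltr_pM2r // ltr_nat.
  have [x /andP[x1 x2] e] := mean_value lt1 cF (fun x _ => hF x).
  exists x; split; first by rewrite e -natr1; ring.
  have i0 := mulr_ge0 (ler0n R i) (ltW h0).
  have i1 : i.+1%:R * h <= m%:R * h by rewrite ler_pM2r // ler_nat.
  have ei : i.+1%:R * h = i%:R * h + h by rewrite -natr1; ring.
  move: xit; rewrite ler_norml => /andP[z1 z2].
  apply: uc; first by apply/andP; split; lra.
    by apply/andP; split; lra.
  by rewrite ler_norml; apply/andP; split; lra.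
have [x hx] := choice step.
have tele : F xi - F (xi - m%:R * h) = \sum_(i < m) f (x i) * h.
  under eq_bigr => i _ do rewrite -(hx i).1.
  rewrite -(big_mkord xpredT (fun i => F (xi - i%:R * h) - F (xi - i.+1%:R * h))).
  rewrite (@telescope_sumr_eq _ 0 m (fun i => - F (xi - i%:R * h))) //.
    by rewrite mul0r subr0 opprK addrC.
  by move=> i _; rewrite opprK addrC.
have head : `|F xi - F (xi - m%:R * h) - h * \sum_(i < m) f (t - i%:R * h)| <= tau * eta.
  rewrite tele mulr_sumr -sumrB; apply: (le_trans (ler_norm_sum _ _ _)).
  apply: (@le_trans _ _ (\sum_(i < m) eta * h)).
    apply: ler_sum => i _; rewrite mulrC -mulrBr mulrC normrM (gtr0_norm h0).
    by rewrite ler_pM2r //; case: (hx i).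
  by rewrite sumr_const card_ord -mulr_natl mulrCA mulrC ler_wpM2r.
rewrite (_ : _ - _ - _ = (F xi - F (xi - m%:R * h) - h * \sum_(i < m) f (t - i%:R * h))
  + (F (xi - m%:R * h) - F (xi - tau))); last by ring.
by apply: (le_trans (ler_normD _ _)); apply: lerD.
Qed.

End RealAnalysis.

(** * From the discrete to the continuous estimate, for zero history *)

Section Core.
Variable R : realType.

Lemma common_positive (n : nat) (P : 'I_n -> R -> Prop) :
  (forall j, exists d : R, 0 < d /\ forall d', 0 < d' <= d -> P j d') ->
  exists d : R, 0 < d /\ forall d', 0 < d' <= d -> forall j, P j d'.
Proof.
move=> h; have [d hd] := choice h.
pose C := 1 + \sum_j (d j)^-1.
have C0 : 0 < C.
  by rewrite ltr_pwDl // sumr_ge0 // => i _; rewrite invr_ge0 ltW //; case: (hd i).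
exists C^-1; split; first by rewrite invr_gt0.
move=> d' /andP[d0 d1] j; have [dj0 hj] := hd j; apply: hj; rewrite d0 /=.
apply: (le_trans d1); rewrite -[leRHS]invrK lef_pV2 ?posrE ?invr_gt0 //.
rewrite /C (bigD1 j) //= addrCA lerDl addr_ge0 // sumr_ge0 // => i _.
by rewrite invr_ge0 ltW //; case: (hd i).
Qed.

Lemma common_bound (n : nat) (P : 'I_n -> R -> Prop) :
  (forall j, exists b : R, 0 <= b /\ forall b', b <= b' -> P j b') ->
  exists b : R, 0 <= b /\ forall j, P j b.
Proof.
move=> h; have [b hb] := choice h; exists (\sum_j b j); split.
  by apply: sumr_ge0 => j _; case: (hb j).
move=> j; apply: (hb j).2; rewrite (bigD1 j) //= lerDl sumr_ge0 // => i _.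
by case: (hb i).
Qed.

Lemma lag_sample (f : R -> R) (M s k : nat) : (0 < M)%N -> (forall t, t <= 0 -> f t = 0) ->
  lag s (fun i => f (i%:R / M%:R)) k = f ((k%:R - s%:R) / M%:R).
Proof.
move=> M0 f0; rewrite /lag; case: leqP => [sk|ks]; first by rewrite natrB.
by rewrite f0 // pmulr_lle0 ?invr_gt0 ?ltr0n // subr_le0 ler_nat ltnW.
Qed.

Lemma residual_triangle (d g l k h vx vx1 vt vt1 VV SS X G1 G2 G3 G4 : R) :
  `|d - (g * (vx - vx1) - l * vx - k * VV)| <= X ->
  `|g * (vx - vt)| <= G1 -> `|g * (vx1 - vt1)| <= G2 -> `|l * (vx - vt)| <= G3 ->
  `|k * (VV - h * SS)| <= G4 ->
  `|d + (l - g) * vt + g * vt1 + k * h * SS| <= X + G1 + G2 + G3 + G4.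
Proof.
rewrite !ler_norml => /andP[? ?] /andP[? ?] /andP[? ?] /andP[? ?] /andP[? ?].
by apply/andP; split; lra.
Qed.

Lemma sum_prefix_le (N c : nat) (x : R) : 0 <= x ->
  \sum_(i < N) (if (i <= c)%N then x else 0) <= c.+1%:R * x.
Proof.
move=> x0; apply: (@le_trans _ _ (\sum_(i < c.+1 + N) (if (i <= c)%N then x else 0))).
  apply: (@sum_widen _ N (c.+1 + N) (fun i => if (i <= c)%N then x else 0)).
    by rewrite leq_addl.
  by move=> i; case: ifP.
rewrite big_split_ord /= [X in _ + X]big1 ?addr0; last first.
  by move=> i _; rewrite leqNgt leq_addr.
rewrite (eq_bigr (fun=> x)); first by rewrite sumr_const card_ord mulr_natl.
by move=> i _; rewrite -ltnS ltn_ord.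
Qed.

Lemma sqrD2 (x y : R) : (x + y) ^+ 2 <= 2 * (x ^+ 2 + y ^+ 2).
Proof. by have := sqr_ge0 (x - y); rewrite sqrrB sqrrD; lra. Qed.

Definition l1 (n : nat) (v : 'I_n -> R -> R) (t : R) : R := \sum_j `|v j t|.

Variables (n : nat) (lam : 'I_n -> R) (gamma tau1 tau2 k T1 : R).
Hypotheses (tau1_gt0 : 0 < tau1) (tau2_gt0 : 0 < tau2) (T1_ge0 : 0 <= T1).

(** The forcing [D] acts only up to time [T1], so its energy is bounded independently of [T], and so
    is [K]. The time 1 is exempted because the ramp with which this is applied has a corner
    there. *)
Lemma zero_history_estimate :
  (forall j, exists c : R, 0 < c /\ exists M0 : nat, forall M, (M0 <= M)%N ->
     gain (dpoly M (Num.truncn (tau1 * M%:R)) (Num.truncn (tau2 * M%:R)) (lam j) gamma k) c^-1) ->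
  exists eps K : R, [/\ 0 < eps, 0 <= K &
    forall (T D : R) (v V : 'I_n -> R -> R) (B : R -> R),
    0 < T -> 0 <= D ->
    (forall j, continuous (v j)) -> (forall j t, t <= 0 -> v j t = 0) ->
    (forall j (t : R), is_derive t 1 (V j) (v j t)) ->
    (forall t : R, is_derive t 1 B (l1 v t)) ->
    (forall j t, 0 < t < T -> t != 1 -> exists2 d : R, is_derive t 1 (v j) d &
       `|d - (gamma * (v j t - v j (t - tau1)) - lam j * v j t - k * (V j t - V j (t - tau2)))|
       <= eps * (l1 v t + l1 v (t - tau1) + (B t - B (t - tau2)))
          + (if t <= T1 then D else 0)) ->
    forall j, `|v j T| <= K * D].
Proof.
move=> /discrete_small_gain - /(_ tau2_gt0) [eps [K [eps0 K0 [M0 hM0]]]].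
(* The square of the solution will be at most [X D^2] with [X = 4 K (T1 + 2)], and [X <= (1 + X)^2]
   avoids a square root. *)
pose K' := 1 + 4 * K * (T1 + 2).
have K4 : 0 <= 4 * K * (T1 + 2) by rewrite !mulr_ge0 // addr_ge0.
exists eps, K'; split => //; first by rewrite addr_ge0.
move=> T D v V B T0 D0 cv v0 hV hB hode j0.
pose p := - (tau1 + tau2 + 2).
pose A := \sum_j `|lam j|.
have A0 : 0 <= A by apply: sumr_ge0.
have Aj j : `|lam j| <= A by rewrite /A (bigD1 j) //= lerDl sumr_ge0.
have [b [b0 hb]] : exists b : R, 0 <= b /\ forall j t, p <= t <= T -> `|v j t| <= b.
  apply: common_bound => j; have [b [b0 hb]] := bounded_itv p T (cv j).
  by exists b; split => // b' bb t ht; apply: le_trans bb; apply: hb.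
pose Ce := 2 * `|gamma| + A + `|k| * (tau2 + b) + eps * (2 * n%:R + tau2 * n%:R + n%:R * b).
have Ce0 : 0 <= Ce.
  by rewrite /Ce !(addr_ge0, mulr_ge0, normr_ge0, ler0n) ?(ltW eps0) ?(ltW tau2_gt0).
(* The sampled solution satisfies the discrete equation up to an error that
   vanishes with the step. *)
have main (eta : R) : 0 < eta ->
    v j0 T ^+ 2 <= 4 * K * ((T1 + 2) * D ^+ 2 + (T + 1) * (Ce * eta) ^+ 2) + 2 * eta ^+ 2.
  move=> eta0.
  have [del [del0 hdel]] : exists d : R, 0 < d /\ forall d', 0 < d' <= d -> forall j s t,
      p <= s <= T -> p <= t <= T -> `|s - t| <= d' -> `|v j s - v j t| <= eta.
    apply: common_positive => j.
    have [d [d0 hd]] := unif_cont_itv p T (cv j) eta0.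
    exists d; split => // d' /andP[_ dd] s t hs ht st.
    by apply: hd => //; apply: le_trans dd.
  (* Ensures at once [h <= 1], [h <= eta] and [2 h <= del]. *)
  pose M := (maxn M0 (Num.bound (1 + eta^-1 + 2 / del))).+1.
  have Mp : (0 < M)%N by [].
  have MM0 : (M0 <= M)%N by rewrite /M leqW // leq_maxl.
  have m0 : 0 < M%:R :> R by rewrite ltr0n.
  set h := (M%:R^-1 : R).
  have h0 : 0 < h by rewrite invr_gt0.
  have Mbig : 1 + eta^-1 + 2 / del <= M%:R.
    have q0 : 0 <= 1 + eta^-1 + 2 / del by rewrite !addr_ge0 ?invr_ge0 ?divr_ge0 // ltW.
    apply: le_trans (ltW (archi_boundP q0)) _.
    by rewrite ler_nat /M leqW // leq_maxr.
  have e0 : 0 < eta^-1 by rewrite invr_gt0.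
  have d0 : 0 < 2 / del by rewrite divr_gt0.
  have h1 : h <= 1 by rewrite invf_le1 //; lra.
  have heta : h <= eta by rewrite -[leRHS]invrK lef_pV2 ?posrE //; lra.
  have hdel2 : 2 * h <= del.
    rewrite -ler_pdivlMl // mulrC -[leRHS]invrK lef_pV2 ?posrE ?invr_gt0 ?divr_gt0 //.
    by rewrite invf_div; lra.
  have uc := hdel (2 * h); rewrite hdel2 mulr_gt0 //= in uc; have {}uc := uc isT.
  pose N := Num.truncn (T * M%:R).
  have /andP[N1 N2] : N%:R <= T * M%:R < N.+1%:R by rewrite truncn_itv // mulr_ge0 // ltW.
  have NT : N%:R * h <= T by rewrite ler_pdivrMr.
  pose w (j : 'I_n) (i : nat) := v j (i%:R / M%:R).
  pose e := Ce * eta.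
  (* The index [i + 1] stands for the cell that begins at [i h]; this cell can meet [[0, T1]] only
     if [i] is at most the truncation of [T1 M]. *)
  pose r (i : nat) : R := (if (i <= (Num.truncn (T1 * M%:R)).+1)%N then D else 0) + e.
  have r0 i : (0 <= r i)%R.
    by rewrite /r; apply: addr_ge0; [case: ifP|rewrite mulr_ge0 // ltW].
  have lagE (f : R -> R) s i : (forall t, t <= 0 -> f t = 0) ->
      lag s.+1 (fun i => f (i%:R / M%:R)) i.+1 = f (i%:R * h - s%:R * h).
    move=> f0; rewrite lag_sample // -mulrBl -/h; congr (f (_ * h)).
    by rewrite -!natr1; ring.
  have l10 t : t <= 0 -> l1 v t = 0.
    by move=> t0; apply: big1 => j _; rewrite v0 // normr0.
  have res j i : (i <= N)%N ->
      `|M%:R * (w j i - lag 1 (w j) i) + (lam j - gamma) * lag 1 (w j) i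
        + gamma * lag (Num.truncn (tau1 * M%:R)).+1 (w j) i
        + k / M%:R * memory (Num.truncn (tau2 * M%:R)) (w j) i| <=
      eps * (lag 1 (abs_sum w) i + lag (Num.truncn (tau1 * M%:R)).+1 (abs_sum w) i
             + M%:R^-1 * memory (Num.truncn (tau2 * M%:R)) (abs_sum w) i) + r i.
    case: i => [|i] iN.
      have lag0 s f : lag s.+1 f 0 = 0 by [].
      have mem0 m f : memory m f 0 = 0 by apply: big1.
      by rewrite !lag0 !mem0 /w mul0r v0 // subrr !(mulr0, addr0) normr0 add0r.
    set m1 := Num.truncn _; set m2 := Num.truncn _.
    set t := i%:R * h.
    have t0 : 0 <= t by rewrite mulr_ge0 // ltW.
    have tE : i.+1%:R / M%:R = t + h by rewrite -natr1 mulrDl mul1r.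
    have thT : t + h <= T.
      by rewrite -tE; apply: le_trans NT; rewrite ler_pM2r // ler_nat.
    have /andP[m1a m1b] : m1%:R <= tau1 * M%:R < m1.+1%:R.
      by rewrite truncn_itv // mulr_ge0 // ltW.
    have /andP[m2a m2b] : m2%:R <= tau2 * M%:R < m2.+1%:R.
      by rewrite truncn_itv // mulr_ge0 // ltW.
    have {}m1a : m1%:R * h <= tau1 by rewrite ler_pdivrMr.
    have {}m2a : m2%:R * h <= tau2 by rewrite ler_pdivrMr.
    have {}m1b : tau1 <= (m1%:R + 1) * h by rewrite natr1 ler_pdivlMr // ltW.
    have {}m2b : tau2 <= (m2%:R + 1) * h by rewrite natr1 ler_pdivlMr // ltW.
    have lag1E : lag 1 (w j) i.+1 = v j t.
      by rewrite (lagE (v j) 0%N) ?mul0r ?subr0 //; apply: v0.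
    have lagm1 : lag m1.+1 (w j) i.+1 = v j (t - m1%:R * h) by apply: lagE; apply: v0.
    have mem1 : memory m2 (w j) i.+1 = \sum_(s < m2) v j (t - s%:R * h).
      by apply: eq_bigr => s _; apply: lagE; apply: v0.
    have slag1E : lag 1 (abs_sum w) i.+1 = l1 v t.
      by rewrite (lagE (l1 v) 0%N) ?mul0r ?subr0.
    have slagm1 : lag m1.+1 (abs_sum w) i.+1 = l1 v (t - m1%:R * h) by apply: lagE.
    have smem1 : memory m2 (abs_sum w) i.+1 = \sum_(s < m2) l1 v (t - s%:R * h).
      by apply: eq_bigr => s _; apply: lagE.
    rewrite lag1E lagm1 mem1 slag1E slagm1 smem1 -/h.
    have tpos x : t < x < t + h -> 0 < x < T.
      move=> /andP[x1 x2]; move: x1 x2 t0 thT; clear => *.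
      by apply/andP; split; lra.
    (* The step is [1 / M], so 1 is a grid point and lies in the interior of no cell. *)
    have tne1 x : t < x < t + h -> x != 1.
      move=> /andP[x1 x2]; apply/eqP => xe.
      move: x1 x2; rewrite xe -tE /t /h ltr_pdivrMr // mul1r ltr_pdivlMr //.
      by rewrite mul1r !ltr_nat => x1 x2; move: (leq_trans x2 x1); rewrite ltnn.
    have dv x : t < x < t + h -> is_derive x 1 (v j) ('D_1 (v j) x).
      move=> xt; have [d hd _] := hode j x (tpos x xt) (tne1 x xt).
      by apply: derivableP; case: hd.
    have tth : t < t + h by rewrite ltrDl.
    (* The difference quotient is exactly a derivative at some [xi] in the cell. The error consists
       only of moving the arguments from [xi] to the grid. *)
    have [xi xit wE] := mean_value tth (cv j) dv.
    have dE : M%:R * (w j i.+1 - v j t) = 'D_1 (v j) xi.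
      have th : t + h - t = h by ring.
      by rewrite /w tE wE th mulrCA divff ?mulr1 // gt_eqF.
    have [d hd hdiff] := hode j xi (tpos xi xit) (tne1 xi xit).
    have /andP[xi1 xi2] := xit.
    have {hd}dd : 'D_1 (v j) xi = d by exact: derive_val.
    rewrite dE dd {dE dd dv}.
    have [rng1 [rng2 [rng3 [rng4 [rng5 [d1 d2]]]]]] : p <= xi <= T /\ p <= t <= T /\
        p <= xi - tau1 <= T /\ p <= t - m1%:R * h <= T /\
        (p <= xi - tau2 /\ p <= t - tau2) /\
        `|xi - t| <= h /\ `|xi - tau1 - (t - m1%:R * h)| <= 2 * h.
      rewrite /p; move: xi1 xi2 t0 thT m1a m1b tau1_gt0 tau2_gt0 h0 h1; rewrite !ler_norml.
      by move: (m1%:R) => m1r; clear => *; do ![split]; try (apply/andP; split); nra.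
    have c1 j' : `|v j' xi - v j' t| <= eta.
      by apply: uc => //; apply: (le_trans d1); rewrite ler_peMl ?(ltW h0) // ler1n.
    have c2 j' : `|v j' (xi - tau1) - v j' (t - m1%:R * h)| <= eta by exact: uc.
    have c3 : `|V j xi - V j (xi - tau2) - h * \sum_(s < m2) v j (t - s%:R * h)|
        <= tau2 * eta + b * h.
      apply: (@riemann_sum _ (v j) (V j) p T) => //.
      - exact: ltW.
      - exact: uc.
      - exact: hb.
      - by rewrite m2a.
      - by case: rng5.
      - by case/andP: rng1.
      - by case: rng5.
      - by case/andP: rng2.
    have l1_dist x y : (forall j', `|v j' x - v j' y| <= eta) -> `|l1 v x - l1 v y| <= n%:R * eta.
      move=> hxy; rewrite /l1 -sumrB; apply: (le_trans (ler_norm_sum _ _ _)).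
      apply: (@le_trans _ _ (\sum_(j' < n) eta)).
        by apply: ler_sum => j' _; apply: le_trans (ler_dist_dist _ _) _.
      by rewrite sumr_const card_ord -[leLHS]mulr_natl.
    have c4 : `|B xi - B (xi - tau2) - h * \sum_(s < m2) l1 v (t - s%:R * h)|
        <= tau2 * (n%:R * eta) + n%:R * b * h.
      apply: (@riemann_sum _ (l1 v) B p T) => //.
      - by rewrite mulr_ge0 // ltW.
      - by move=> x y hx hy hxy; apply: l1_dist => j'; exact: uc.
      - move=> x hx; rewrite ger0_norm ?sumr_ge0 //.
        apply: (@le_trans _ _ (\sum_(j' < n) b)); first by apply: ler_sum => j' _; exact: hb.
        by rewrite sumr_const card_ord -[leLHS]mulr_natl.
      - by rewrite m2a.
      - by case: rng5.
      - by case/andP: rng1.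
      - by case: rng5.
      - by case/andP: rng2.
    have ind : (if xi <= T1 then D else 0) <=
        (if (i.+1 <= (Num.truncn (T1 * M%:R)).+1)%N then D else 0).
      case: ifP => [xT|_]; last by case: ifP.
      rewrite ifT //; rewrite ltnS truncn_ge_nat ?mulr_ge0 ?(ltW m0) //.
      by rewrite -ler_pdivrMr // -/h -/t (le_trans (ltW xi1)).
    have tri (x y : R) : `|x| <= y -> forall c : R, `|c * x| <= `|c| * y.
      by move=> xy c; rewrite normrM ler_wpM2l.
    have g1 := tri _ _ (c1 j) gamma; have g2 := tri _ _ (c2 j) gamma.
    have g3 := tri _ _ (c1 j) (lam j); have g4 := tri _ _ c3 k.
    have lamA : `|lam j| * eta <= A * eta by rewrite ler_wpM2r // ltW.
    have g5 : `|k| * (tau2 * eta + b * h) <= `|k| * ((tau2 + b) * eta).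
      by rewrite mulrDl ler_wpM2l // lerD2l ler_wpM2l.
    have c1' := ler_normlW (l1_dist _ _ c1); have c2' := ler_normlW (l1_dist _ _ c2).
    have c4' := ler_normlW c4.
    have nbh : n%:R * b * h <= n%:R * b * eta by rewrite ler_wpM2l // mulr_ge0.
    set S1 := l1 v t in c1' *; set S2 := l1 v (t - _) in c2' *; set S3 := \sum_(s < m2) l1 _ _ in c4' *.
    have epsb : eps * (l1 v xi + l1 v (xi - tau1) + (B xi - B (xi - tau2))) <=
        eps * (S1 + S2 + h * S3) + eps * (2 * n%:R + tau2 * n%:R + n%:R * b) * eta.
      rewrite -mulrA -mulrDr ler_wpM2l ?(ltW eps0) //.
      by move: c1' c2' c4' nbh; clear; lra.
    apply: (le_trans (residual_triangle hdiff g1 g2 g3 g4)).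
    rewrite /r /e /Ce; move: epsb ind lamA g5; clear.
    set D1 := (if (_ <= _)%N then _ else _); set D2 := (if _ <= _ then _ else _).
    set X1 := eps * (l1 v xi + _ + _).
    lra.
  have fin := hM0 M MM0 Mp N w r res j0.
  have Er : energy N.+1 r / M%:R <= 2 * ((T1 + 2) * D ^+ 2 + (T + 1) * (Ce * eta) ^+ 2).
    pose x i := if (i <= (Num.truncn (T1 * M%:R)).+1)%N then D ^+ 2 else 0.
    apply: (@le_trans _ _ (2 * (\sum_(i < N.+1) x i + N.+1%:R * e ^+ 2) / M%:R)).
      rewrite ler_wpM2r ?(ltW h0) //.
      have <- : \sum_(i < N.+1) e ^+ 2 = N.+1%:R * e ^+ 2.
        by rewrite sumr_const card_ord mulr_natl.
      rewrite /energy -big_split mulr_sumr; apply: ler_sum => i _ /=.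
      rewrite /r /x; case: ifP => _; first exact: sqrD2.
      by rewrite !add0r ler_peMl ?sqr_ge0 // ler1n.
    have x_b : \sum_(i < N.+1) x i <= ((Num.truncn (T1 * M%:R))%:R + 2) * D ^+ 2.
      apply: (le_trans (sum_prefix_le _ _ (sqr_ge0 D))).
      by rewrite -[X in X%:R]addn2 natrD.
    have t1 : (Num.truncn (T1 * M%:R))%:R <= T1 * M%:R by rewrite truncn_le ?mulr_ge0 // ltW.
    have M1 : 1 <= M%:R :> R by rewrite ler1n.
    have D2 := sqr_ge0 D; have e2 : 0 <= e ^+ 2 by exact: sqr_ge0.
    rewrite ler_pdivrMr // -mulrA ler_pM2l // mulrDl; apply: lerD.
      apply: (le_trans x_b); rewrite mulrAC ler_wpM2r // mulrDl.
      by apply: lerD => //; rewrite ler_peMr.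
    rewrite mulrAC ler_wpM2r // -natr1 mulrDl mul1r; exact: lerD.
  have vN : `|v j0 T - w j0 N| <= eta.
    have pNT : p <= 0 by rewrite /p oppr_le0 !addr_ge0 // ltW.
    have TN : T <= N%:R * h + h.
      by rewrite -[X in _ + X]mul1r -mulrDl natr1 ler_pdivlMr // ltW.
    apply: uc.
    - by rewrite lexx (le_trans pNT (ltW T0)).
    - by rewrite NT (le_trans pNT) // mulr_ge0 // ltW.
    - rewrite -/h ler_norml; move: TN NT h0; clear; move: (N%:R * h) => x *.
      by apply/andP; split; lra.
  have sq : (v j0 T - w j0 N) ^+ 2 <= eta ^+ 2.
    by rewrite -[leLHS]real_normK ?num_real // ler_sqr ?nnegrE // ltW.
  have : v j0 T ^+ 2 <= 2 * w j0 N ^+ 2 + 2 * (v j0 T - w j0 N) ^+ 2.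
    by have := sqr_ge0 (v j0 T - 2 * w j0 N); nra.
  have : K * (energy N.+1 r / M%:R) <= K * (2 * ((T1 + 2) * D ^+ 2 + (T + 1) * (Ce * eta) ^+ 2)).
    by rewrite ler_wpM2l.
  lra.
have K'2 : 4 * K * (T1 + 2) * D ^+ 2 <= (K' * D) ^+ 2.
  rewrite exprMn ler_wpM2r ?sqr_ge0 // /K' -/(4 * K * (T1 + 2)).
  by move: K4; set X := 4 * K * _ => X0; rewrite sqrrD; have := sqr_ge0 X; lra.
rewrite -(@ler_pXn2r _ 2) ?nnegrE ?mulr_ge0 ?addr_ge0 // real_normK ?num_real //.
(* The discretization error grows with [T], but [T] is fixed while [eta = 1 / m] tends to 0. *)
apply: le_trans K'2; apply: (@le_archi _ _ _ (4 * K * (T + 1) * Ce ^+ 2 + 2)) => m m0.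
have mp : 0 < m%:R :> R by rewrite ltr0n.
apply: (le_trans (main (m%:R^-1) _)); first by rewrite invr_gt0.
have mm : (m%:R^-1) ^+ 2 <= m%:R^-1 :> R.
  by rewrite expr2 ler_piMl ?invr_ge0 ?(ltW mp) // invf_le1 // ler1n.
rewrite exprMn; set X := m%:R^-1 in mm *.
have c1 : 0 <= 4 * K * (T + 1) * Ce ^+ 2 + 2.
  by rewrite addr_ge0 // !mulr_ge0 ?sqr_ge0 // addr_ge0 // ltW.
have := ler_wpM2l c1 mm; lra.
Qed.

End Core.

(** * Antiderivatives on the whole line *)

Section Antiderivative.
Variable R : realType.
Implicit Types (f F : R -> R).
Local Notation mu := (@lebesgue_measure R).

Lemma continuous_integrable_itv f (p q : R) : continuous f ->
  mu.-integrable `[p, q] (EFin \o f).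
Proof.
move=> cf; apply: continuous_compact_integrable; first exact: segment_compact.
exact: continuous_subspaceT.
Qed.

Lemma antiderivative_right f (p : R) : continuous f ->
  exists F, forall t, p < t -> is_derive t 1 F (f t).
Proof.
move=> cf; exists (fun x => \int[mu]_(t in `[p, x]) f t)%R => t pt.
have t1 : t < t + 1 by rewrite ltrDl.
have [d e] := continuous_FTC1_closed t1 (continuous_integrable_itv p (t + 1) cf) pt (cf t).
by rewrite derive1E in e; exact: DeriveDef d e.
Qed.

(** An integral from -1 serves only to the right of -1. A reflected one serves to the left of 1, and
    the two are glued at 0, since they differ by a constant on the overlap. *)
Lemma antiderivative f : continuous f -> exists F, forall t : R, is_derive t 1 F (f t).
Proof.
move=> cf; have [H hH] := antiderivative_right (-1) cf.
have cfN : continuous (fun t => f (- t)).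
  move=> t; apply: (@continuous_comp _ _ _ (fun t => - t) f); last exact: cf.
  by apply: cvgN; exact: cvg_id.
have [G hG] := antiderivative_right (-1) cfN.
have hG' (t : R) : t < 1 -> is_derive t 1 (fun t => - G (- t)) (f t).
  move=> t1; have gt : is_derive (- t) 1 G (f t).
    by have := hG (- t); rewrite opprK; apply; rewrite ltrN2.
  have := is_deriveN (is_derive1_comp gt (is_deriveN (is_derive_id t 1))).
  by rewrite mulrN1 opprK.
pose c := H 0 + G 0.
have eqHG (t : R) : -1 < t < 1 -> H t = - G (- t) + c.
  move=> /andP[t1 t2].
  pose K s := H s - - G (- s).
  have hK (s : R) : -1 < s < 1 -> is_derive s 1 K 0.
    move=> /andP[s1 s2]; rewrite -(subrr (f s)); apply: is_deriveB; first exact: hH.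
    exact: hG'.
  suff : K t = K 0 by rewrite /K /c oppr0 opprK opprK => <-; ring.
  have cK (p q : R) : -1 < p -> q < 1 -> {within `[p, q], continuous K}.
    move=> p1 q1; apply: derivable_within_continuous => s; rewrite in_itv /= => /andP[s1 s2].
    by case: (hK s) => //; rewrite (lt_le_trans p1) //= (le_lt_trans s2).
  have const (p q : R) : -1 < p -> p <= q -> q < 1 -> K p = K q.
    move=> p1; rewrite le_eqVlt => /orP[/eqP->//|pq] q1.
    have hd x : x \in `]p, q[ -> is_derive x 1 K ((fun=> 0) x).
      by rewrite in_itv => /andP[x1 x2]; apply: hK; rewrite (lt_trans p1) //= (lt_trans x2).
    have [x _ /eqP] := MVT pq hd (cK p q p1 q1).
    by rewrite mul0r subr_eq0 => /eqP.
  by have [t0|/ltW t0] := leP 0 t; [rewrite (const 0 t)|rewrite (const t 0)] => //; rewrite ?ltr01 // ltrN10.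
pose F t := if t < 0 then - G (- t) + c else H t.
exists F => t; have [t0|t0] := ltP t 0.
  have ft : is_derive t 1 (fun t => - G (- t) + c) (f t).
    have := is_deriveD (hG' t (lt_trans t0 ltr01)) (is_derive_cst c t 1).
    by rewrite addr0.
  have near : \forall s \near t, - G (- s) + c = F s.
    near=> s; rewrite /F ifT //; near: s; exact: lt_nbhsl.
  exact: near_eq_is_derive near ft.
have t1 : -1 < t by rewrite (lt_le_trans _ t0) // ltrN10.
have near : \forall s \near t, H s = F s.
  have [t0'|] := ltP 0 t.
    near=> s; rewrite /F ifF //; apply/negbTE; rewrite -leNgt ltW //.
    by near: s; exact: lt_nbhsr.
  move=> t0'; have te : t = 0 by apply/eqP; rewrite eq_le t0 t0'.
  near=> s; rewrite /F; case: ifP => // s0; apply: eqHG.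
  rewrite (lt_trans s0) ?andbT //; near: s.
  by apply: lt_nbhsr.
exact: near_eq_is_derive near (hH t t1).
Unshelve. all: by end_near.
Qed.

Lemma int_delay f F (t tau : R) : 0 < tau -> continuous f ->
  (forall t : R, is_derive t 1 F (f t)) ->
  (\int[mu]_(s in `[0%R, tau]) f (t - s) = F t - F (t - tau))%R.
Proof.
move=> tau0 cf hF.
have cfd : continuous (fun s => f (t - s)).
  move=> s; apply: (@continuous_comp _ _ _ (fun s => t - s) f); last exact: cf.
  by apply: cvgB; [exact: cvg_cst|exact: cvg_id].
have hd (s : R) : is_derive s 1 (fun s => - F (t - s)) (f (t - s)).
  have := is_deriveN (@is_derive1_comp _ F (fun s => t - s) s _ _ (hF (t - s)) (is_deriveB (is_derive_cst t s 1) (is_derive_id s 1))).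
  by rewrite sub0r mulrN1 opprK.
have cF : continuous (fun s => - F (t - s)) by exact: is_derive_continuous hd.
rewrite /Rintegral (@continuous_FTC2 _ (fun s => f (t - s)) (fun s => - F (t - s)) 0 tau) //=.
- by rewrite subr0 opprK addrC.
- exact: continuous_subspaceT.
- split.
  + by move=> s _; case: (hd s).
  + by apply: cvg_at_right_filter; exact: cF.
  + by apply: cvg_at_left_filter; exact: cF.
- by move=> s _; rewrite derive1E; apply: derive_val.
Qed.

End Antiderivative.

(** * Replacing the history by a ramp and inserting the exponential weight *)

Section Ramp.
Variables (R : realType) (sg : R) (y : R -> R).
Hypothesis cy : continuous y.

(* The history before 0 is replaced by a linear ramp, and time is shifted by 1
   so that the result vanishes on negative times; [sg] is the decay rate that
   is to be shown. *)
Definition ramp (t : R) : R :=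
  Num.min 1 (Num.max 0 t) * (expR (sg * Num.max 0 (t - 1)) * y (Num.max 0 (t - 1))).

Lemma ramp_continuous : continuous ramp.
Proof.
have cpos (c : R) : continuous (fun t : R => Num.max 0 (t - c)).
  move=> t; apply: (@continuous_max _ _ (fun=> 0) (fun t => t - c)); first exact: cvg_cst.
  by apply: cvgB; [exact: cvg_id|exact: cvg_cst].
have cmin : continuous (fun t : R => Num.min 1 (Num.max 0 t)).
  move=> t; have h0 : {for t, continuous ((fun=> 0 : R) \max id)}.
    by apply: continuous_max; [exact: cvg_cst|exact: cvg_id].
  have h1 : {for t, continuous ((fun=> 1 : R) \min ((fun=> 0 : R) \max id))}.
    by apply: continuous_min => //; exact: cvg_cst.
  exact: h1.
have csp : continuous (fun t : R => sg * Num.max 0 (t - 1)).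
  by move=> t; apply: cvgM; [exact: cvg_cst|exact: cpos].
have cexp : continuous (fun t : R => expR (sg * Num.max 0 (t - 1))).
  by move=> t; exact: (continuous_comp (csp t) (@continuous_expR R _)).
have cyp : continuous (fun t : R => y (Num.max 0 (t - 1))).
  by move=> t; exact: (continuous_comp (cpos 1 t) (@cy _)).
by move=> t; apply: cvgM; [exact: cmin|apply: cvgM; [exact: cexp|exact: cyp]].
Qed.

Lemma ramp_le0 (t : R) : t <= 0 -> ramp t = 0.
Proof. by move=> t0; rewrite /ramp (max_idPl t0) min_r ?mul0r. Qed.

Lemma ramp_mid (t : R) : 0 <= t <= 1 -> ramp t = t * y 0.
Proof.
move=> /andP[t0 t1]; rewrite /ramp (max_idPr t0) (min_idPr t1).
by rewrite (@max_l _ _ 0) ?subr_le0 // mulr0 expR0 mul1r.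
Qed.

Lemma ramp_right (t : R) : 1 <= t -> ramp t = expR (sg * (t - 1)) * y (t - 1).
Proof.
move=> t1; rewrite /ramp (@max_r _ _ 0 t) ?(le_trans ler01) // (min_idPl t1) mul1r.
by rewrite max_r ?subr_ge0.
Qed.

Lemma is_derive_ramp_mid (t : R) : 0 < t < 1 -> is_derive t 1 ramp (y 0).
Proof.
move=> /andP[t0 t1]; apply: (@near_eq_is_derive _ _ _ (fun t : R => t * y 0)).
  near=> s; rewrite ramp_mid //; apply/andP; split; apply: ltW; near: s.
    exact: lt_nbhsr.
  exact: lt_nbhsl.
by apply: is_derive_eq; rewrite /GRing.scale /= mulr0 add0r mulr1.
Unshelve. all: by end_near.
Qed.

Lemma is_derive_ramp_right (t d : R) : 1 < t -> is_derive (t - 1) 1 y d ->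
  is_derive t 1 ramp (sg * ramp t + expR (sg * (t - 1)) * d).
Proof.
move=> t1 hy; apply: (@near_eq_is_derive _ _ _ (fun t : R => expR (sg * (t - 1)) * y (t - 1))).
  near=> s; rewrite ramp_right //; apply: ltW; near: s; exact: lt_nbhsr.
have hy' : is_derive t 1 (fun t => y (t - 1)) d.
  have := @is_derive1_comp _ y (fun t => t - 1) t _ _ hy
    (is_deriveB (is_derive_id t (1 : R)) (is_derive_cst (1 : R) t (1 : R))).
  by rewrite subr0 mulr1.
have he : is_derive t 1 (fun t => expR (sg * (t - 1))) (expR (sg * (t - 1)) * sg).
  apply: (@is_derive1_comp _ expR (fun t => sg * (t - 1))).
  by apply: is_derive_eq; rewrite /GRing.scale /= subr0 !mulr1 // mulr0 addr0.
have := is_deriveM he hy'; rewrite /GRing.scale /= ramp_right ?ltW // => h.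
apply: (is_derive_eq h); rewrite [X in X = _]/=; ring.
Unshelve. all: by end_near.
Qed.

End Ramp.

(** * Exponential decay for the diagonal system *)

Section Decay.
Variable R : realType.

Lemma expR_le_1D2x (x : R) : 0 <= x <= 1 / 2 -> expR x - 1 <= 2 * x.
Proof.
move=> /andP[x0 x1]; have := expR_ge1Dx (- x); rewrite expRN => h.
have e0 := expR_gt0 x.
have : (1 - x) * expR x <= 1 by rewrite -ler_pdivlMr // div1r.
have : expR x <= 2 * (1 - x) * expR x.
  by rewrite ler_peMl ?(ltW e0) //; lra.
by nra.
Qed.

Lemma is_derive_reflect (F : R -> R) (t r d : R) : is_derive (t - r) 1 F d ->
  is_derive r 1 (fun r => F (t - r)) (- d).
Proof.
move=> h.
have := @is_derive1_comp _ F (fun r => t - r) r _ _ h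
  (is_deriveB (is_derive_cst t r (1 : R)) (is_derive_id r (1 : R))).
by rewrite sub0r mulrN1.
Qed.

(** Compares integrals over two windows that end at different times, after the substitution
    [r -> s - r] in one and [r -> t - r] in the other. *)
Lemma le_delay_increment (f g F G : R -> R) (s t tau c e : R) : 0 <= tau ->
  (forall t : R, is_derive t 1 F (f t)) -> (forall t : R, is_derive t 1 G (g t)) ->
  (forall r, 0 <= r <= tau -> c * f (s - r) <= g (t - r) + e) ->
  c * (F s - F (s - tau)) <= G t - G (t - tau) + tau * e.
Proof.
move=> tau0 hF hG h.
have d1 (r : R) : is_derive r 1 (fun r => - c * F (s - r)) (c * f (s - r)).
  have := is_deriveZ (- c) (is_derive_reflect (hF (s - r))).
  by rewrite /GRing.scale /= mulrNN.
have d2 (r : R) : is_derive r 1 (fun r => e * r - G (t - r)) (g (t - r) + e).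
  apply: (is_derive_eq (is_deriveB (is_deriveZ e (is_derive_id r (1 : R))) (is_derive_reflect (hG (t - r))))).
  by rewrite /GRing.scale /= mulr1 opprK addrC.
have := le_increment tau0 (is_derive_continuous d1) (is_derive_continuous d2)
  (fun r _ => d1 r) (fun r _ => d2 r) _.
rewrite !subr0 mulr0 => H.
have {}H : - c * F (s - tau) - - c * F s <= e * tau - G (t - tau) - (0 - G t).
  by apply: H => r /andP[r1 r2]; apply: h; rewrite !ltW.
lra.
Qed.

Lemma continuous_fin_sum (n : nat) (F : 'I_n -> R -> R) :
  (forall j, continuous (F j)) -> continuous (fun t => \sum_j F j t).
Proof.
elim: n F => [|n IH] F cF t.
  by under eq_fun do rewrite big_ord0; exact: cvg_cst.
rewrite /continuous_at; under eq_fun do rewrite big_ord_recr.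
rewrite big_ord_recr; apply: cvgD; last exact: cF.
exact: (IH (fun j => F (widen_ord (leqnSn n) j))).
Qed.

Lemma is_derive_fin_sum (n : nat) (F : 'I_n -> R -> R) (d : 'I_n -> R) (t : R) :
  (forall j, is_derive t 1 (F j) (d j)) ->
  is_derive t 1 (fun t => \sum_j F j t) (\sum_j d j).
Proof.
elim: n F d => [|n IH] F d hF.
  under eq_fun do rewrite big_ord0; rewrite big_ord0; exact: is_derive_cst.
under eq_fun do rewrite big_ord_recr; rewrite big_ord_recr.
exact: (is_deriveD (IH _ _ (fun j => hF (widen_ord (leqnSn n) j))) (hF ord_max)).
Qed.

Lemma decay_triangle (d ex g l k sg v1 v2 y2 VV YY X E1 E2 : R) : 0 <= sg ->
  `|ex * d - (g * (v1 - y2) - l * v1 - k * YY)| <= X ->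
  `|y2 - v2| <= E1 -> `|YY - VV| <= E2 ->
  `|sg * v1 + ex * d - (g * (v1 - v2) - l * v1 - k * VV)| <=
    X + sg * `|v1| + `|g| * E1 + `|k| * E2.
Proof.
move=> sg0 hX h1 h2.
have -> : sg * v1 + ex * d - (g * (v1 - v2) - l * v1 - k * VV) =
  (ex * d - (g * (v1 - y2) - l * v1 - k * YY)) + sg * v1 + - g * (y2 - v2) + - k * (YY - VV).
  by ring.
apply: (le_trans (ler_normD _ _)); apply: lerD; last by rewrite normrM normrN ler_wpM2l.
apply: (le_trans (ler_normD _ _)); apply: lerD; last by rewrite normrM normrN ler_wpM2l.
by apply: (le_trans (ler_normD _ _)); apply: lerD => //; rewrite normrM (ger0_norm sg0).
Qed.

(** The weighted solution solves the same equation up to [sg * v], from differentiating the weight,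
    and up to terms of relative size [exp (sg tau) - 1], from moving the weight past a delay. Both
    are small with [sg]. History and ramp contribute a forcing of size [delta] that ends at time
    [1 + tau]. *)
Lemma diagonal_decay (n : nat) (lam : 'I_n -> R) (gamma tau1 tau2 k tau : R) :
  0 < tau1 -> 0 < tau2 -> tau1 <= tau -> tau2 <= tau ->
  (forall j, exists c : R, 0 < c /\ exists M0 : nat, forall M, (M0 <= M)%N ->
     gain (dpoly M (Num.truncn (tau1 * M%:R)) (Num.truncn (tau2 * M%:R)) (lam j) gamma k) c^-1) ->
  exists eps sg K : R, [/\ 0 < eps, 0 < sg, 0 <= K &
    forall (T delta : R) (y Y : 'I_n -> R -> R) (B : R -> R),
    0 < T -> 0 <= delta ->
    (forall j, continuous (y j)) ->
    (forall j t, - tau <= t <= 0 -> `|y j t| <= delta) ->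
    (forall j (t : R), is_derive t 1 (Y j) (y j t)) ->
    (forall t : R, is_derive t 1 B (l1 y t)) ->
    (forall j t, 0 < t < T -> exists2 d : R, is_derive t 1 (y j) d &
       `|d - (gamma * (y j t - y j (t - tau1)) - lam j * y j t - k * (Y j t - Y j (t - tau2)))|
       <= eps * (l1 y t + l1 y (t - tau1) + (B t - B (t - tau2)))) ->
    forall j, `|y j T| <= K * delta * expR (- (sg * T))].
Proof.
move=> tau1_gt0 tau2_gt0 tau1_le tau2_le gains.
have tau0 : 0 < tau by apply: lt_le_trans tau1_le.
have T1_ge0 : 0 <= 1 + tau by rewrite addr_ge0 // ltW.
have [eps [K [eps0 K0 core]]] := zero_history_estimate tau1_gt0 tau2_gt0 T1_ge0 gains.
pose G := 1 + `|gamma| + `|k|.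
have G0 : 0 < G by rewrite /G ltr_pwDl // ltr_pwDl.
(* The first bound allows [exp x - 1 <= 2 x] at [x = sg tau] and gives [rho <= 1]; the second makes
   [(sg + rho) G] at most [eps / 4]. *)
pose sg := Num.min (1 / 2) (eps / 8 / G) / (1 + tau).
have t10 : 0 < 1 + tau by rewrite addr_gt0.
have sg0 : 0 < sg by rewrite divr_gt0 // lt_min !divr_gt0.
have sg1 : sg * (1 + tau) <= 1 / 2 by rewrite divfK ?gt_eqF // ge_min lexx.
have sg2 : sg * (1 + tau) <= eps / 8 / G by rewrite divfK ?gt_eqF // ge_min lexx orbT.
pose rho := expR (sg * tau) - 1.
have rho0 : 0 <= rho by rewrite subr_ge0 -expR0 ler_expR mulr_ge0 // ltW.
have sgt : 0 <= sg * tau by rewrite mulr_ge0 // ltW.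
have rho2 : rho <= 2 * (sg * tau).
  by apply: expR_le_1D2x; rewrite sgt /=; move: sg1; rewrite mulrDr mulr1; lra.
have rho1 : rho <= 1 by move: sg1; rewrite mulrDr mulr1; lra.
have smallG : (sg + rho) * G <= eps / 4.
  have : (sg * (1 + tau)) * G <= eps / 8 by rewrite -ler_pdivlMr.
  have : (sg + rho) * G <= 2 * (sg * (1 + tau)) * G.
    by rewrite ler_pM2r // mulrDr mulr1; lra.
  lra.
pose A := \sum_j `|lam j|.
have Aj j : `|lam j| <= A by rewrite /A (bigD1 j) //= lerDl sumr_ge0.
have A0 : 0 <= A by apply: sumr_ge0.
(* The terms before the factor 3 bound the defect of the ramp on [[0, 1]]; the others bound the
   error made when a delay reaches back to the ramp or the history, where [De = 3 delta]. *)
pose KD := 1 + 2 * `|gamma| + A + `|k| * tau2 + 3 * (eps / 4 * n%:R * (2 + tau2) + `|gamma| + `|k| * tau2).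
have KD0 : 0 <= KD.
  have h1 := normr_ge0 gamma; have h2 : 0 <= `|k| * tau2 by rewrite mulr_ge0 // ltW.
  have h3 : 0 <= eps / 4 * n%:R * (2 + tau2).
    by rewrite !mulr_ge0 ?addr_ge0 ?invr_ge0 ?(ltW eps0) ?(ltW tau2_gt0).
  rewrite /KD; lra.
(* Passing to the weighted solution at most doubles the given residual, so it uses [eps / 2]; the
   perturbations by the weight use another [eps / 4]. *)
exists (eps / 4), sg, (K * KD); split => //; [by rewrite divr_gt0|by rewrite mulr_ge0|].
move=> T delta y Y B T0 delta0 cy hist hY hB ode j0.
pose v j := ramp sg (y j).
have cv j : continuous (v j) by apply: ramp_continuous.
have [V hV] := choice (fun j => antiderivative (cv j)).
have cl1 : continuous (l1 v).
  apply: continuous_fin_sum => j t.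
  exact: (continuous_comp (cv j t) (@norm_continuous _ _ _)).
have [Bv hBv] := antiderivative cl1.
have vr t j : 1 <= t -> v j t = expR (sg * (t - 1)) * y j (t - 1) by exact: ramp_right.
have vsmall t j : t <= 1 -> `|v j t| <= delta.
  move=> t1; have [t0|t0] := leP t 0; first by rewrite /v ramp_le0 // normr0.
  rewrite /v ramp_mid; last by rewrite (ltW t0).
  rewrite normrM (gtr0_norm t0) (@le_trans _ _ `|y j 0|) //; first by rewrite ler_piMl.
  by apply: hist; rewrite lexx andbT oppr_le0 ltW.
have l1v0 t : 0 <= l1 v t by apply: sumr_ge0.
have Bmono t : 0 <= Bv t - Bv (t - tau2).
  rewrite subr_ge0 -subr_ge0.
  have := @le_increment _ (fun=> 0) Bv (fun=> 0) (l1 v) (t - tau2) t.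
  rewrite subrr; apply => //.
  - by rewrite gerBl ltW.
  - by move=> x; exact: cvg_cst.
  - exact: is_derive_continuous hBv.
have core1 := core (T + 1) (KD * delta) v V Bv.
have -> : K * KD * delta * expR (- (sg * T)) = expR (- (sg * T)) * (K * (KD * delta)) by ring.
have vT : v j0 (T + 1) = expR (sg * T) * y j0 T.
  by rewrite vr ?addrK // lerDr ltW.
rewrite expRN ler_pdivlMl ?expR_gt0 //.
rewrite -[X in X * _](gtr0_norm (expR_gt0 _)) -normrM -vT.
apply: core1 => //.
- by rewrite addr_gt0.
- by rewrite mulr_ge0.
- by move=> j t t0; exact: ramp_le0.
move=> j t /andP[t0 tT] t1.
have [{}t1|{}t1|/eqP] := ltgtP t 1; last by rewrite (negbTE t1).
  exists (y j 0); first by apply: is_derive_ramp_mid; rewrite t0.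
  rewrite ifT; last by apply: ltW; rewrite (lt_trans t1) // ltrDl.
  have VV : `|V j t - V j (t - tau2)| <= tau2 * delta.
    have lt1 : t - tau2 < t by rewrite gtrBl.
    have [x /andP[_ x2] ->] := mean_value lt1 (is_derive_continuous (hV j)) (fun x _ => hV j x).
    rewrite opprB addrC subrK normrM (gtr0_norm tau2_gt0) mulrC ler_pM2l //.
    by apply: vsmall; rewrite ltW // (lt_trans x2).
  have h1 : `|v j t| <= delta by apply/vsmall/ltW.
  have h2 : `|v j (t - tau1)| <= delta.
    by apply: vsmall; rewrite ltW // (le_lt_trans _ t1) // gerBl ltW.
  have h3 : `|y j 0| <= delta by apply: hist; rewrite lexx andbT oppr_le0 ltW.
  have X0 : 0 <= eps * (l1 v t + l1 v (t - tau1) + (Bv t - Bv (t - tau2))).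
    by rewrite mulr_ge0 ?(ltW eps0) // addr_ge0 ?Bmono // addr_ge0.
  apply: (@le_trans _ _ (KD * delta)); last by rewrite lerDr.
  have -> : y j 0 - (gamma * (v j t - v j (t - tau1)) - lam j * v j t - k * (V j t - V j (t - tau2)))
    = y j 0 + - gamma * (v j t - v j (t - tau1)) + lam j * v j t + k * (V j t - V j (t - tau2)).
    by ring.
  apply: (@le_trans _ _ (delta + `|gamma| * (2 * delta) + A * delta + `|k| * (tau2 * delta))).
    apply: (le_trans (ler_normD _ _)); apply: lerD; last by rewrite normrM ler_wpM2l.
    apply: (le_trans (ler_normD _ _)); apply: lerD; last first.
      by rewrite normrM ler_pM.
    apply: (le_trans (ler_normD _ _)); apply: lerD => //.
    rewrite normrM normrN ler_wpM2l //; apply: (le_trans (ler_normB _ _)).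
    by rewrite mulr_natl mulr2n lerD.
  have h4 : 0 <= (eps / 4 * n%:R * (2 + tau2) + `|gamma| + `|k| * tau2) * delta.
    by rewrite !(mulr_ge0, addr_ge0) ?invr_ge0 ?(ltW eps0) ?(ltW tau2_gt0).
  move: h4; rewrite /KD; clear; lra.
pose s := t - 1.
have s0 : 0 < s by rewrite subr_gt0.
have sT : s < T by rewrite /s ltrBlDr.
have [d hd hdiff] := ode j s (ssrbool.introT andP (conj s0 sT)).
exists (sg * v j t + expR (sg * s) * d); first by apply: is_derive_ramp_right.
set ex := expR (sg * s); have ex0 : 0 < ex by exact: expR_gt0.
pose De : R := if t <= 1 + tau then 3 * delta else 0.
have De0 : 0 <= De by rewrite /De; case: ifP => // _; rewrite mulr_ge0.
(* For [r <= s] the first term is exactly [exp (sg r)] times the second. Otherwise both arguments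
   lie in the history or the ramp, and [ex <= 2] bounds the difference by [2 delta + delta]. *)
have P j' r : 0 <= r <= tau -> `|ex * y j' (s - r) - v j' (t - r)| <= rho * `|v j' (t - r)| + De.
  move=> /andP[r0 rt]; have [rs|sr] := leP r s.
    have -> : v j' (t - r) = expR (sg * (s - r)) * y j' (s - r).
      have tr : t - r - 1 = s - r by rewrite /s; ring.
      by rewrite vr ?tr // lerBrDr -lerBrDl.
    set w := expR _ * _.
    have -> : ex * y j' (s - r) = expR (sg * r) * w.
      by rewrite /w mulrA -expRD /ex; congr (expR _ * _); ring.
    rewrite -{2}(mul1r w) -mulrBl normrM.
    apply: (@le_trans _ _ (rho * `|w|)); last by rewrite lerDl.
    rewrite ler_wpM2r // ger0_norm; first by rewrite lerD2r ler_expR ler_pM2l.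
    by rewrite subr_ge0 -expR0 ler_expR mulr_ge0 // ltW.
  have t1t : t <= 1 + tau by rewrite -lerBlDl -/s ltW // (lt_le_trans sr).
  have DeE : De = 3 * delta by rewrite /De t1t.
  have ex2 : ex <= 2.
    have : ex <= expR (sg * tau).
      by rewrite ler_expR ler_pM2l // ltW // (lt_le_trans sr).
    by move: rho1; rewrite /rho; clear; lra.
  have y1 : `|y j' (s - r)| <= delta.
    apply: hist; rewrite subr_le0 (ltW sr) andbT lerBrDl.
    by rewrite (le_trans _ (ltW s0)) // subr_le0.
  have v1 : `|v j' (t - r)| <= delta by apply: vsmall; rewrite lerBlDl -lerBlDr ltW.
  rewrite DeE (@le_trans _ _ (3 * delta)) //; last by rewrite lerDr mulr_ge0.
  have : `|ex * y j' (s - r)| <= 2 * delta.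
    by rewrite normrM (gtr0_norm ex0) ler_pM // ltW.
  have := ler_normB (ex * y j' (s - r)) (v j' (t - r)).
  by move: v1; clear; lra.
have Q r : 0 <= r <= tau -> ex * l1 y (s - r) <= 2 * l1 v (t - r) + n%:R * De.
  move=> hr; have -> : n%:R * De = \sum_(j' < n) De by rewrite sumr_const card_ord mulr_natl.
  rewrite /l1 !mulr_sumr -big_split /=.
  apply: ler_sum => j' _; have := P j' r hr.
  have : `|ex * y j' (s - r)| = ex * `|y j' (s - r)| by rewrite normrM (gtr0_norm ex0).
  have := ler_normD (ex * y j' (s - r) - v j' (t - r)) (v j' (t - r)); rewrite subrK => h1 h2 h3.
  rewrite -h2; have : rho * `|v j' (t - r)| <= `|v j' (t - r)| by rewrite ler_piMl.
  by move: h1 h3; clear; lra.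
have I1 : `|ex * (Y j s - Y j (s - tau2)) - (V j t - V j (t - tau2))|
    <= rho * (Bv t - Bv (t - tau2)) + tau2 * De.
  have vl1 j' x : `|v j' x| <= l1 v x by rewrite /l1 (bigD1 j') //= lerDl sumr_ge0.
  have up r : 0 <= r <= tau2 -> `|ex * y j (s - r) - v j (t - r)| <= rho * l1 v (t - r) + De.
    move=> /andP[r0 r2]; apply: (le_trans (P j r _)); first by rewrite r0 (le_trans r2).
    by rewrite lerD2r ler_wpM2l.
  have hVp (x : R) : is_derive x 1 (fun x => V j x + rho * Bv x) (v j x + rho * l1 v x).
    exact: (is_deriveD (hV j x) (is_deriveZ rho (hBv x))).
  have hVm (x : R) : is_derive x 1 (fun x => - V j x + rho * Bv x) (- v j x + rho * l1 v x).
    exact: (is_deriveD (is_deriveN (hV j x)) (is_deriveZ rho (hBv x))).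
  have hYm (x : R) : is_derive x 1 (fun x => - Y j x) (- y j x) by exact: (is_deriveN (hY j x)).
  have u1 := @le_delay_increment _ _ _ _ s t tau2 ex De (ltW tau2_gt0) (hY j) hVp.
  have u2 := @le_delay_increment _ _ _ _ s t tau2 ex De (ltW tau2_gt0) hYm hVm.
  have {}u1 := u1 (fun r hr => ltac:(have /ler_normlP[? ?] := up r hr; lra)).
  have {}u2 := u2 (fun r hr => ltac:(have /ler_normlP[? ?] := up r hr; lra)).
  rewrite ler_norml; move: u1 u2; clear => u1 u2; apply/andP; split; lra.
have I2 : ex * (B s - B (s - tau2)) <= 2 * (Bv t - Bv (t - tau2)) + tau2 * (n%:R * De).
  have hB2 (x : R) : is_derive x 1 (fun x => 2 * Bv x) (2 * l1 v x).
    exact: (is_deriveZ 2 (hBv x)).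
  have := @le_delay_increment _ _ _ _ s t tau2 ex (n%:R * De) (ltW tau2_gt0) hB hB2.
  by rewrite -mulrBr; apply => r /andP[r0 r2]; apply: Q; rewrite r0 (le_trans r2).
have exy : ex * y j s = v j t by rewrite vr ?ltW.
have P1 : `|ex * y j (s - tau1) - v j (t - tau1)| <= rho * l1 v (t - tau1) + De.
  have vl1 j' x : `|v j' x| <= l1 v x by rewrite /l1 (bigD1 j') //= lerDl sumr_ge0.
  apply: (le_trans (P j tau1 _)); first by rewrite (ltW tau1_gt0).
  by rewrite lerD2r ler_wpM2l.
have X : `|ex * d - (gamma * (v j t - ex * y j (s - tau1)) - lam j * v j t
    - k * (ex * (Y j s - Y j (s - tau2))))| <=
    eps / 4 * (2 * l1 v t + 2 * l1 v (t - tau1) + 2 * (Bv t - Bv (t - tau2))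
      + (2 + tau2) * (n%:R * De)).
  have -> : ex * d - (gamma * (v j t - ex * y j (s - tau1)) - lam j * v j t
      - k * (ex * (Y j s - Y j (s - tau2)))) =
    ex * (d - (gamma * (y j s - y j (s - tau1)) - lam j * y j s - k * (Y j s - Y j (s - tau2)))).
    by rewrite -exy; ring.
  rewrite normrM (gtr0_norm ex0).
  apply: (@le_trans _ _ (ex * (eps / 4 * (l1 y s + l1 y (s - tau1) + (B s - B (s - tau2)))))).
    by rewrite ler_pM2l.
  rewrite mulrCA ler_wpM2l ?divr_ge0 ?(ltW eps0) //.
  have Q0 := Q 0; rewrite !subr0 lexx ltW //= in Q0.
  have Q1 := Q tau1; rewrite tau1_le ltW //= in Q1.
  move: (Q0 isT) (Q1 isT) I2; clear; lra.
apply: (le_trans (decay_triangle (ltW sg0) X P1 I1)).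
have DeE : (eps / 4 * n%:R * (2 + tau2) + `|gamma| + `|k| * tau2) * De <=
   (if t <= 1 + tau then KD * delta else 0).
  rewrite /De; case: ifP => _; last by rewrite mulr0.
  rewrite mulrA [_ * 3]mulrC ler_wpM2r // /KD lerDr.
  by rewrite !addr_ge0 ?mulr_ge0 // ltW.
have vl1t : `|v j t| <= l1 v t by rewrite /l1 (bigD1 j) //= lerDl sumr_ge0.
have a1 : sg * `|v j t| <= eps / 4 * l1 v t.
  apply: ler_pM => //; first exact: ltW.
  have G1 : 1 <= G by rewrite /G -addrA lerDl addr_ge0.
  apply: le_trans smallG; rewrite -[leLHS]mulr1.
  by apply: ler_pM => //; [exact: ltW|rewrite lerDl].
have a2 : `|gamma| * rho <= eps / 4.
  apply: le_trans smallG; rewrite mulrC.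
  by apply: ler_pM => //; [rewrite lerDr ltW|rewrite /G addrAC lerDr addr_ge0].
have a3 : `|k| * rho <= eps / 4.
  apply: le_trans smallG; rewrite mulrC.
  by apply: ler_pM => //; [rewrite lerDr ltW|rewrite /G lerDr addr_ge0].
have b2 := ler_wpM2r (l1v0 (t - tau1)) a2.
have b3 := ler_wpM2r (Bmono t) a3.
move: DeE a1 b2 b3 (ltW eps0) (l1v0 t) (l1v0 (t - tau1)) (Bmono t); clear.
set BB := Bv t - _; set S1 := l1 v t; set S2 := l1 v _; set DD := (if _ then _ else _).
move: BB S1 S2 DD => BB S1 S2 DD h1 h2 h3 h4 e0 s1 s2 s3.
have := mulr_ge0 e0 s1; have := mulr_ge0 e0 s2; have := mulr_ge0 e0 s3.
lra.
Qed.

End Decay.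

(** * Change of basis to the eigenvectors *)

Section MatrixDecay.
Variable R : realType.

Lemma l1_linear_le (m n : nat) (A : 'M[R]_(m, n)) (x : 'I_m -> R) :
  \sum_j `|\sum_i x i * A i j| <= (\sum_j \sum_i `|A i j|) * \sum_i `|x i|.
Proof.
rewrite mulr_suml; apply: ler_sum => j _; apply: (le_trans (ler_norm_sum _ _ _)).
rewrite mulr_suml; apply: ler_sum => i _; rewrite normrM mulrC ler_wpM2l //.
by rewrite (bigD1 i) //= lerDl sumr_ge0.
Qed.

(** States are rows, so [y = x Q] decouples. The tolerance drops by [q^2]: one factor for
    transporting the residual to [y], one for bounding the sums of [|x|] by those of [|y|]. *)
Lemma matrix_decay (n : nat) (C Q : 'M[R]_n) (lam : 'rV[R]_n) (a gamma tau1 tau2 k tau : R) :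
  Q \in unitmx -> C *m Q = Q *m diag_mx lam ->
  0 < tau1 -> 0 < tau2 -> tau1 <= tau -> tau2 <= tau ->
  (forall j, exists c : R, 0 < c /\ exists M0 : nat, forall M, (M0 <= M)%N ->
     gain (dpoly M (Num.truncn (tau1 * M%:R)) (Num.truncn (tau2 * M%:R)) (a + lam 0 j) gamma k) c^-1) ->
  exists eps sg K : R, [/\ 0 < eps, 0 < sg, 0 <= K &
    forall (T delta : R) (x X : 'I_n -> R -> R) (B : R -> R),
    0 < T -> 0 <= delta ->
    (forall i, continuous (x i)) ->
    (forall i t, - tau <= t <= 0 -> `|x i t| <= delta) ->
    (forall i (t : R), is_derive t 1 (X i) (x i t)) ->
    (forall t : R, is_derive t 1 B (l1 x t)) ->
    (forall i t, 0 < t < T -> exists2 d : R, is_derive t 1 (x i) d &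
       `|d - (gamma * (x i t - x i (t - tau1)) - a * x i t - (\sum_l x l t * C l i)
              - k * (X i t - X i (t - tau2)))|
       <= eps * (l1 x t + l1 x (t - tau1) + (B t - B (t - tau2)))) ->
    forall i, `|x i T| <= K * delta * expR (- (sg * T))].
Proof.
move=> uQ CQ t10 t20 t1t t2t gains.
have [eps [sg [K [eps0 sg0 K0 dec]]]] := diagonal_decay t10 t20 t1t t2t gains.
pose Qi := invmx Q.
pose q := 1 + \sum_j \sum_i `|Q i j| + \sum_j \sum_i `|Qi i j|.
have s1 : 0 <= \sum_j \sum_i `|Q i j| by apply: sumr_ge0 => j _; apply: sumr_ge0.
have s2 : 0 <= \sum_j \sum_i `|Qi i j| by apply: sumr_ge0 => j _; apply: sumr_ge0.
have q1 : 1 <= q by rewrite /q -addrA lerDl addr_ge0.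
have q0 : 0 < q by apply: lt_le_trans q1.
have Qq : \sum_j \sum_i `|Q i j| <= q by rewrite /q addrAC lerDr addr_ge0.
have Qiq : \sum_j \sum_i `|Qi i j| <= q by rewrite /q lerDr addr_ge0.
have Qcol j : \sum_i `|Q i j| <= q.
  by apply: le_trans Qq; rewrite [leRHS](bigD1 j) //= lerDl sumr_ge0 // => l _; apply: sumr_ge0.
exists (eps / q ^+ 2), sg, (q * (n%:R * (K * q))); split => //.
- by rewrite divr_gt0 // exprn_gt0.
- by rewrite !mulr_ge0 // ltW.
move=> T delta x X B T0 delta0 cx hist hX hB ode i0.
pose y j t := \sum_i x i t * Q i j; pose Y j t := \sum_i X i t * Q i j.
have cy j : continuous (y j).
  by apply: continuous_fin_sum => i t; apply: cvgM; [exact: cx|exact: cvg_cst].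
have hY j (t : R) : is_derive t 1 (Y j) (y j t).
  apply: is_derive_fin_sum => i.
  apply: (is_derive_eq (is_deriveM (hX i t) (is_derive_cst (Q i j) t (1 : R)))).
  by rewrite /GRing.scale /= mulr0 add0r mulrC.
have cl1y : continuous (l1 y).
  apply: continuous_fin_sum => j t.
  exact: (continuous_comp (cy j t) (@norm_continuous _ _ _)).
have [By hBy] := antiderivative cl1y.
have xy i t : x i t = \sum_j y j t * Qi j i.
  have := mulmxV uQ => /matrixP QQ.
  under eq_bigr => j _ do rewrite mulr_suml.
  rewrite exchange_big /=.
  under eq_bigr => l _.
    under eq_bigr => j _ do rewrite -mulrA.
    rewrite -mulr_sumr; have := QQ l i; rewrite mxE => ->; rewrite mxE; over.
  rewrite /= (bigD1 i) //= eqxx mulr1 big1 ?addr0 // => l /negbTE ->.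
  by rewrite mulr0.
have l1x t : l1 x t <= q * l1 y t.
  rewrite /l1; under eq_bigr => i _ do rewrite xy.
  apply: (le_trans (l1_linear_le _ _)); rewrite ler_wpM2r // ?sumr_ge0 //.
have l1y t : l1 y t <= q * l1 x t.
  by apply: (le_trans (l1_linear_le _ _)); rewrite ler_wpM2r // ?sumr_ge0.
have BB t : B t - B (t - tau2) <= q * (By t - By (t - tau2)).
  have hqB (s : R) : is_derive s 1 (fun s => q * By s) (q * l1 y s) by exact: (is_deriveZ q (hBy s)).
  have := @le_increment _ B (fun s => q * By s) (l1 x) (fun s => q * l1 y s) (t - tau2) t.
  rewrite -mulrBr; apply => //.
  - by rewrite gerBl ltW.
  - exact: is_derive_continuous hB.
  - exact: is_derive_continuous hqB.
have ydec j : `|y j T| <= K * (q * delta) * expR (- (sg * T)).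
  apply: (dec T (q * delta) y Y By) => //; first by rewrite mulr_ge0 // ltW.
    move=> j' t ht; apply: (le_trans (ler_norm_sum _ _ _)).
    apply: (@le_trans _ _ ((\sum_i `|Q i j'|) * delta)); last by rewrite ler_wpM2r.
    rewrite mulr_suml; apply: ler_sum => i _; rewrite normrM mulrC ler_wpM2l //.
    exact: hist.
  move=> j' t ht; have [d hd] := choice (fun i => let: ex_intro2 d h1 h2 := ode i t ht in
     ex_intro (fun d => is_derive t 1 (x i) d /\ _ <= _) d (conj h1 h2)).
  exists (\sum_i d i * Q i j').
    apply: is_derive_fin_sum => i.
    apply: (is_derive_eq (is_deriveM (hd i).1 (is_derive_cst (Q i j') t (1 : R)))).
    by rewrite /GRing.scale /= mulr0 add0r mulrC.
  have lamE : lam 0 j' * y j' t = \sum_i (\sum_l x l t * C l i) * Q i j'.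
    under eq_bigr => i _ do rewrite mulr_suml.
    rewrite exchange_big /= mulr_sumr; apply: eq_bigr => l _.
    under eq_bigr => i _ do rewrite -mulrA.
    rewrite -mulr_sumr; have /matrixP/(_ l j') := CQ; rewrite mxE => ->.
    by rewrite mul_mx_diag mxE mulrC mulrA.
  rewrite mulrDl lamE.
  have -> : \sum_i d i * Q i j' - (gamma * (y j' t - y j' (t - tau1))
       - (a * y j' t + \sum_i (\sum_l x l t * C l i) * Q i j') - k * (Y j' t - Y j' (t - tau2)))
    = \sum_i (d i - (gamma * (x i t - x i (t - tau1)) - a * x i t - (\sum_l x l t * C l i)
              - k * (X i t - X i (t - tau2)))) * Q i j'.
    rewrite /y /Y -!sumrB !mulr_sumr -big_split /= -!sumrB.
    by apply: eq_bigr => i _; ring.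
  apply: (le_trans (ler_norm_sum _ _ _)).
  set S := l1 x t + l1 x (t - tau1) + (B t - B (t - tau2)).
  set S' := l1 y t + l1 y (t - tau1) + (By t - By (t - tau2)).
  have SS : S <= q * S' by rewrite /S /S' [q * (_ + _)]mulrDr [q * (l1 y t + _)]mulrDr; do 2![apply: lerD => //].
  apply: (@le_trans _ _ ((eps / q ^+ 2 * S) * \sum_i `|Q i j'|)).
    rewrite mulr_sumr; apply: ler_sum => i _; rewrite normrM ler_wpM2r //.
    by case: (hd i).
  have Sp : 0 <= eps / q ^+ 2 * S by exact: le_trans (normr_ge0 _) (hd i0).2.
  apply: (@le_trans _ _ (eps / q ^+ 2 * S * q)); first by rewrite ler_wpM2l.
  have -> : eps * S' = eps / q ^+ 2 * (q * S') * q by field; rewrite gt_eqF.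
  by rewrite ler_pM2r // ler_pM2l // divr_gt0 // exprn_gt0.
apply: (@le_trans _ _ (l1 x T)); first by rewrite /l1 (bigD1 i0) //= lerDl sumr_ge0.
apply: (le_trans (l1x T)); rewrite -!mulrA ler_pM2l //.
apply: (@le_trans _ _ (\sum_(j < n) K * (q * delta) * expR (- (sg * T)))); first exact: ler_sum.
by rewrite sumr_const card_ord -[leLHS]mulr_natl -!mulrA.
Qed.

End MatrixDecay.

(** * A priori decay for the nonlinear equation *)

Section NonlinearDecay.
Variable R : realType.

(** At the infimum of the exit times the strict bound still holds by [step], and by continuity it
    holds nearby, where there should be exit times. *)
Lemma first_exit (n : nat) (x : 'I_n -> R -> R) (rho T : R) :
  (forall i, continuous (x i)) ->
  (forall t, 0 <= t <= T -> (forall s i, 0 <= s < t -> `|x i s| < rho) ->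
     forall i, `|x i t| < rho) ->
  forall t i, 0 <= t <= T -> `|x i t| < rho.
Proof.
move=> cx step t i /andP[t0 tT]; rewrite ltNge; apply/negP => xt.
pose S : set R := [set s | 0 <= s <= t /\ exists i, rho <= `|x i s| ].
have St : S t by split; [rewrite t0 lexx|exists i].
have lS : lbound S 0 by move=> s [/andP[]].
have hS : has_inf S by split; [exists t|exists 0].
pose t1 := inf S.
have t10 : 0 <= t1 by apply: lb_le_inf => //; exists t.
have t1t : t1 <= t by apply: ge_inf => //; exists 0.
have t1T : 0 <= t1 <= T by rewrite t10 (le_trans t1t).
have before s j : 0 <= s < t1 -> `|x j s| < rho.
  move=> /andP[s0 s1]; rewrite ltNge; apply/negP => xs.
  have : t1 <= s.
    apply: ge_inf; first by exists 0.
    by split; [rewrite s0 (le_trans (ltW s1))|exists j].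
  by rewrite leNgt s1.
have at1 := step t1 t1T before.
have near1 j : \forall s \near t1, `|x j s| < rho.
  have cn : (fun s => `|x j s|) @ t1 --> `|x j t1|.
    exact: (continuous_comp (cx j t1) (@norm_continuous _ _ _)).
  have /cvgrPdist_lt /(_ (rho - `|x j t1|)) := cn; rewrite subr_gt0 => /(_ (at1 j)).
  apply: filterS => s; rewrite ltr_distlC => /andP[_]; by rewrite addrC subrK.
have /nbhs_ballP [eta /= eta0 heta] : nbhs t1 [set s | forall j, `|x j s| < rho].
  exact: (@filter_forall _ _ (fun j => [set s | `|x j s| < rho]) (nbhs t1) _ near1).
have [s Ss s1] := inf_adherent eta0 hS.
have ts : t1 <= s by apply: ge_inf => //; exists 0.
have [_ [j]] := Ss; rewrite leNgt => /negP; apply.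
apply: heta; rewrite /ball /= ltr_distlC; apply/andP; split => //.
by rewrite (lt_le_trans _ ts) // gtrBl.
Qed.

(** As long as the solution stays below [rho], the remainders are within the tolerance of the linear
    estimate, whose conclusion [K delta < rho] then prevents an exit. The equation is therefore
    required only while the solution is small, as clipped solutions demand. *)
Lemma nonlinear_decay (n : nat) (C Q : 'M[R]_n) (lam : 'rV[R]_n)
   (a alpha b gamma tau1 tau2 tau : R) (f g : R -> R) (h : 'rV[R]_n -> 'rV[R]_n) :
  Q \in unitmx -> C *m Q = Q *m diag_mx lam ->
  0 < tau1 -> 0 < tau2 -> tau1 <= tau -> tau2 <= tau ->
  (forall j, exists c : R, 0 < c /\ exists M0 : nat, forall M, (M0 <= M)%N ->
     gain (dpoly M (Num.truncn (tau1 * M%:R)) (Num.truncn (tau2 * M%:R)) (a + lam 0 j) gamma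
       (alpha * b)) c^-1) ->
  (forall e : R, 0 < e -> exists r : R, 0 < r /\ [/\
     forall u, `|u| <= r -> `|f u - b * u| <= e * `|u|,
     forall u, `|u| <= r -> `|g u - gamma * u| <= e * `|u| &
     forall u : 'rV[R]_n, (forall i, `|u 0 i| <= r) ->
       forall i, `|h u 0 i - (u *m C) 0 i| <= e * \sum_l `|u 0 l| ]) ->
  exists r0 : R, 0 < r0 /\ forall rho, 0 < rho <= r0 ->
  exists sg K : R, [/\ 0 < sg, 1 <= K &
    forall (T delta : R) (x X : 'I_n -> R -> R),
    0 <= delta -> K * delta < rho ->
    (forall i, continuous (x i)) ->
    (forall i t, - tau <= t <= 0 -> `|x i t| <= delta) ->
    (forall i (t : R), is_derive t 1 (X i) (x i t)) ->
    (forall t, 0 < t < T -> (forall s i, - tau <= s <= t -> `|x i s| <= rho) ->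
       forall i, is_derive t 1 (x i) (g (x i t) - g (x i (t - tau1)) - a * x i t
         - alpha * f (X i t - X i (t - tau2)) - h (\row_l x l t) 0 i)) ->
    forall t i, 0 <= t <= T -> `|x i t| <= K * delta * expR (- (sg * t)) /\ `|x i t| < rho].
Proof.
move=> uQ CQ t10 t20 t1t t2t gains rem.
have [eps [sg [K [eps0 sg0 K0 dec]]]] := matrix_decay uQ CQ t10 t20 t1t t2t gains.
(* The present value enters the remainders of [g] and of [h], whence 2; the distributed delay enters
   with weight [alpha]. *)
pose e := eps / (2 + `|alpha|).
have al0 : 0 < 2 + `|alpha| by rewrite ltr_pwDl.
have e0 : 0 < e by rewrite divr_gt0.
have [r [r0 [hf hg hh]]] := rem e e0.
have t21 : 0 < 1 + tau2 by rewrite addr_gt0.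
have tau0 : 0 < tau by apply: lt_le_trans t1t.
(* The argument of [f] is an integral over a window of length [tau2]; it stays below [r] because
   [tau2 * rho <= r]. *)
exists (r / (1 + tau2)); split; first by rewrite divr_gt0.
(* The added 1 makes the estimate hold at time 0 too, where only the history bound is available. *)
move=> rho /andP[rho0 rhor]; exists sg, (1 + K); split => //; first by rewrite lerDl.
move=> T delta x X delta0 Kd cx hist hX ode.
have rr : rho <= r by apply: (le_trans rhor); rewrite ler_pdivrMr // ler_peMr ?(ltW r0) // lerDl ltW.
have t2r : tau2 * rho <= r.
  apply: (@le_trans _ _ ((1 + tau2) * rho)); first by rewrite ler_pM2r // lerDr.
  by rewrite mulrC -ler_pdivlMr.
have deltaKd : delta <= (1 + K) * delta by rewrite ler_peMl // lerDl.
have deltarho : delta < rho by apply: le_lt_trans Kd.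
have cl1 : continuous (l1 x).
  apply: continuous_fin_sum => i t.
  exact: (continuous_comp (cx i t) (@norm_continuous _ _ _)).
have [B hB] := antiderivative cl1.
have stepA t : 0 <= t <= T -> (forall s i, 0 <= s < t -> `|x i s| < rho) ->
    forall i, `|x i t| <= (1 + K) * delta * expR (- (sg * t)).
  move=> /andP[]; rewrite le_eqVlt => /orP[/eqP <- _ _ i|tp tT small i].
    rewrite mulr0 oppr0 expR0 mulr1; apply: le_trans deltaKd.
    by apply: hist; rewrite lexx andbT oppr_le0 ltW.
  apply: (@le_trans _ _ (K * delta * expR (- (sg * t)))); last first.
    by rewrite ler_pM2r ?expR_gt0 // ler_wpM2r // lerDr.
  apply: (dec t delta x X B) => // {}i s /andP[s0 st].
  have small' u j : - tau <= u <= s -> `|x j u| <= rho.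
    move=> /andP[u0 us]; have [u1|u1] := leP u 0.
      by apply: (le_trans (hist j u _)); rewrite ?u0 // ltW.
    by apply/ltW/small; rewrite ltW //= (le_lt_trans us).
  have d := ode s _ small' i; eexists; first by apply: d; rewrite s0 (lt_le_trans st).
  set I := X i s - X i (s - tau2).
  have xs j : `|x j s| <= r by apply: le_trans rr; apply: small'; rewrite lexx andbT; lra.
  have xs1 j : `|x j (s - tau1)| <= r.
    by apply: le_trans rr; apply: small'; apply/andP; split; lra.
  have t2s : s - tau2 <= s by rewrite gerBl ltW.
  have IB : `|I| <= B s - B (s - tau2).
    have xl1 u : `|x i u| <= l1 x u by rewrite /l1 (bigD1 i) //= lerDl sumr_ge0.
    have h1 := le_increment t2s (is_derive_continuous (hX i)) (is_derive_continuous hB)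
      (fun u _ => hX i u) (fun u _ => hB u) (fun u _ => le_trans (ler_norm _) (xl1 u)).
    have hN (u : R) : is_derive u 1 (fun u => - X i u) (- x i u) by exact: (is_deriveN (hX i u)).
    have xN u : - x i u <= l1 x u by apply: le_trans (xl1 u); rewrite -normrN ler_norm.
    have h2 := le_increment t2s (is_derive_continuous hN) (is_derive_continuous hB)
      (fun u _ => hN u) (fun u _ => hB u) (fun u _ => xN u).
    by rewrite /I ler_norml; apply/andP; split; move: h1 h2; lra.
  have Ir : `|I| <= r.
    have t2s' : s - tau2 < s by rewrite gtrBl.
    have [u /andP[u1 u2]] := mean_value t2s' (is_derive_continuous (hX i)) (fun u _ => hX i u).
    rewrite -/I => ->; rewrite opprB addrC subrK normrM (gtr0_norm t20) mulrC.
    apply: le_trans t2r; rewrite ler_pM2l //; apply: small'; apply/andP; split; lra.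
  have -> : \sum_l x l s * C l i = ((\row_l x l s) *m C) 0 i.
    by rewrite mxE; apply: eq_bigr => l _; rewrite mxE.
  have H1 := hg _ (xs i); have H2 := hg _ (xs1 i); have H3 := hf _ Ir.
  have H4 : `|h (\row_l x l s) 0 i - ((\row_l x l s) *m C) 0 i| <= e * l1 x s.
    have -> : l1 x s = \sum_l `|(\row_l x l s) 0 l| by apply: eq_bigr => l _; rewrite mxE.
    by apply: hh => j; rewrite mxE.
  have xl1 u : `|x i u| <= l1 x u by rewrite /l1 (bigD1 i) //= lerDl sumr_ge0.
  have S1 := xl1 s; have S2 := xl1 (s - tau1).
  have L1 : 0 <= l1 x s := le_trans (normr_ge0 _) S1.
  have L2 : 0 <= l1 x (s - tau1) := le_trans (normr_ge0 _) S2.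
  have L3 : 0 <= B s - B (s - tau2) := le_trans (normr_ge0 _) IB.
  have epsE : eps = (2 + `|alpha|) * e by rewrite /e mulrC divfK // gt_eqF.
  have H3' : `|alpha * (f I - b * I)| <= `|alpha| * (e * (B s - B (s - tau2))).
    by rewrite normrM ler_wpM2l // (le_trans H3) // ler_pM2l.
  have {}H1 : `|g (x i s) - gamma * x i s| <= e * l1 x s by apply: (le_trans H1); rewrite ler_pM2l.
  have {}H2 : `|g (x i (s - tau1)) - gamma * x i (s - tau1)| <= e * l1 x (s - tau1).
    by apply: (le_trans H2); rewrite ler_pM2l.
  have e1 := mulr_ge0 (mulr_ge0 (normr_ge0 alpha) (ltW e0)) L1.
  have e2 := mulr_ge0 (mulr_ge0 (normr_ge0 alpha) (ltW e0)) L2.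
  have e3 := mulr_ge0 (ltW e0) L2; have e4 := mulr_ge0 (ltW e0) L3.
  rewrite epsE; move: H1 H2 H3' H4 e1 e2 e3 e4; clear.
  set BB := B s - _; set A1 := l1 x s; set A2 := l1 x _; set hs := h _ 0 i; set C1 := (_ *m C) 0 i.
  set x1 := x i s; set x2 := x i _; rewrite !ler_norml.
  move=> /andP[? ?] /andP[? ?] /andP[? ?] /andP[? ?] *.
  by apply/andP; split; lra.
have fin := @first_exit n x rho T cx.
move=> t i tT.
have allr : forall t i, 0 <= t <= T -> `|x i t| < rho.
  apply: fin => u uT hu j; apply: le_lt_trans Kd; apply: (le_trans (stepA u uT hu j)).
  rewrite ler_piMr ?mulr_ge0 ?addr_ge0 //.
  by rewrite expR_le1 oppr_le0 mulr_ge0 ?(ltW sg0) //; case/andP: uT.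
split; last exact: allr.
apply: stepA => // s j /andP[s0 st]; apply: allr; rewrite s0 /=.
by apply/ltW/(lt_le_trans st); case/andP: tT.
Qed.

End NonlinearDecay.

(** * Existence for delay equations with bounded continuous right-hand side *)

Section Peano.
Variable R : realType.

Lemma is_derive_of_bound (F : R -> R) (t d : R) :
  (forall eta : R, 0 < eta -> exists r : R, 0 < r /\ forall s, `|s - t| < r ->
     `|F s - F t - (s - t) * d| <= eta * `|s - t|) ->
  is_derive t 1 F d.
Proof.
move=> h.
have lim : (fun u : R => u^-1 *: (F (u *: 1 + t) - F t)) @ 0^' --> d.
  apply/cvgrPdist_le => eta eta0; have [r [r0 hr]] := h eta eta0.
  near=> u; have u0 : u != 0 by near: u; exact: nbhs_dnbhs_neq.
  rewrite /GRing.scale /= mulr1.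
  have ur : `|u| < r by near: u; apply: dnbhs0_lt.
  have := hr (u + t); rewrite addrK => /(_ ur) hb.
  have -> : d - u^-1 * (F (u + t) - F t) = - (u^-1 * (F (u + t) - F t - u * d)).
    by rewrite [in RHS]mulrBr mulKf // opprB.
  by rewrite normrN normrM normfV ler_pdivrMl ?normr_gt0 // [`|u| * _]mulrC.
split; first by apply/cvg_ex; exists d.
exact: cvg_lim.
Unshelve. all: by end_near.
Qed.

Variables (I : finType) (G : (I -> R) -> (I -> R) -> (I -> R) -> I -> R).
Variables (b tau1 tau2 : R) (phi : I -> R -> R).
Hypotheses (G_bound : forall p q r i, `|G p q r i| <= b)
  (phi_cont : forall i, continuous (phi i)) (tau1_ge0 : 0 <= tau1) (tau2_ge0 : 0 <= tau2).

Section Euler.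
Variable h : R.
Hypothesis h_gt0 : 0 < h.

(** Stage [m] is the polygon up to time [m h], prolonged along its last piece. Each stage is defined
    on the whole line, so delayed arguments need no case distinction. *)
Fixpoint euler_stage (m : nat) : I -> R -> R :=
  if m is m'.+1 then
    let z := euler_stage m' in let s := m'%:R * h in
    fun i t => if t <= s then z i t else
      z i s + (t - s) * G (z ^~ s) (z ^~ (s - tau1)) (z ^~ (s - tau2)) i
  else fun i t => phi i (Num.min t 0).

Definition euler (i : I) (t : R) : R := euler_stage (Num.truncn (t / h)).+1 i t.

Definition slope (m : nat) (i : I) : R :=
  G (euler ^~ (m%:R * h)) (euler ^~ (m%:R * h - tau1)) (euler ^~ (m%:R * h - tau2)) i.

Lemma euler_stage_eq (m m' : nat) i t : (m <= m')%N -> t <= m%:R * h ->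
  euler_stage m' i t = euler_stage m i t.
Proof.
elim: m' => [|m' IH] mm' tm; first by move: mm' tm; rewrite leqn0 => /eqP->.
move: mm'; rewrite leq_eqVlt => /orP[/eqP->//|mm'].
rewrite /= ifT ?IH //; apply: (le_trans tm).
by rewrite ler_pM2r // ler_nat.
Qed.

Lemma eulerE (m : nat) i t : t <= m%:R * h -> euler i t = euler_stage m i t.
Proof.
move=> tm; rewrite /euler.
have tt : t <= (Num.truncn (t / h)).+1%:R * h.
  rewrite -ler_pdivrMr //; have [t0|t0] := leP 0 (t / h).
    by have /andP[_ /ltW] := truncn_itv t0.
  by apply: le_trans (ltW t0) _.
have [mt|tm'] := leqP m (Num.truncn (t / h)).+1; first exact: euler_stage_eq.
by rewrite -(euler_stage_eq i (ltnW tm') tt).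
Qed.

Lemma euler_hist i t : t <= 0 -> euler i t = phi i t.
Proof.
by move=> t0; rewrite (@eulerE 0) /= ?mul0r // min_l.
Qed.

Lemma euler_step (m : nat) i t : m%:R * h <= t <= m.+1%:R * h ->
  euler i t = euler i (m%:R * h) + (t - m%:R * h) * slope m i.
Proof.
move=> /andP[t0 t1]; rewrite (eulerE _ t1) /=.
have e (s : R) j : s <= m%:R * h -> euler j s = euler_stage m j s by move=> ?; apply: eulerE.
case: leP => [ts|_].
  have -> : t = m%:R * h by apply/eqP; rewrite eq_le ts.
  by rewrite subrr mul0r addr0 e.
rewrite -e // /slope; congr (_ + _ * G _ _ _ i); apply/funext => j; rewrite e //.
  by rewrite gerBl.
by rewrite gerBl.
Qed.

(** An increment is a weighted sum of the slopes of the pieces it crosses. With [g0 = 0] this gives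
    the Lipschitz bound, and with slopes near [g0] the derivative of the limit. *)
Lemma euler_increment i (g0 eta p q : R) : 0 <= eta -> 0 <= p ->
  (forall m : nat, p < m.+1%:R * h -> m%:R * h < q -> `|slope m i - g0| <= eta) ->
  forall s t, p <= s -> s <= t -> t <= q -> `|euler i t - euler i s - (t - s) * g0| <= eta * (t - s).
Proof.
move=> eta0 p0 hs.
suff claim m s t : p <= s -> s <= t -> t <= q -> t <= m%:R * h ->
    `|euler i t - euler i s - (t - s) * g0| <= eta * (t - s).
  move=> s t ps st tq; apply: (claim (Num.bound (t / h))) => //.
  rewrite -ler_pdivrMr //; apply/ltW/archi_boundP; rewrite divr_ge0 ?(ltW h_gt0) //.
  by rewrite (le_trans p0) // (le_trans ps).
have triv u : `|euler i u - euler i u - (u - u) * g0| <= eta * (u - u).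
  by rewrite !subrr mul0r mulr0 subrr normr0.
elim: m s t => [|m IH] s t ps st tq tm.
  have ts : t = s by apply/eqP; rewrite eq_le st andbT; move: tm; rewrite mul0r => /le_trans; apply; apply: le_trans ps.
  by rewrite ts.
have [tm'|mt] := leP t (m%:R * h); first exact: IH.
have [ts|] := leP t s.
  have -> : t = s by apply/eqP; rewrite eq_le ts.
  exact: triv.
move=> st'; have et := euler_step i (ssrbool.introT andP (conj (ltW mt) tm)).
have hsm : `|slope m i - g0| <= eta.
  apply: hs; last by rewrite (lt_le_trans mt).
  by rewrite (le_lt_trans ps) // (lt_le_trans st').
have [sm|ms] := leP s (m%:R * h).
  have h1 := IH s (m%:R * h) ps sm (ltW (lt_le_trans mt tq)) (lexx _).
  rewrite et.
  have -> : euler i (m%:R * h) + (t - m%:R * h) * slope m i - euler i s - (t - s) * g0 =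
    (euler i (m%:R * h) - euler i s - (m%:R * h - s) * g0) + (t - m%:R * h) * (slope m i - g0).
    by ring.
  apply: (le_trans (ler_normD _ _)).
  have -> : eta * (t - s) = eta * (m%:R * h - s) + (t - m%:R * h) * eta by ring.
  apply: lerD => //; rewrite normrM ger0_norm ?subr_ge0 ?(ltW mt) //.
  by rewrite ler_wpM2l // subr_ge0 ltW.
have es := euler_step i (ssrbool.introT andP (conj (ltW ms) (le_trans st tm))).
rewrite et es.
have -> : euler i (m%:R * h) + (t - m%:R * h) * slope m i
   - (euler i (m%:R * h) + (s - m%:R * h) * slope m i) - (t - s) * g0 =
  (t - s) * (slope m i - g0) by ring.
by rewrite normrM ger0_norm ?subr_ge0 // mulrC ler_wpM2r // subr_ge0.
Qed.

(** This modulus of continuity does not depend on [h], so it passes to pointwise limits; no uniform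
    convergence is needed. *)
Lemma euler_modulus i (s t : R) : s <= t ->
  `|euler i t - euler i s| <= b * (t - s) + `|phi i (Num.min t 0) - phi i (Num.min s 0)|.
Proof.
have b0 : 0 <= b.
  exact: le_trans (normr_ge0 _) (G_bound (fun=> 0) (fun=> 0) (fun=> 0) i).
have lip s' t' : 0 <= s' -> s' <= t' -> `|euler i t' - euler i s'| <= b * (t' - s').
  move=> s0 st; have := @euler_increment i 0 b s' t' b0 s0 _ s' t' (lexx _) st (lexx _).
  by rewrite mulr0 subr0; apply => m _ _; rewrite subr0; exact: G_bound.
move=> st; have [s0|s0] := leP 0 s.
  by apply: (le_trans (lip _ _ s0 st)); rewrite lerDl.
have [t0|t0] := leP t 0.
  rewrite (euler_hist i t0) (euler_hist i (ltW s0)).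
  by rewrite lerDr mulr_ge0 // subr_ge0.
rewrite (euler_hist i (ltW s0)).
rewrite -(subrK (euler i 0) (euler i t)) -addrA (euler_hist i (lexx 0)).
apply: (le_trans (ler_normD _ _)); rewrite lerD2r -(euler_hist i (lexx 0)).
apply: (le_trans (lip 0 t (lexx _) (ltW t0))).
by rewrite ler_wpM2l // lerD2l lerN2 ltW.
Qed.

End Euler.

Hypothesis G_cont : forall p q r (eta : R), 0 < eta -> exists delta : R, 0 < delta /\
  forall p' q' r', (forall i, `|p' i - p i| < delta) -> (forall i, `|q' i - q i| < delta) ->
    (forall i, `|r' i - r i| < delta) -> forall i, `|G p' q' r' i - G p q r i| <= eta.

Theorem peano : exists z : I -> R -> R,
  [/\ forall i t, t <= 0 -> z i t = phi i t, forall i, continuous (z i) &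
    forall i (t : R), 0 < t -> is_derive t 1 (z i) (G (z ^~ t) (z ^~ (t - tau1)) (z ^~ (t - tau2)) i)].
Proof.
have [U [uU oU]] := exists_ultra.
pose hk (m : nat) : R := m.+1%:R^-1.
have hk0 m : 0 < hk m by rewrite invr_gt0.
pose Z m := euler (hk m).
have cpm i : continuous (fun t : R => phi i (Num.min t 0)).
  have cm : continuous (fun t : R => Num.min t 0).
    move=> t; have h1 : {for t, continuous (id \min (fun=> 0 : R))}.
      by apply: continuous_min; [exact: cvg_id|exact: cvg_cst].
    exact: h1.
  by move=> t; exact: (continuous_comp (cm t) (@phi_cont i _)).
have modulus m i (s t : R) : `|Z m i t - Z m i s| <=
    b * `|t - s| + `|phi i (Num.min t 0) - phi i (Num.min s 0)|.
  have [st|/ltW ts] := leP s t.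
    by rewrite [`|t - s|]ger0_norm ?subr_ge0 //; apply: euler_modulus.
  rewrite distrC [`|t - s|]distrC [`|phi i _ - _|]distrC [`|s - t|]ger0_norm ?subr_ge0 //.
  exact: euler_modulus.
have lim (v : I * R) : exists l : R, (fun m => Z m v.1 v.2) @ U --> l.
  case: v => i t /=; pose B := `|phi i 0| + (b * `|t - 0| + `|phi i (Num.min t 0) - phi i (Num.min 0 0)|).
  apply: (ultra_cvg (K := `[- B, B]%classic) uU (@segment_compact _ _ _)).
  apply: nearW => m; rewrite /= in_itv /= -ler_norml.
  rewrite -(subrK (Z m i 0) (Z m i t)) addrC; apply: (le_trans (ler_normD _ _)).
  by apply: lerD; [rewrite /Z euler_hist|exact: modulus].
have [l hl] := choice lim; pose z i t := l (i, t).
have zl i t : (fun m => Z m i t) @ U --> z i t by exact: (hl (i, t)).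
exists z.
have zhist i t : t <= 0 -> z i t = phi i t.
  move=> t0; apply: (cvg_unique _ (zl i t)) => //.
  have -> : (fun m => Z m i t) = fun=> phi i t by apply/funext => m; apply: euler_hist.
  exact: cvg_cst.
have zmod i (s t : R) : `|z i t - z i s| <= b * `|t - s| + `|phi i (Num.min t 0) - phi i (Num.min s 0)|.
  have c : (fun m => `|Z m i t - Z m i s|) @ U --> `|z i t - z i s|.
    by apply: cvg_norm; apply: cvgB.
  by apply: (cvgr_to_le c); apply: nearW => m.
have mod0 i (t : R) :
    (fun s => b * `|s - t| + `|phi i (Num.min s 0) - phi i (Num.min t 0)|) @ t --> (0 : R).
  have L0 : b * `|t - t| + `|phi i (Num.min t 0) - phi i (Num.min t 0)| = 0.
    by rewrite !subrr normr0 mulr0 addr0.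
  have c1 : (fun s : R => s - t) @ t --> t - t by apply: cvgB; [exact: cvg_id|exact: cvg_cst].
  have c2 : (fun s : R => phi i (Num.min s 0) - phi i (Num.min t 0)) @ t -->
      phi i (Num.min t 0) - phi i (Num.min t 0).
    by apply: cvgB; [exact: (cpm i t)|exact: cvg_cst].
  have c3 := cvg_norm c1; have c4 := cvg_norm c2.
  rewrite -[X in _ --> X]L0.
  by apply: (cvgD (cvgM (cvg_cst b) (c3 _)) (c4 _)).
split => //.
  move=> i t; have c := mod0 i t.
  apply/cvgrPdist_le => eta eta0; move/cvgrPdist_le: c => /(_ _ eta0).
  apply: filterS => s; rewrite sub0r normrN => hs; rewrite distrC (le_trans (zmod i t s)) //.
  exact: le_trans (ler_norm _) hs.
move=> i0 t0 t0p; set g0 := G _ _ _ _.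
apply: is_derive_of_bound => eta eta0.
have [del [del0 hdel]] := G_cont (z ^~ t0) (z ^~ (t0 - tau1)) (z ^~ (t0 - tau2)) eta0.
(* All Euler polygons of small step have slopes close to [g0] near [t0], and
   this passes to the pointwise limit. *)
have b0 : 0 <= b.
  exact: le_trans (normr_ge0 _) (G_bound (fun=> 0) (fun=> 0) (fun=> 0) i0).
have close (t1 : R) : \forall s \near t1, forall m i, `|Z m i s - Z m i t1| < del / 2.
  have c i := mod0 i t1.
  have d20 : 0 < del / 2 by rewrite divr_gt0.
  have : \forall s \near t1, forall i, b * `|s - t1| + `|phi i (Num.min s 0) - phi i (Num.min t1 0)| < del / 2.
    apply: (@filter_forall _ I (fun i s => b * `|s - t1|
       + `|phi i (Num.min s 0) - phi i (Num.min t1 0)| < del / 2) (nbhs t1)) => i.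
    have /cvgrPdist_lt /(_ _ d20) := c i; apply: filterS => s.
    by rewrite sub0r normrN => hs; apply: le_lt_trans (ler_norm _) hs.
  by apply: filterS => s hs m i; apply: le_lt_trans (modulus m i t1 s) (hs i).
have closeU (t1 : R) : \forall m \near U, forall i, `|Z m i t1 - z i t1| < del / 2.
  have d20 : 0 < del / 2 by rewrite divr_gt0.
  apply: (@filter_forall _ I (fun i m => `|Z m i t1 - z i t1| < del / 2) U) => i.
  have /cvgrPdist_lt /(_ _ d20) := zl i t1; apply: filterS => m.
  by rewrite distrC.
have /nbhs_ballP [r1 /= r10 hr1] := close t0.
have /nbhs_ballP [r2 /= r20 hr2] := close (t0 - tau1).
have /nbhs_ballP [r3 /= r30 hr3] := close (t0 - tau2).
(* A piece that meets []t0 - r, t0 + r[] may begin outside, but by less than its length [hk m <= r];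
   its left end is within [3 r] of [t0]. *)
pose r := Num.min t0 (Num.min r1 (Num.min r2 r3)) / 3.
have rp : 0 < Num.min t0 (Num.min r1 (Num.min r2 r3)) by rewrite !lt_min t0p r10 r20.
have r0 : 0 < r by rewrite divr_gt0.
have [rt [rr1 [rr2 rr3]]] : 3 * r <= t0 /\ 3 * r <= r1 /\ 3 * r <= r2 /\ 3 * r <= r3.
  by rewrite /r [3 * _]mulrC divfK // !ge_min !lexx !orbT.
have hkr : \forall m \near U, hk m <= r.
  apply: oU; have /cvgrPdist_lt /(_ _ r0) := @cvg_harmonic R; apply: filterS => m.
  by rewrite sub0r normrN => hm; apply: le_trans (ler_norm _) (ltW hm).
exists r; split => // s st0.
have key : \forall m \near U, forall s t : R, t0 - r <= s -> s <= t -> t <= t0 + r ->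
    `|Z m i0 t - Z m i0 s - (t - s) * g0| <= eta * (t - s).
  near=> m; move=> s' t' h1 h2 h3.
  apply: (@euler_increment _ (hk0 m) i0 g0 eta (t0 - r) (t0 + r)) => //; try exact: ltW.
    by lra.
  move=> k k1 k2; have hm : hk m <= r by near: m.
  have kd : `|t0 - k%:R * hk m| < 3 * r.
    move: k1 k2 hm r0; rewrite -natr1 mulrDl mul1r ltr_norml; move: (k%:R * hk m) (hk m) => x y.
    by move=> *; apply/andP; split; lra.
  have cl1 : forall i, `|Z m i t0 - z i t0| < del / 2 by near: m; exact: closeU.
  have cl2 : forall i, `|Z m i (t0 - tau1) - z i (t0 - tau1)| < del / 2 by near: m; exact: closeU.
  have cl3 : forall i, `|Z m i (t0 - tau2) - z i (t0 - tau2)| < del / 2 by near: m; exact: closeU.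
  have comb (x y w : R) : `|x - y| < del / 2 -> `|y - w| < del / 2 -> `|x - w| < del.
    by move=> xy yw; apply: le_lt_trans (ler_distD y _ _) _; rewrite [del]splitr ltrD.
  apply: hdel => i.
  - apply: comb (cl1 i); apply: hr1; exact: lt_le_trans kd rr1.
  - apply: comb (cl2 i); apply: hr2; rewrite /ball /=.
    have -> : t0 - tau1 - (k%:R * hk m - tau1) = t0 - k%:R * hk m by ring.
    exact: lt_le_trans kd rr2.
  - apply: comb (cl3 i); apply: hr3; rewrite /ball /=.
    have -> : t0 - tau2 - (k%:R * hk m - tau2) = t0 - k%:R * hk m by ring.
    exact: lt_le_trans kd rr3.
have key2 s' t' : t0 - r <= s' -> s' <= t' -> t' <= t0 + r ->
    `|z i0 t' - z i0 s' - (t' - s') * g0| <= eta * (t' - s').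
  move=> h1 h2 h3.
  have c : (fun m => `|Z m i0 t' - Z m i0 s' - (t' - s') * g0|) @ U --> `|z i0 t' - z i0 s' - (t' - s') * g0|.
    by apply: cvg_norm; apply: cvgB; [exact: cvgB|exact: cvg_cst].
  by apply: (cvgr_to_le c); apply: filterS key => m; apply.
move: st0; rewrite ltr_norml => /andP[s1 s2].
have [t0s|/ltW st] := leP t0 s.
  by rewrite [`|s - t0|]ger0_norm ?subr_ge0 //; apply: key2 => //; lra.
have -> : `|z i0 s - z i0 t0 - (s - t0) * g0| = `|z i0 t0 - z i0 s - (t0 - s) * g0|.
  by rewrite -normrN; congr (`|_|); ring.
rewrite [`|s - t0|]distrC [`|t0 - s|]ger0_norm ?subr_ge0 //.
by apply: key2 => //; lra.
Unshelve. all: by end_near.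
Qed.

End Peano.

(** * Scalar and vector remainders at 0 *)

Section Linearization.
Variable R : realType.

Lemma entry_norm_le (n : nat) (v : 'rV[R]_n) i : `|v 0 i| <= `|v|.
Proof.
rewrite [leRHS]/Num.Def.normr /= mx_normrE.
by apply: (@le_bigmax _ _ _ _ (fun ij => `|v ij.1 ij.2|) (0, i)).
Qed.

Lemma rV_norm_lt (n : nat) (v : 'rV[R]_n) (e : R) : 0 < e ->
  (forall i, `|v 0 i| < e) -> `|v| < e.
Proof.
move=> e0 h; rewrite /Num.Def.normr /= mx_normrE; apply/bigmax_ltP; split => // -[i j] _ /=.
by rewrite ord1.
Qed.

Lemma rV_norm_le_sum (n : nat) (v : 'rV[R]_n) : `|v| <= \sum_i `|v 0 i|.
Proof.
rewrite [leLHS]/Num.Def.normr /= mx_normrE; apply/bigmax_leP; split; first by apply: sumr_ge0.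
move=> -[i j] _ /=; rewrite ord1 (bigD1 j) //= lerDl; exact: sumr_ge0.
Qed.

(** The pair of the trivial permutation and the generator of ['Z_2] acts as -1. *)
Lemma equivariant_odd (n : nat) (Gamma0 : {group 'S_n}) (F : 'rV[R]_n -> 'rV[R]_n) v :
  equivariant Gamma0 F -> F (- v) = - F v.
Proof.
move=> h; have hp : (1%g, 1 : 'Z_2) \in Gam Gamma0.
  by rewrite /Gam /= finset.in_setX group1 inE.
have := h _ hp v; rewrite /= /Gam_mx /= perm_mx1 expr1 scaleN1r.
by rewrite !mulmxN !mulmx1.
Qed.

Variables (n : nat) (i0 : 'I_n).

Lemma scalar_odd (Gamma0 : {group 'S_n}) (f : R -> R) u :
  equivariant Gamma0 (map_mx f) -> f (- u) = - f u.
Proof.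
move=> h; have := equivariant_odd (const_mx u) h.
by move=> /matrixP /(_ 0 i0); rewrite !mxE.
Qed.

(** Scalar facts are read off the entry [i0] on constant vectors. *)
Lemma scalar_continuous (f : R -> R) :
  continuous (map_mx f : 'rV[R]_n -> 'rV[R]_n) -> continuous f.
Proof.
move=> cf u; apply/cvgrPdist_lt => e e0.
have /cvgrPdist_lt /(_ _ e0) /nbhs_ballP [d /= d0 hd] := cf (const_mx u).
apply/nbhs_ballP; exists d => // u'; rewrite /ball /= => uu.
have := hd (const_mx u'); rewrite mx_norm_ball /ball_ /= => H.
have : `|const_mx u - const_mx u' : 'rV[R]_n| < d.
  by apply: rV_norm_lt => // i; rewrite !mxE.
move=> /H => h; have := le_lt_trans (entry_norm_le _ i0) h.
by rewrite !mxE.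
Qed.

(** The derivative of [f] at 0 is the entry [i0] of the derivative of [map_mx f] along the constant
    vector 1. *)
Lemma scalar_remainder (f : R -> R) (e : R) : f 0 = 0 ->
  differentiable (map_mx f : 'rV[R]_n -> 'rV[R]_n) 0 -> 0 < e ->
  exists r : R, 0 < r /\ forall u, `|u| <= r -> `|f u - derive1 f 0 * u| <= e * `|u|.
Proof.
move=> f0 df e0.
have /derivable_mxP/(_ 0 i0) d1 : derivable (map_mx f : 'rV[R]_n -> 'rV[R]_n) 0 (const_mx 1).
  exact: diff_derivable.
have d2 : derivable f 0 1.
  have E : (fun t : R => t^-1 *: ((f \o shift 0) (t *: 1) - f 0)) =
      (fun t : R => t^-1 *: (((fun v : 'rV[R]_n => map_mx f v 0 i0) \o shift 0)
         (t *: const_mx 1) - map_mx f (0 : 'rV[R]_n) 0 i0)).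
    by apply/funext => t; rewrite /= !mxE.
  by rewrite /derivable E.
have c : (fun t : R => t^-1 *: (f (t *: 1 + 0) - f 0)) @ 0^' --> 'D_1 f 0 by exact: d2.
have /cvgrPdist_le /(_ _ e0) [d /= d0 hd] := c.
exists (d / 2); split; first by rewrite divr_gt0.
move=> u ud; have [->|u0] := eqVneq u 0; first by rewrite f0 mulr0 subrr normr0 mulr0.
have ud' : ball_ [eta Num.Def.normr] 0 d u.
  rewrite /ball_ /= sub0r normrN; apply: le_lt_trans ud _.
  by rewrite ltr_pdivrMr // ltr_pMr // ltr1n.
have h := hd u ud' u0.
rewrite /GRing.scale /= mulr1 addr0 f0 subr0 in h.
rewrite derive1E.
have -> : f u - 'D_1 f 0 * u = - (('D_1 f 0 - u^-1 * f u) * u).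
  by rewrite mulrBl mulrAC mulVf // mul1r opprB.
by rewrite normrN normrM ler_wpM2r.
Qed.

Lemma vector_remainder (h : 'rV[R]_n -> 'rV[R]_n) (e : R) : h 0 = 0 ->
  differentiable h 0 -> 0 < e ->
  exists r : R, 0 < r /\ forall v : 'rV[R]_n, (forall i, `|v 0 i| <= r) ->
    forall i, `|h v 0 i - (v *m jacobian h 0) 0 i| <= e * \sum_l `|v 0 l|.
Proof.
move=> h0 /diff_locallyP [_ /eqaddoP hd] e0.
have /nbhs_ballP [d /= d0 {}hd] := hd e e0.
exists (d / 2); split; first by rewrite divr_gt0.
move=> v vd i.
have vb : ball (0 : 'rV[R]_n) d v.
  rewrite mx_norm_ball /ball_ /= sub0r normrN; apply: rV_norm_lt => // j.
  by apply: le_lt_trans (vd j) _; rewrite ltr_pdivrMr // ltr_pMr // ltr1n.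
have := hd v vb; rewrite /= !fctE /= h0 addr0 add0r => H.
rewrite /jacobian mul_rV_lin1.
have -> : h v 0 i - 'd h 0 v 0 i = (h v - 'd h 0 v) 0 i by rewrite !mxE.
apply: (le_trans (entry_norm_le _ i)); apply: (le_trans H).
by rewrite ler_pM2l // rV_norm_le_sum.
Qed.

End Linearization.

(** * Diagonalization of the coupling and subcritical gains *)

Section Gains.
Variable R : realType.

(** The eigenspaces are the isotypic components, which sum to the whole space. *)
Lemma isotypic_diagonalizable (n r : nat) (Gamma0 : {group 'S_n}) (C : 'M[R]_n)
  (mu : 'I_r.+1 -> R) (V_ : 'I_r.+1 -> 'M[R]_n) :
  injective mu -> isotypic_decomposition Gamma0 V_ ->
  (forall j, (eigenspace C (mu j) :=: V_ j)%MS) ->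
  exists (Q : 'M[R]_n) (lam : 'rV[R]_n), Q \in unitmx /\ C *m Q = Q *m diag_mx lam.
Proof.
move=> mu_inj [_ _ sumV _] VE.
have [P uP /(diagonalizable_forP _ uP) dP] : mxpoly.diagonalizable C.
  apply/mxpoly.diagonalizablePeigen; exists [seq mu j | j <- enum 'I_r.+1].
    by rewrite map_inj_uniq ?enum_uniq.
  rewrite big_map big_enum /=; apply: eqmx_trans sumV.
  exact: eqmx_sums.
exists (invmx P), (\row_j (P *m C *m invmx P) j j); split; first by rewrite unitmx_inv.
have -> : diag_mx (\row_j (P *m C *m invmx P) j j) = P *m C *m invmx P.
  apply/matrixP => i j; rewrite mxE; have [->|ij] := eqVneq i j; first by rewrite mulr1n mxE.
  by rewrite mulr0n dP.
by rewrite !mulmxA mulVmx // mul1mx.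
Qed.

(** The rows of the inverse of [Q] are eigenvectors for the action on row vectors. *)
Lemma diagonal_eigenvalue (n : nat) (C Q : 'M[R]_n) (lam : 'rV[R]_n) j :
  Q \in unitmx -> C *m Q = Q *m diag_mx lam -> eigenvalue C (lam 0 j).
Proof.
move=> uQ CQ; apply/eigenvalueP; exists (row j (invmx Q)).
  have h : invmx Q *m C = diag_mx lam *m invmx Q.
    by rewrite -[LHS]mulmx1 -(mulmxV uQ) mulmxA -(mulmxA _ C) CQ mulmxA mulVmx // mul1mx.
  by rewrite -row_mul h row_mul row_diag_mx -scalemxAl -rowE.
apply/eqP => r0; have : row j (invmx Q) *m Q = 0 by rewrite r0 mul0mx.
rewrite -row_mul mulVmx // => /matrixP /(_ 0 j) /eqP.
by rewrite !mxE eqxx oner_eq0.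
Qed.

(** An imaginary root met for some [k <= alpha b] would make [k / b] a positive critical value below
    [alpha0]. *)
Lemma subcritical_gain (r : nat) (a tau1 tau2 b gamma alpha0 alpha : R)
  (mu : 'I_r.+1 -> R) (j : 'I_r.+1) :
  0 < tau1 -> 0 < tau2 -> 0 <= gamma -> gamma * tau1 <= 1 -> 0 < b -> 0 < a + mu j ->
  smallest_critical b gamma tau1 tau2 a mu alpha0 -> 0 < alpha -> alpha < alpha0 ->
  exists c : R, 0 < c /\ exists M0 : nat, forall M, (M0 <= M)%N ->
    gain (dpoly M (Num.truncn (tau1 * M%:R)) (Num.truncn (tau2 * M%:R)) (a + mu j) gamma
      (alpha * b)) c^-1.
Proof.
move=> t1 t2 g0 gt b0 aj0 [_ _ least] al0 al1.
apply: discrete_gain => //; first by rewrite mulr_ge0 // ltW.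
move=> k om Cc Sc /andP[k0 kb] om0 eC eS re im.
have := least (k / b); rewrite divr_gt0 // => /(_ isT) H.
have {}H : alpha0 <= k / b.
  by apply: H; exists j, om; split => //; apply: critical_eqs_of_root eC eS re im.
have : k / b <= alpha by rewrite ler_pdivrMr.
by move=> /(le_trans H); rewrite leNgt al1.
Qed.

End Gains.

(** * Clipping and solutions of the clipped system *)

Section Clip.
Variable R : realType.

Definition clamp (p q u : R) : R := Num.max p (Num.min q u).

Lemma clamp_id p q u : p <= u <= q -> clamp p q u = u.
Proof. by move=> /andP[h1 h2]; rewrite /clamp (min_idPr h2) (max_idPr h1). Qed.

Lemma clamp_itv p q u : p <= q -> p <= clamp p q u <= q.
Proof. by move=> pq; rewrite /clamp le_max lexx /= ge_max pq ge_min lexx. Qed.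

Lemma clamp_continuous p q : continuous (clamp p q).
Proof.
move=> t; have h1 : {for t, continuous ((fun=> q) \min id)}.
  by apply: continuous_min; [exact: cvg_cst|exact: cvg_id].
have h2 : {for t, continuous ((fun=> p) \max ((fun=> q) \min id))}.
  by apply: continuous_max => //; exact: cvg_cst.
exact: h2.
Qed.

Definition clip (rho : R) := clamp (- rho) rho.

Lemma clip_id rho u : `|u| <= rho -> clip rho u = u.
Proof. by rewrite ler_norml; exact: clamp_id. Qed.

Lemma clip_bound rho u : 0 <= rho -> `|clip rho u| <= rho.
Proof. by move=> r0; rewrite ler_norml clamp_itv // (le_trans _ r0) // oppr_le0. Qed.

Lemma clip_continuous rho : continuous (clip rho).
Proof. exact: clamp_continuous. Qed.

(** Extends an entry by constants beyond [[p, q]]; the estimates above are stated for functions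
    continuous on the whole line. *)
Lemma continuous_clamp_entry (n : nat) (D : set R) (x : R -> 'rV[R]_n) p q i :
  p <= q -> (forall t, p <= t <= q -> D t) -> {within D, continuous x} ->
  continuous (fun t => x (clamp p q t) 0 i).
Proof.
move=> pq pqD cx t.
have Dc s : D (clamp p q s) by apply: pqD; exact: clamp_itv.
have H := (subspace_continuousP _ _).1 cx _ (Dc t).
have {}H : (fun s => x (clamp p q s)) @ t --> x (clamp p q t).
  apply: (@cvg_comp _ _ _ (clamp p q) x _ _ _ _ H) => P /= hP.
  have : \forall s \near t, D (clamp p q s) -> P (clamp p q s).
    exact: clamp_continuous t _ hP.
  by rewrite near_simpl; apply: (@filterS _ (nbhs t)) => s; apply.
exact: (cvg_comp _ _ H (@coord_continuous _ _ _ 0 i (x (clamp p q t)))).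
Qed.

Lemma continuous_dist (F : R -> R) (u eta : R) : continuous F -> 0 < eta ->
  exists d : R, 0 < d /\ forall u', `|u' - u| < d -> `|F u' - F u| <= eta.
Proof.
move=> cF eta0; have /cvgrPdist_le /(_ _ eta0) /nbhs_ballP [d /= d0 hd] := cF u.
exists d; split => // u' uu; rewrite distrC; apply: hd.
by rewrite /ball /= distrC.
Qed.

(** An antiderivative [J] is adjoined as a second block of unknowns, so that the distributed delay
    becomes the point delay [J t - J (t - tau2)] and [peano] applies on ['I_n + 'I_n]. *)
Lemma clipped_solution (n : nat) (a alpha tau1 tau2 rho rho2 Bh : R) (f g : R -> R)
   (h : 'rV[R]_n -> 'rV[R]_n) (phi Phi : 'I_n -> R -> R) :
  0 <= tau1 -> 0 <= tau2 -> 0 <= rho -> 0 <= rho2 ->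
  continuous f -> continuous g -> continuous h ->
  (forall v : 'rV[R]_n, (forall i, `|v 0 i| <= rho) -> forall i, `|h v 0 i| <= Bh) ->
  (forall i, continuous (phi i)) -> (forall i, continuous (Phi i)) ->
  exists x J : 'I_n -> R -> R, [/\
    forall i t, t <= 0 -> x i t = phi i t,
    forall i t, t <= 0 -> J i t = Phi i t,
    forall i, continuous (x i), forall i, continuous (J i) &
    forall i (t : R), 0 < t ->
      is_derive t 1 (x i) (g (clip rho (x i t)) - g (clip rho (x i (t - tau1)))
        - a * clip rho (x i t) - alpha * f (clip rho2 (J i t - J i (t - tau2)))
        - h (\row_l clip rho (x l t)) 0 i) /\
      is_derive t 1 (J i) (clip rho (x i t))].
Proof.
move=> t10 t20 r0 r20 cf cg ch hB cphi cPhi.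
pose I := ('I_n + 'I_n)%type.
pose G (p q r : I -> R) (k : I) : R := match k with
  | inl i => g (clip rho (p (inl i))) - g (clip rho (q (inl i))) - a * clip rho (p (inl i))
      - alpha * f (clip rho2 (p (inr i) - r (inr i))) - h (\row_l clip rho (p (inl l))) 0 i
  | inr i => clip rho (p (inl i)) end.
pose ph (k : I) t := match k with inl i => phi i t | inr i => Phi i t end.
have [Bg [Bg0 hBg]] := bounded_itv (- rho) rho cg.
have [Bf [Bf0 hBf]] := bounded_itv (- rho2) rho2 cf.
have gb u : `|g (clip rho u)| <= Bg by apply: hBg; rewrite -ler_norml clip_bound.
have fb u : `|f (clip rho2 u)| <= Bf by apply: hBf; rewrite -ler_norml clip_bound.
pose b := Num.max rho (Bg + Bg + `|a| * rho + `|alpha| * Bf + Bh).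
have Gb p q r k : `|G p q r k| <= b.
  case: k => i /=; last by rewrite le_max clip_bound.
  rewrite le_max; apply/orP; right.
  apply: (le_trans (ler_normB _ _)); apply: lerD; last first.
    by apply: hB => l; rewrite mxE clip_bound.
  apply: (le_trans (ler_normB _ _)); apply: lerD; last by rewrite normrM ler_wpM2l.
  apply: (le_trans (ler_normB _ _)); apply: lerD; last by rewrite normrM ler_wpM2l // clip_bound.
  by apply: (le_trans (ler_normB _ _)); apply: lerD.
have cph k : continuous (ph k) by case: k => i; [exact: cphi|exact: cPhi].
have cgc : continuous (fun u => g (clip rho u)).
  by move=> u; exact: (continuous_comp (@clip_continuous rho u) (@cg _)).
have cfc : continuous (fun u => f (clip rho2 u)).
  by move=> u; exact: (continuous_comp (@clip_continuous rho2 u) (@cf _)).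
have Gc p q r (eta : R) : 0 < eta -> exists delta : R, 0 < delta /\
  forall p' q' r', (forall k, `|p' k - p k| < delta) -> (forall k, `|q' k - q k| < delta) ->
    (forall k, `|r' k - r k| < delta) -> forall k, `|G p' q' r' k - G p q r k| <= eta.
  move=> eta0.
  have hl i : exists d : R, 0 < d /\ forall p' q' r', (forall k, `|p' k - p k| < d) ->
      (forall k, `|q' k - q k| < d) -> (forall k, `|r' k - r k| < d) ->
      `|G p' q' r' (inl i) - G p q r (inl i)| <= eta /\
      `|G p' q' r' (inr i) - G p q r (inr i)| <= eta.
    have e5 : 0 < eta / 5 by rewrite divr_gt0.
    have ea : 0 < eta / 5 / (1 + `|a|) by rewrite divr_gt0 // ltr_pwDl.
    have eal : 0 < eta / 5 / (1 + `|alpha|) by rewrite divr_gt0 // ltr_pwDl.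
    have scale (c u : R) : `|u| <= eta / 5 / (1 + `|c|) -> `|c * u| <= eta / 5.
      move=> hu; have c1 : 0 < 1 + `|c| by rewrite ltr_pwDl.
      rewrite normrM; apply: (@le_trans _ _ ((1 + `|c|) * `|u|)).
        by rewrite ler_wpM2r // lerDr.
      by rewrite mulrC -ler_pdivlMr.
    have [d1 [d10 h1]] := continuous_dist (p (inl i)) cgc e5.
    have [d2 [d20 h2]] := continuous_dist (q (inl i)) cgc e5.
    have [d3 [d30 h3]] := continuous_dist (p (inl i)) (@clip_continuous rho) ea.
    have [d4 [d40 h4]] := continuous_dist (p (inr i) - r (inr i)) cfc eal.
    have /cvgrPdist_le /(_ _ e5) /nbhs_ballP [d5 /= d50 h5] := ch (\row_l clip rho (p (inl l))).
    have [d6 [d60 h6]] : exists d : R, 0 < d /\ forall d', 0 < d' <= d -> forall l u,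
        `|u - p (inl l)| < d' -> `|clip rho u - clip rho (p (inl l))| <= d5 / 2.
      apply: common_positive => l; have d52 : 0 < d5 / 2 by rewrite divr_gt0.
      have [d [d0 hd]] := continuous_dist (p (inl l)) (@clip_continuous rho) d52.
      exists d; split => // d' /andP[_ dd] u uu; apply: hd; exact: lt_le_trans dd.
    exists (Num.min d1 (Num.min d2 (Num.min d3 (Num.min (d4 / 2) d6)))); split.
      by rewrite !lt_min d10 d20 d30 d60 divr_gt0.
    move=> p' q' r' hp hq hr.
    have {}hp k : [/\ `|p' k - p k| < d1, `|p' k - p k| < d3, `|p' k - p k| < d4 / 2 & `|p' k - p k| < d6].
      by have := hp k; rewrite !lt_min => /and5P[-> _ -> -> ->].
    have {}hq k : `|q' k - q k| < d2 by have := hq k; rewrite !lt_min => /and5P[].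
    have {}hr k : `|r' k - r k| < d4 / 2 by have := hr k; rewrite !lt_min => /and5P[].
    have [hp1 hp3 hp4 hp6] := hp (inl i); have [_ _ hp4' _] := hp (inr i).
    have k1 := h1 _ hp1; have k2 := h2 _ (hq (inl i)); have k3 := h3 _ hp3.
    have k4 : `|f (clip rho2 (p' (inr i) - r' (inr i))) - f (clip rho2 (p (inr i) - r (inr i)))|
        <= eta / 5 / (1 + `|alpha|).
      apply: h4; rewrite (_ : _ - _ = (p' (inr i) - p (inr i)) - (r' (inr i) - r (inr i))); last by ring.
      by apply: le_lt_trans (ler_normB _ _) _; rewrite [d4]splitr ltrD.
    have k5 : `|h (\row_l clip rho (p' (inl l))) 0 i - h (\row_l clip rho (p (inl l))) 0 i| <= eta / 5.
      have b5 : ball (\row_l clip rho (p (inl l)) : 'rV[R]_n) d5 (\row_l clip rho (p' (inl l))).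
        rewrite mx_norm_ball /ball_ /=; apply: rV_norm_lt => // l; rewrite !mxE distrC.
        have [_ _ _ hpl] := hp (inl l).
        apply: (@le_lt_trans _ _ (d5 / 2)); last by rewrite ltr_pdivrMr // ltr_pMr // ltr1n.
        by apply: (h6 d6) => //; rewrite d60 lexx.
      have := h5 _ b5; rewrite distrC => H; apply: le_trans H.
      rewrite (_ : h _ 0 i - h _ 0 i = (h (\row_l clip rho (p' (inl l))) - h (\row_l clip rho (p (inl l)))) 0 i).
        exact: entry_norm_le.
      by rewrite !mxE.
    split; last first.
      apply: (le_trans k3); rewrite ler_pdivrMr ?ltr_pwDl // ler_pdivrMr //.
      rewrite -mulrA ler_peMr ?(ltW eta0) //; have := normr_ge0 a; lra.
    rewrite /G; have s3 := scale a _ k3; have s4 := scale alpha _ k4.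
    move: k1 k2 s3 s4 k5.
    set x1 := g _; set x2 := g _; set x3 := g _; set x4 := g _; set x5 := clip _ _; set x6 := clip _ _.
    set x7 := f _; set x8 := f _; set x9 := h _ 0 i; set x10 := h _ 0 i.
    by rewrite !ler_norml => /andP[? ?] /andP[? ?] /andP[? ?] /andP[? ?] /andP[? ?]; apply/andP; split; lra.
  have [d [d0 hd]] : exists d : R, 0 < d /\ forall d', 0 < d' <= d -> forall i p' q' r',
      (forall k, `|p' k - p k| < d') -> (forall k, `|q' k - q k| < d') ->
      (forall k, `|r' k - r k| < d') ->
      `|G p' q' r' (inl i) - G p q r (inl i)| <= eta /\
      `|G p' q' r' (inr i) - G p q r (inr i)| <= eta.
    apply: common_positive => i; have [d [d0 hd]] := hl i.
    exists d; split => // d' /andP[_ dd] p' q' r' hp hq hr.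
    by apply: hd => k; apply: lt_le_trans dd.
  exists d; split => // p' q' r' hp hq hr k.
  have dd : 0 < d <= d by rewrite d0 lexx.
  by case: k => i; have [? ?] := hd d dd i p' q' r' hp hq hr.
have [z [z1 z2 z3]] := peano Gb cph t10 t20 Gc.
exists (fun i => z (inl i)), (fun i => z (inr i)); split.
- by move=> i t; apply: z1.
- by move=> i t; apply: z1.
- by move=> i; apply: z2.
- by move=> i; apply: z2.
- by move=> i t t0; split; [exact: (z3 (inl i) t t0)|exact: (z3 (inr i) t t0)].
Qed.

End Clip.

(** * Passage between the neutral equation and its componentwise form *)

Section Components.
Variable R : realType.

Lemma is_derive_rowP (n : nat) (F : R -> 'rV[R]_n) (d : 'rV[R]_n) (t : R) :
  is_derive t 1 F d <-> forall i, is_derive t 1 (fun s => F s 0 i) (d 0 i).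
Proof.
split=> [[dF <-] i|h].
  apply: DeriveDef; first by move/derivable_mxP: dF; exact.
  by rewrite derive_mx // mxE.
have dF : derivable F t 1 by apply/derivable_mxP => i j; rewrite ord1; case: (h j).
apply: DeriveDef => //; rewrite derive_mx //; apply/rowP => j; rewrite mxE.
by case: (h j).
Qed.

Lemma is_derive_lag (F : R -> R) (t c d : R) :
  is_derive (t - c) 1 F d -> is_derive t 1 (fun s => F (s - c)) d.
Proof.
move=> hF.
have := @is_derive1_comp _ F (fun s => s - c) t _ _ hF
  (is_deriveB (is_derive_id t (1 : R)) (is_derive_cst c t (1 : R))).
by rewrite subr0 mulr1.
Qed.

Lemma vint_entry (n : nat) (tau t : R) (F : R -> 'rV[R]_n) (y Y : R -> R) i :
  0 < tau -> continuous y -> (forall t : R, is_derive t 1 Y (y t)) ->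
  (forall s, 0 <= s <= tau -> F s 0 i = y (t - s)) ->
  vint tau F 0 i = Y t - Y (t - tau).
Proof.
move=> tau0 cy hY hF; rewrite mxE -(int_delay t tau0 cy hY).
apply: eq_Rintegral => s; rewrite inE /= in_itv /= => hs; exact: hF.
Qed.

Lemma nf_lhs_entry (n : nat) (S : nfde R n) (x : R -> 'rV[R]_n) (y G : R -> R) (t : R) i :
  0 < nf_tau1 S -> continuous y -> continuous (nf_g S) ->
  (forall t : R, is_derive t 1 G (nf_g S (y t))) ->
  (forall s, t - nf_tau1 S <= s <= t -> x s 0 i = y s) ->
  nf_lhs S x t 0 i = y t - (G t - G (t - nf_tau1 S)).
Proof.
move=> t10 cy cg hG xy; rewrite /nf_lhs !mxE; congr (_ - _).
  by apply: xy; rewrite lexx andbT lerBlDr lerDl ltW.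
rewrite -(@vint_entry n _ _ (fun s => map_mx (nf_g S) (x (t - s))) (nf_g S \o y) _ i) //.
- by rewrite mxE.
- by move=> u; apply: continuous_comp; [exact: cy|exact: cg].
- move=> s /andP[s0 s1]; rewrite mxE xy //.
  by rewrite lerB // gerBl.
Qed.

Lemma nf_rhs_entry (n : nat) (S : nfde R n) (x : R -> 'rV[R]_n) (y Y : R -> R) (t : R) i :
  0 < nf_tau2 S -> continuous y -> (forall t : R, is_derive t 1 Y (y t)) ->
  (forall s, t - nf_tau2 S <= s <= t -> x s 0 i = y s) ->
  nf_rhs S x t 0 i = - (nf_a S * y t) - nf_alpha S * nf_f S (Y t - Y (t - nf_tau2 S))
    - nf_h S (x t) 0 i.
Proof.
move=> t20 cy hY xy.
have e1 : x t 0 i = y t by apply: xy; rewrite lexx andbT lerBlDr lerDl ltW.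
have : vint (nf_tau2 S) (fun s => x (t - s)) 0 i = Y t - Y (t - nf_tau2 S).
  apply: (@vint_entry n _ _ _ y) => // s /andP[s0 s1].
  by rewrite xy // lerB // gerBl.
by rewrite /nf_rhs; move: (vint _ _) => I e2; rewrite !mxE e1 e2.
Qed.

(** Stopping at some [t1] below [T] makes solutions on bounded intervals accessible to estimates for
    functions on the whole line. *)
Lemma solution_ode (n : nat) (S : nfde R n) (T : \bar R) (x : R -> 'rV[R]_n) (t1 : R) :
  0 < nf_tau1 S -> 0 < nf_tau2 S -> continuous (nf_g S) ->
  is_solution S T x -> 0 <= t1 -> (t1%:E < T)%E ->
  exists y Y : 'I_n -> R -> R, [/\
    forall i, continuous (y i),
    forall i t, - delay S <= t <= t1 -> y i t = x t 0 i,
    forall i (t : R), is_derive t 1 (Y i) (y i t) &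
    forall i (t : R), 0 < t < t1 -> is_derive t 1 (y i)
      (nf_g S (y i t) - nf_g S (y i (t - nf_tau1 S)) - nf_a S * y i t
       - nf_alpha S * nf_f S (Y i t - Y i (t - nf_tau2 S)) - nf_h S (\row_l y l t) 0 i)].
Proof.
move=> t10 t20 cg [cx dx] t1_0 t1T.
set tau := delay S.
have tau1 : nf_tau1 S <= tau by rewrite /tau /delay le_max lexx.
have tau2 : nf_tau2 S <= tau by rewrite /tau /delay le_max lexx orbT.
have tau0 : 0 < tau by apply: lt_le_trans tau1.
have taut : - tau <= t1 by apply: le_trans t1_0; rewrite oppr_le0 ltW.
pose y i t := x (clamp (- tau) t1 t) 0 i.
have cy i : continuous (y i).
  apply: continuous_clamp_entry taut _ cx => t /andP[h1 h2]; split => //.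
  by apply: le_lt_trans t1T; rewrite lee_fin.
have yE i t : - tau <= t <= t1 -> y i t = x t 0 i by move=> ht; rewrite /y clamp_id.
have [Y hY] : exists Y : 'I_n -> R -> R, forall i (t : R), is_derive t 1 (Y i) (y i t).
  have [Y hY] := choice (fun i => antiderivative (cy i)); by exists Y.
exists y, Y; split => // i t /andP[t0 tt1].
have [G hG] := antiderivative (fun u => continuous_comp (cy i u) (cg _)).
have tT : (t%:E < T)%E by apply: lt_trans t1T; rewrite lte_fin.
have /is_derive_rowP /(_ i) d1 := dx t t0 tT.
have near : \forall s \near t, nf_lhs S x s 0 i = y i s - (G s - G (s - nf_tau1 S)).
  near=> s.
  apply: nf_lhs_entry => // u /andP[u1 u2]; rewrite yE //; apply/andP; split; last first.
    apply: (le_trans u2); apply: ltW; near: s; exact: lt_nbhsl.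
  apply: le_trans u1; have s0 : 0 < s by near: s; exact: lt_nbhsr.
  lra.
have d2 := near_eq_is_derive near d1.
(* Only the difference of [x] and its integral is known to be differentiable. Adding back the
   increment of [G], the antiderivative of [g] along [y], shows that [y] itself is. *)
have d3 := is_deriveB (hG t) (is_derive_lag (hG (t - nf_tau1 S))).
have d4 := is_deriveD d2 d3.
rewrite (_ : _ + _ = y i) in d4; last by apply/funext => s; rewrite !fctE subrK.
apply: (is_derive_eq d4).
rewrite (@nf_rhs_entry _ _ _ (y i) (Y i)) //; last first.
  by move=> u /andP[u1 u2]; rewrite yE //; lra.
have -> : \row_l y l t = x t by apply/rowP => l; rewrite mxE yE //; lra.
rewrite /=; ring.
Unshelve. all: by end_near.
Qed.

Lemma ode_solution (n : nat) (S : nfde R n) (x X : 'I_n -> R -> R) :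
  0 < nf_tau1 S -> 0 < nf_tau2 S -> continuous (nf_g S) ->
  (forall i, continuous (x i)) -> (forall i (t : R), is_derive t 1 (X i) (x i t)) ->
  (forall i (t : R), 0 < t -> is_derive t 1 (x i)
      (nf_g S (x i t) - nf_g S (x i (t - nf_tau1 S)) - nf_a S * x i t
       - nf_alpha S * nf_f S (X i t - X i (t - nf_tau2 S)) - nf_h S (\row_l x l t) 0 i)) ->
  is_solution S +oo%E (fun t => \row_i x i t).
Proof.
move=> t10 t20 cg cx hX dx; split.
  apply: continuous_subspaceT => t; apply/cvgrPdist_lt => e e0.
  have : \forall s \near t, forall i, `|x i t - x i s| < e.
    apply: (@filter_forall _ _ (fun i s => `|x i t - x i s| < e) (nbhs t)) => i.
    by have /cvgrPdist_lt /(_ _ e0) := cx i t.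
  by apply: filterS => s hs; apply: rV_norm_lt => // i; rewrite !mxE.
move=> t t0 _; apply/is_derive_rowP => i.
have [G hG] := antiderivative (fun u => continuous_comp (cx i u) (cg _)).
have E s : nf_lhs S (fun t => \row_i x i t) s 0 i = x i s - (G s - G (s - nf_tau1 S)).
  by apply: nf_lhs_entry => // u _; rewrite mxE.
have -> : (fun s => nf_lhs S (fun t => \row_i x i t) s 0 i) =
    x i - (G - (fun s => G (s - nf_tau1 S))).
  by apply/funext => s; rewrite E !fctE.
apply: (is_derive_eq (is_deriveB (dx i t t0) (is_deriveB (hG t) (is_derive_lag (hG (t - nf_tau1 S)))))).
rewrite (@nf_rhs_entry _ _ _ (x i) (X i)) //=; last by move=> u _; rewrite mxE.
ring.
Qed.

Lemma eq_increment (f F d : R -> R) (p q : R) : p <= q -> continuous f -> continuous F ->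
  (forall t, p < t < q -> is_derive t 1 f (d t)) ->
  (forall t, p < t < q -> is_derive t 1 F (d t)) -> f q - f p = F q - F p.
Proof.
by move=> pq cf cF hf hF; apply/eqP; rewrite eq_le !(le_increment (df := d) (dF := d)).
Qed.

(* Clipping the unknowns makes the vector field bounded; the a priori bound shows that the
   clipped solution never reaches the thresholds. *)
Lemma small_solution_exists (n : nat) (a alpha tau1 tau2 tau rho Bh : R) (f g : R -> R)
   (h : 'rV[R]_n -> 'rV[R]_n) (phi : 'I_n -> R -> R) :
  0 < tau1 -> 0 < tau2 -> tau1 <= tau -> tau2 <= tau -> 0 <= rho ->
  continuous f -> continuous g -> continuous h ->
  (forall v : 'rV[R]_n, (forall i, `|v 0 i| <= rho) -> forall i, `|h v 0 i| <= Bh) ->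
  (forall i, continuous (phi i)) -> (forall i t, - tau <= t <= 0 -> `|phi i t| <= rho) ->
  let ode (x X : 'I_n -> R -> R) (t : R) i := is_derive t 1 (x i) (g (x i t) - g (x i (t - tau1)) - a * x i t
         - alpha * f (X i t - X i (t - tau2)) - h (\row_l x l t) 0 i) in
  (forall T (x X : 'I_n -> R -> R), (forall i, continuous (x i)) ->
    (forall i t, t <= 0 -> x i t = phi i t) -> (forall i (t : R), is_derive t 1 (X i) (x i t)) ->
    (forall t, 0 < t < T -> (forall s i, - tau <= s <= t -> `|x i s| <= rho) ->
       forall i, ode x X t i) ->
    forall t i, 0 <= t <= T -> `|x i t| <= rho) ->
  exists x X : 'I_n -> R -> R, [/\ forall i, continuous (x i),
    forall i t, t <= 0 -> x i t = phi i t, forall i (t : R), is_derive t 1 (X i) (x i t) &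
    forall i t, 0 < t -> ode x X t i].
Proof.
move=> t10 t20 t1t t2t r0 cf cg ch hB cphi phir ode dec.
have [Phi hPhi] : exists Phi : 'I_n -> R -> R, forall i (t : R), is_derive t 1 (Phi i) (phi i t).
  by have [Y hY] := choice (fun i => antiderivative (cphi i)); exists Y.
have cPhi i : continuous (Phi i) by exact: is_derive_continuous (hPhi i).
have r20 : 0 <= tau2 * rho by rewrite mulr_ge0 // ltW.
have [x [J [x0 J0 cx cJ dxJ]]] := clipped_solution a alpha (ltW t10) (ltW t20) r0 r20 cf cg ch hB
  cphi cPhi.
have [X hX] : exists X : 'I_n -> R -> R, forall i (t : R), is_derive t 1 (X i) (x i t).
  by have [Y hY] := choice (fun i => antiderivative (cx i)); exists Y.
have cX i : continuous (X i) by exact: is_derive_continuous (hX i).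
have small t : 0 < t -> (forall s i, - tau <= s <= t -> `|x i s| <= rho) -> forall i, ode x X t i.
  move=> t0 xs i.
  (* While [x] stays within [rho], clipping has no effect and [J], like [X], has derivative [x]. On
     negative times [J] is [Phi], an antiderivative of the history; a window that straddles 0 is
     split there. *)
  have inc1 p q : 0 <= p -> p <= q -> q <= t -> J i q - J i p = X i q - X i p.
    move=> p0 pq qt; apply: (@eq_increment _ _ (x i)) => // u /andP[pu uq].
    have [_] := dxJ i u (le_lt_trans p0 pu); rewrite clip_id //; apply: xs; lra.
  have inc2 p : p <= 0 -> J i 0 - J i p = X i 0 - X i p.
    move=> p0; rewrite !J0 //; apply: (@eq_increment _ _ (x i)) => // u /andP[pu u0].
    by rewrite x0 // ltW.
  have JX : J i t - J i (t - tau2) = X i t - X i (t - tau2).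
    have [tt|tt] := leP 0 (t - tau2); first by apply: inc1 => //; lra.
    have := inc1 0 t (lexx 0) (ltW t0) (lexx t); have := inc2 _ (ltW tt); lra.
  have XB : `|X i t - X i (t - tau2)| <= tau2 * rho.
    have tt : t - tau2 < t by lra.
    have [u /andP[u1 u2] ->] := mean_value tt (cX i) (fun s _ => hX i s).
    rewrite normrM mulrC; apply: ler_pM => //; last by apply: xs; lra.
    by rewrite gtr0_norm; lra.
  have xt : `|x i t| <= rho by apply: xs; lra.
  have xt1 : `|x i (t - tau1)| <= rho by apply: xs; lra.
  have [d _] := dxJ i t t0; rewrite !clip_id // ?JX // in d.
  rewrite /ode (_ : \row_l x l t = \row_l clip rho (x l t)) //.
  by apply/rowP => l; rewrite !mxE clip_id //; apply: xs; lra.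
exists x, X; split => // i t t0.
apply: (small) => // s k /andP[s1 s2]; have [s0|s0] := leP s 0.
  by rewrite x0 // phir // s1 s0.
apply: (dec t x X) => //; last by rewrite (ltW s0).
by move=> u /andP[u0 _]; exact: small.
Qed.

End Components.

(** * From a priori decay to asymptotic stability *)

Section Stability.
Variable R : realType.

Lemma asymptotic_stability_of_decay (n : nat) (S : nfde R n) (r0 : R) :
  0 < nf_tau1 S -> 0 < nf_tau2 S -> continuous (nf_f S) -> continuous (nf_g S) ->
  continuous (nf_h S) -> nf_h S 0 = 0 -> 0 < r0 ->
  (forall rho, 0 < rho <= r0 -> exists sg K : R, [/\ 0 < sg, 1 <= K &
    forall (T delta : R) (x X : 'I_n -> R -> R), 0 <= delta -> K * delta < rho ->
    (forall i, continuous (x i)) ->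
    (forall i t, - delay S <= t <= 0 -> `|x i t| <= delta) ->
    (forall i (t : R), is_derive t 1 (X i) (x i t)) ->
    (forall t, 0 < t < T -> (forall s i, - delay S <= s <= t -> `|x i s| <= rho) ->
       forall i, is_derive t 1 (x i) (nf_g S (x i t) - nf_g S (x i (t - nf_tau1 S))
         - nf_a S * x i t - nf_alpha S * nf_f S (X i t - X i (t - nf_tau2 S))
         - nf_h S (\row_l x l t) 0 i)) ->
    forall t i, 0 <= t <= T -> `|x i t| <= K * delta * expR (- (sg * t)) /\ `|x i t| < rho]) ->
  locally_asymptotically_stable S 0.
Proof.
move=> t10 t20 cf cg ch h0 r00 decay.
have tau1 : nf_tau1 S <= delay S by rewrite /delay le_max lexx.
have tau2 : nf_tau2 S <= delay S by rewrite /delay le_max lexx orbT.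
have tau0 : - delay S <= 0 by rewrite oppr_le0 (le_trans (ltW t10)).
have [rB [rB0 hB]] : exists rB : R, 0 < rB /\ forall v : 'rV[R]_n,
    (forall i, `|v 0 i| <= rB) -> forall i, `|nf_h S v 0 i| <= 1.
  have /cvgrPdist_le /(_ _ ltr01) /nbhs_ballP [d /= d0 hd] := ch 0.
  exists (d / 2); split; first by rewrite divr_gt0.
  move=> v vd i; have : ball (0 : 'rV[R]_n) d v.
    rewrite mx_norm_ball /ball_ /= sub0r normrN; apply: rV_norm_lt => // j.
    by apply: le_lt_trans (vd j) _; rewrite ltr_pdivrMr // ltr_pMr // ltr1n.
  move=> /hd; rewrite h0 sub0r normrN; apply: le_trans; exact: entry_norm_le.
(* Both halves of the conclusion follow from this: stability from the bound by [eps], attractivity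
   from the exponential bound with [eps = 1]. *)
have key (eps : R) : 0 < eps -> exists sg K delta : R, [/\ 0 < sg, 0 < K, 0 < delta &
    forall phi, near_history S 0 delta phi ->
      (exists x, solution_from S +oo%E phi x) /\
      (forall (T : \bar R) x, solution_from S T phi x ->
         forall t : R, 0 <= t -> (t%:E < T)%E ->
         forall i, `|x t 0 i| <= K * expR (- (sg * t)) /\ `|x t 0 i| < eps)].
  move=> eps0; pose rho := Num.min (Num.min r0 rB) eps.
  have rho0 : 0 < rho by rewrite !lt_min r00 rB0 eps0.
  have rhor : rho <= r0 by rewrite /rho !ge_min lexx.
  have rhoB : rho <= rB by rewrite /rho !ge_min lexx orbT.
  have rhoe : rho <= eps by rewrite /rho !ge_min lexx orbT.
  have [|sg [K [sg0 K1 dec]]] := decay rho; first by rewrite rho0.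
  have K0 : 0 < K by apply: lt_le_trans K1.
  (* The factor 2 makes [K * delta < rho] strict. *)
  pose delta := rho / (2 * K).
  have delta0 : 0 < delta by rewrite divr_gt0 // mulr_gt0.
  have Kd : K * delta < rho.
    rewrite (_ : K * delta = rho / 2); first by rewrite ltr_pdivrMr // ltr_pMr // ltr1n.
    by rewrite /delta; field; rewrite gt_eqF.
  exists sg, (K * delta), delta; split => //; first exact: mulr_gt0.
  move=> phi [cphi phid].
  have phid' s i : - delay S <= s <= 0 -> `|phi s 0 i| <= delta.
    move=> /phid; rewrite subr0 => /ltW; apply: le_trans; exact: entry_norm_le.
  have deltarho : delta <= rho by apply: le_trans (ltW Kd); rewrite ler_peMl // ltW.
  split; last first.
    move=> T x [sx x0] t t0 tT i.
    have [y [Y [cy yx hY dy]]] := solution_ode t10 t20 cg sx t0 tT.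
    have [] := dec t delta y Y (ltW delta0) Kd cy _ hY _ t i _.
    - by move=> k s /andP[s1 s2]; rewrite yx ?x0 ?phid' ?s1 ?s2 //= (le_trans s2).
    - by move=> s hs _ k; exact: dy.
    - by rewrite t0 lexx.
    rewrite yx ?lexx ?andbT ?(le_trans _ t0) // => h1 h2; split => //.
    exact: lt_le_trans rhoe.
  pose ph i t := phi (clamp (- delay S) 0 t) 0 i.
  have cph i : continuous (ph i).
    apply: continuous_clamp_entry tau0 _ cphi => t; by rewrite /= in_itv.
  have phE i t : - delay S <= t <= 0 -> ph i t = phi t 0 i by move=> ht; rewrite /ph clamp_id.
  have phB i t : - delay S <= t <= 0 -> `|ph i t| <= delta by move=> ht; rewrite phE // phid'.
  have [||x [X [cx x0 hX dx]]] := @small_solution_exists R n (nf_a S) (nf_alpha S) (nf_tau1 S)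
    (nf_tau2 S) (delay S) rho 1 (nf_f S) (nf_g S) (nf_h S) ph t10 t20 tau1 tau2 (ltW rho0) cf cg ch
    (fun v hv => hB v (fun i => le_trans (hv i) rhoB)) cph.
  - by move=> i t ht; apply: (le_trans (phB i t ht)).
  - move=> T x X cx x0 hX dx t i ht; apply: ltW.
    have hist k s : - delay S <= s <= 0 -> `|x k s| <= delta.
      by move=> hs; have /andP[_ s2] := hs; rewrite x0 // phB.
    by have [] := dec T delta x X (ltW delta0) Kd cx hist hX dx t i ht.
  exists (fun t => \row_i x i t); split; first exact: ode_solution hX dx.
  by move=> s /andP[s1 s2]; apply/rowP => i; rewrite mxE x0 // phE // s1 s2.
split.
  move=> eps eps0; have [sg [K [delta [_ _ delta0 H]]]] := key eps eps0.
  exists delta => // phi /H [ex est]; split => // T x sx t t0 tT.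
  by rewrite subr0; apply: rV_norm_lt => // i; have [] := est T x sx t t0 tT i.
have [sg [K [delta [sg0 K0 delta0 H]]]] := key 1 ltr01.
exists delta => // phi /H [_ est] x sx; apply/cvgrPdist_lt => e e0.
near=> t; have t0 : 0 <= t by near: t; apply: nbhs_pinfty_ge; exact: num_real.
rewrite sub0r normrN; apply: rV_norm_lt => // i.
have [h1 _] := est _ x sx t t0 (ltry t) i; apply: le_lt_trans h1 _.
rewrite expRN ltr_pdivrMr ?expR_gt0 // -ltr_pdivrMl //.
apply: lt_le_trans (expR_ge1Dx _).
(* By [exp u >= 1 + u] it is enough that [sg t] exceeds [K / e]. *)
have : e^-1 * K / sg < t by near: t; apply: nbhs_pinfty_gt; exact: num_real.
by rewrite ltr_pdivrMr // [t * _]mulrC => Kt; apply: (lt_trans Kt); rewrite ltrDr.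
Unshelve. all: by end_near.
Qed.

End Stability.

Theorem theorem5p1p1 (R : realType) (n r : nat) (Gamma0 : {group 'S_n})
  (a tau1 tau2 b gamma kappa alpha0 : R)
  (f g : R -> R) (h : 'rV[R]_n -> 'rV[R]_n) (C : 'M[R]_n)
  (mu : 'I_r.+1 -> R) (V_ : 'I_r.+1 -> 'M[R]_n)
  (a_gt0 : 0 < a) (tau1_gt0 : 0 < tau1) (tau2_gt0 : 0 < tau2)
  (f_equiv : equivariant Gamma0 (map_mx f))
  (g_equiv : equivariant Gamma0 (map_mx g))
  (h_equiv : equivariant Gamma0 h)
  (f_cont : continuous (map_mx f : 'rV[R]_n -> 'rV[R]_n))
  (g_cont : continuous (map_mx g : 'rV[R]_n -> 'rV[R]_n))
  (h_cont : continuous h)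
  (f_diff : differentiable (map_mx f : 'rV[R]_n -> 'rV[R]_n) 0)
  (g_diff : differentiable (map_mx g : 'rV[R]_n -> 'rV[R]_n) 0)
  (h_diff : differentiable h 0)
  (b_def : b = derive1 f 0) (gamma_def : gamma = derive1 g 0)
  (C_def : C = jacobian h 0)
  (b_neq0 : b != 0) (gamma_gt0 : 0 < gamma) (gamma_lt1 : gamma < 1)
  (C_equiv : equivariant_mx Gamma0 C) (C_sym : C^T = C)
  (kappa_ge0 : 0 <= kappa) (kappa_lt1 : kappa < 1)
  (g_lip : kappa.-lipschitz (map_mx g : 'rV[R]_n -> 'rV[R]_n))
  (mu_inj : injective mu)
  (mu_eigen : forall c : R, eigenvalue C c <-> exists j, c = mu j)
  (V_isotypic : isotypic_decomposition Gamma0 V_)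
  (V_eigen : forall j, (eigenspace C (mu j) :=: V_ j)%MS)
  (alpha0_def : smallest_critical b gamma tau1 tau2 a mu alpha0)
  (gamma_tau1_gt0 : 0 < gamma * tau1) (gamma_tau1_le1 : gamma * tau1 <= 1)
  (b_gt0 : 0 < b) (aj_gt0 : forall j, 0 < a + mu j) :
  forall alpha : R, 0 < alpha -> alpha < alpha0 ->
    [/\ consensus (0 : 'rV[R]_n),
        equilibrium (Nfde a tau1 tau2 alpha f g h) 0
      & locally_asymptotically_stable (Nfde a tau1 tau2 alpha f g h) 0].
Proof.
move=> alpha al0 al1.
(* The dimension is positive because [mu ord0] has an eigenvector; scalar properties of [f] and [g]
   are not visible from [map_mx] otherwise. *)
have [i0 _] : exists i0 : 'I_n, True.
  have /eigenvalueP [v _ /rV0Pn [i _]] : eigenvalue C (mu ord0) by apply/mu_eigen; exists ord0.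
  by exists i.
have f0 : f 0 = 0 by have := scalar_odd i0 0 f_equiv; rewrite oppr0; lra.
have g0 : g 0 = 0 by have := scalar_odd i0 0 g_equiv; rewrite oppr0; lra.
have h0 : h 0 = 0.
  apply/rowP => i; have := equivariant_odd 0 h_equiv.
  by rewrite oppr0 => /rowP /(_ i); rewrite !mxE; lra.
have cf := scalar_continuous i0 f_cont; have cg := scalar_continuous i0 g_cont.
have [Q [lam [uQ CQ]]] := isotypic_diagonalizable mu_inj V_isotypic V_eigen.
have t1d : tau1 <= Num.max tau1 tau2 by rewrite le_max lexx.
have t2d : tau2 <= Num.max tau1 tau2 by rewrite le_max lexx orbT.
split; first by move=> i k; rewrite !mxE.
  have -> : (0 : 'rV[R]_n) = \row_i 0 by apply/rowP => i; rewrite !mxE.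
  apply: (@ode_solution _ _ _ (fun _ _ => 0) (fun _ _ => 0)) => //.
  by move=> i; exact: cst_continuous.
  move=> i t _; apply: (is_derive_eq (is_derive_cst (0 : R) t (1 : R))).
  rewrite (_ : \row_l 0 = 0) /= ?h0; last by apply/rowP => l; rewrite !mxE.
  by rewrite mxE !subrr f0 !mulr0 !subr0.
have [||r0 [r00 dec]] := nonlinear_decay (f := f) (g := g) (h := h) (a := a) (alpha := alpha) (b := b)
  (gamma := gamma) uQ CQ tau1_gt0 tau2_gt0 t1d t2d.
(* Diagonal entries are indexed by coordinates, with multiplicity, and each is one of the
   eigenvalues [mu j'] that occur in the critical equations. *)
- move=> j; have /mu_eigen [j' ->] := diagonal_eigenvalue j uQ CQ.
  by apply: subcritical_gain alpha0_def al0 al1 => //; exact: ltW.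
- move=> e e0.
  have [r1 [r10 h1]] := scalar_remainder i0 f0 f_diff e0.
  have [r2 [r20 h2]] := scalar_remainder i0 g0 g_diff e0.
  have [r3 [r30 h3]] := vector_remainder h0 h_diff e0.
  exists (Num.min r1 (Num.min r2 r3)); split; first by rewrite !lt_min r10 r20 r30.
  rewrite b_def gamma_def C_def; split.
  + by move=> u; rewrite !le_min => /and3P[? _ _]; exact: h1.
  + by move=> u; rewrite !le_min => /and3P[_ ? _]; exact: h2.
  + by move=> u hu i; apply: h3 => l; have := hu l; rewrite !le_min => /and3P[].
exact: (@asymptotic_stability_of_decay _ _ (Nfde a tau1 tau2 alpha f g h) r0).
Qed.
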